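(* Let $p\ge 0$ be an integer, $n=2p+1$ and $R>0$. Then the magnitude of the closed Euclidean ball $B^n_R\subset\mathbb{R}^n$ of radius $R$ is \[\left|B^n_R\right|=\frac{\det[\chi_{i+j+2}(R)]_{i,j=0}^p}{n!\,R\,\det[\chi_{i+j}(R)]_{i,j=0}^p}.\]
   Context: The reverse Bessel polynomials $\chi_i(R)\in\mathbb{Z}[R]$ are defined by $\chi_0(R)=1$, $\chi_1(R)=R$ and $\chi_{i+2}(R)=R^2\chi_i(R)+(2i+1)\chi_{i+1}(R)$ for $i\ge 0$. Magnitude: for a finite metric space $A$, a weighting is a function $w\colon A\to\mathbb{R}$ with $\sum_{x\in A}w(x)e^{-d(x,s)}=1$ for all $s\in A$, and the magnitude $|A|$ is $\sum_x w(x)$ (independent of the weighting; weightings exist for finite subsets of Euclidean space). For a compact subset $X$ of Euclidean space, the magnitude is $|X|=\lim_i|A_i|$ for any sequence of finite subsets $A_i\subset X$ converging to $X$ in the Hausdorff metric (Leinster–Meckes). *)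

(* Defs.v *)
From HB Require Import structures.
From mathcomp Require Import all_boot all_order all_algebra.
From mathcomp Require Import all_classical all_reals all_analysis.
From mathcomp Require Import finmap.

Set Implicit Arguments.
Unset Strict Implicit.
Unset Printing Implicit Defensive.

Import Order.TTheory GRing.Theory Num.Theory.
Import numFieldNormedType.Exports.
Local Open Scope ring_scope.
Local Open Scope classical_set_scope.

(* Reverse Bessel polynomials chi_i in Z[X]:
   chi_0 = 1, chi_1 = X, chi_{i+2} = X^2 chi_i + (2i+1) chi_{i+1}.
   chi_pair i = (chi_i, chi_{i+1}). *)
Fixpoint chi_pair (i : nat) : {poly int} * {poly int} :=
  match i with
  | 0 => (1, 'X)
  | i'.+1 => let: (a, b) := chi_pair i' in
             (b, 'X ^+ 2 * a + ((2 * i' + 1)%N)%:R * b)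
  end.

Definition chi (i : nat) : {poly int} := (chi_pair i).1.

Definition chiR (R : realType) (i : nat) (r : R) : R :=
  (map_poly (fun z : int => z%:~R) (chi i)).[r].

Definition edist (R : realType) (n : nat) (x y : 'rV[R]_n) : R :=
  Num.sqrt (\sum_(k < n) (x 0 k - y 0 k) ^+ 2).

Definition closed_ball_eucl (R : realType) (n : nat) (r : R) : set 'rV[R]_n :=
  [set x | edist x 0 <= r].

Arguments closed_ball_eucl {R} n r.

Local Open Scope fset_scope.

Definition is_weighting (R : realType) (n : nat) (A : {fset 'rV[R]_n})
    (w : 'rV[R]_n -> R) : Prop :=
  forall s, s \in A -> \sum_(x <- A) w x * expR (- edist x s) = 1.

(* m is the magnitude of the finite set A: m = sum_x w(x) for a weighting w
   (independent of the weighting). *)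
Definition finite_magnitude (R : realType) (n : nat) (A : {fset 'rV[R]_n})
    (m : R) : Prop :=
  exists w, is_weighting A w /\ m = \sum_(x <- A) w x.

Definition hausdorff_cvg (R : realType) (n : nat) (A : nat -> {fset 'rV[R]_n})
    (X : set 'rV[R]_n) : Prop :=
  forall eps : R, 0 < eps -> exists N : nat, forall i : nat, (N <= i)%N ->
    (forall x, X x -> exists2 a, a \in A i & edist x a < eps) /\
    (forall a, a \in A i -> exists2 x, X x & edist x a < eps).

(* Magnitude of a compact subset X of Euclidean space (Leinster--Meckes):
   |X| = v means that for every sequence of finite subsets A_i of X converging
   to X in the Hausdorff metric, the magnitudes |A_i| converge to v. *)
Definition has_magnitude (R : realType) (n : nat) (X : set 'rV[R]_n) (v : R)
    : Prop :=
  forall (A : nat -> {fset 'rV[R]_n}) (m : nat -> R),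
    (forall i a, a \in A i -> X a) ->
    hausdorff_cvg A X ->
    (forall i, finite_magnitude (A i) (m i)) ->
    m @ \oo --> v.

(* Main.v *)
From Pilot Require Import Defs.
From HB Require Import structures.
From mathcomp Require Import all_boot all_order all_algebra.
From mathcomp Require Import all_classical all_reals all_analysis.
From mathcomp Require Import finmap.
From mathcomp Require Import ring lra zify.
(* exp (- |x - y|) is positive definite. Hence, if V is a finite signed measure
   on the ball whose potential, the integral of exp (- |x - y|) over V (dy), is
   uniformly close to 1 on the ball, comparing the energies of V and of the
   weighting of a finite subset A shows that |A| is at most the energy of V up to
   a small error, and close to the mass of V when A is dense in the ball. It
   remains to find such V whose masses and energies tend to the stated value.

   V is a superposition of uniform measures on spheres |y| = rho. With n = 2p + 1,
   the average of exp (- |x - y|) over such a sphere is, for |x| <= rho, equal to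
   sum_k A_k psi_k (rho) p_k (|x|^2), where psi_k = (- (1/s) d/ds)^k exp (- s), the
   functions p_k (|x|^2) are regular at 0 and Delta p_k = p_k + p_(k-1); this
   follows from the maximum principle by descending induction on k. The density
   rho^(2p) / (2p)! on 0 < rho < r then has potential
   1 - sum_k tau_k p_k (|x|^2), and the sum is cancelled by a distribution of
   order p on |y| = r, which is approximated by backward differences of spheres.
   The coefficients of this distribution solve a linear system with matrix
   psi_(j+m) (r) up to scaling, and Cramer's rule yields the quotient of Hankel
   determinants, since chi_j (r) = exp r * r^(2j) * psi_j (r). *)
Set Implicit Arguments.
Unset Strict Implicit.
Unset Printing Implicit Defensive.
Import Order.TTheory GRing.Theory Num.Theory.
Import numFieldNormedType.Exports.
Local Open Scope ring_scope.
Local Notation edist := Pilot.Defs.edist.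

(** * Nonnegative combinations of exponentials *)

(** No integration is used. Measures are finite lists of weighted points, and near minimizers of the
    energy among finite probabilities on a sphere replace its uniform measure. By convexity their
    potentials converge uniformly, and reflections preserve near minimality, so the limit is
    rotation invariant; an ultrafilter extends it to averages of all bounded functions. All spheres
    must lie in the ball, so near its boundary a point x may have |x| > rho, where the expansion in
    p_k (|x|^2) is not the average. The two differ by O((|x| - rho)^(2p+1)). Differences of step e
    have coefficients of size e^(-p), so the potential errs by O(e^(p+1)), and the energy, which
    brings in the total variation once more, by O(e): one power is left over. The upper bound for
    |A| contains the total variation of the weighting of A, which is not under control, so V is
    chosen after A. The lower bound contains only the energy of the weighting, which is |A| itself
    and already bounded. *)

Section Limits.
Variable R : realType.
Local Open Scope classical_set_scope.

Lemma cvg_sum_seq (T : Type) (F : set_system T) {FF : Filter F} (I : Type) (s : seq I)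
    (u : T -> I -> R) (l : I -> R) :
  (forall i, u k i @[k --> F] --> l i) ->
  \sum_(i <- s) u k i @[k --> F] --> \sum_(i <- s) l i.
Proof.
move=> cu; elim: s => [|i s IH].
  by under eq_fun do rewrite big_nil; rewrite big_nil; exact: cvg_cst.
under eq_fun do rewrite big_cons; rewrite big_cons.
by apply: cvgD => //; exact: cu.
Qed.

Lemma cvg_lin_comb (T : Type) (F : set_system T) {FF : Filter F} (I : Type) (s : seq I)
    (c : I -> R) (u : T -> I -> R) (l : I -> R) :
  (forall i, u k i @[k --> F] --> l i) ->
  \sum_(i <- s) c i * u k i @[k --> F] --> \sum_(i <- s) c i * l i.
Proof. by move=> cu; apply: cvg_sum_seq => i; apply: cvgM; [exact: cvg_cst|]. Qed.

Lemma lin_comb_ge0_lim (T : Type) (F : set_system T) {FF : ProperFilter F} (I : Type)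
    (s : seq I) (c : I -> R) (u : T -> I -> R) (l : I -> R) :
  (forall k, 0 <= \sum_(i <- s) c i * u k i) ->
  (forall i, u k i @[k --> F] --> l i) ->
  0 <= \sum_(i <- s) c i * l i.
Proof.
move=> h cu.
have H : \sum_(i <- s) c i * u k i @[k --> F] --> \sum_(i <- s) c i * l i.
  exact: cvg_lin_comb.
by apply: (cvgr_to_ge H); exact: nearW.
Qed.

End Limits.

Section SquareRootIteration.
Variable R : realType.
Local Open Scope classical_set_scope.
Implicit Types (p q : {poly R}) (x t : R).

Definition nneg_coef p := forall i, 0 <= p`_i.

Lemma nneg_coefC (c : R) : 0 <= c -> nneg_coef c%:P.
Proof. by move=> c0 i; rewrite coefC; case: ifP. Qed.

Lemma nneg_coefX : nneg_coef 'X.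
Proof. by move=> i; rewrite coefX; exact: ler0n. Qed.

Lemma nneg_coefD p q : nneg_coef p -> nneg_coef q -> nneg_coef (p + q).
Proof. by move=> hp hq i; rewrite coefD addr_ge0. Qed.

Lemma nneg_coefM p q : nneg_coef p -> nneg_coef q -> nneg_coef (p * q).
Proof. by move=> hp hq i; rewrite coefM sumr_ge0// => j _; rewrite mulr_ge0. Qed.

Lemma nneg_coefXn p m : nneg_coef p -> nneg_coef (p ^+ m).
Proof.
move=> hp; elim: m => [|m IH]; first by rewrite expr0; exact: nneg_coefC.
by rewrite exprS; exact: nneg_coefM.
Qed.

Lemma nneg_coef_sum (I : Type) (s : seq I) (P : I -> {poly R}) :
  (forall i, nneg_coef (P i)) -> nneg_coef (\sum_(i <- s) P i).
Proof.
move=> hP; elim: s => [|i s IH]; first by rewrite big_nil; exact: nneg_coefC.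
by rewrite big_cons; exact: nneg_coefD.
Qed.

(* The fixed point of y = (X + y^2) / 2 is 1 - sqrt (1 - X), so every Taylor
   coefficient of the latter is nonnegative. *)
Fixpoint sqrt_iter k : {poly R} :=
  if k is k'.+1 then 2^-1%:P * ('X + sqrt_iter k' ^+ 2) else 0.

Lemma nneg_sqrt_iter k : nneg_coef (sqrt_iter k).
Proof.
elim: k => [|k IH] /=; first by exact: nneg_coefC.
apply: nneg_coefM; first by apply: nneg_coefC; rewrite invr_ge0.
by apply: nneg_coefD; [exact: nneg_coefX|exact: nneg_coefXn].
Qed.

(** With s = sqrt (1 - x), one step turns the error e into e (1 - s - e / 2) <= e (1 - e / 2). The
    last expression increases for e <= 1 and sends 2 / K below 2 / (K + 1). The rate is uniform up
    to x = 1, where the iteration is not a contraction. *)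
Lemma sqrt_iter_bound k x : 0 <= x <= 1 ->
  0 <= 1 - Num.sqrt (1 - x) - (sqrt_iter k).[x] <= 2 / k.+2%:R.
Proof.
move=> /andP[x0 x1]; set s := Num.sqrt (1 - x).
have s0 : 0 <= s by exact: sqrtr_ge0.
have sE : s ^+ 2 = 1 - x by rewrite sqr_sqrtr// subr_ge0.
have s1 : s <= 1 by rewrite -(@ler_pXn2r _ 2)// ?nnegrE// sE expr1n gerBl.
elim: k => [|k /andP[IH1 IH2]] /=.
  by rewrite horner0 subr0 subr_ge0 s1 /= divff// gerBl.
rewrite !hornerE; set y := (sqrt_iter k).[x] in IH1 IH2 *.
have y0 : 0 <= y.
  rewrite /y horner_coef sumr_ge0// => i _.
  by rewrite mulr_ge0 ?exprn_ge0//; exact: nneg_sqrt_iter.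
have -> : 1 - s - 2^-1 * (x + y ^+ 2) = (1 - s - y) * (1 - s + y) / 2.
  have -> : x = 1 - s ^+ 2 by rewrite sE; ring.
  by field.
set e := 1 - s - y in IH1 IH2 *.
apply/andP; split; first by rewrite divr_ge0 ?mulr_ge0// addr_ge0// subr_ge0.
have e1 : e <= 1 by rewrite /e; lra.
have h1 : e * (1 - s + y) / 2 <= e * (1 - e / 2).
  rewrite -mulrA ler_wpM2l// /e; lra.
apply: (le_trans h1).
have k0 : 0 < k.+2%:R :> R by rewrite ltr0n.
have k1 : 0 < k.+3%:R :> R by rewrite ltr0n.
have kE : k.+3%:R = k.+2%:R + 1 :> R by rewrite -natr1.
have k2 : 2 <= k.+2%:R :> R by rewrite ler_nat.
set K : R := k.+2%:R in IH2 k0 k2 kE *; rewrite kE.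
have h2 : e * (1 - e / 2) <= 2 / K * (1 - K^-1).
  have d0 : 0 <= 2 / K - e by rewrite subr_ge0.
  have d1 : 2 / K <= 1 by rewrite ler_pdivrMr// mul1r.
  rewrite -subr_ge0.
  have -> : 2 / K * (1 - K^-1) - e * (1 - e / 2) = (2 / K - e) * (1 - (2 / K + e) / 2).
    by field; lra.
  by rewrite mulr_ge0// subr_ge0 ler_pdivrMr// mul1r -[leRHS]/(1 + 1 : R) lerD.
apply: (le_trans h2).
rewrite ler_pdivlMr ?addr_gt0//.
have -> : 2 / K * (1 - K^-1) * (K + 1) = 2 - 2 / K ^+ 2 by field; lra.
by rewrite gerBl divr_ge0// sqr_ge0.
Qed.

Lemma cvg_sqrt_iter x : 0 <= x <= 1 ->
  (sqrt_iter k).[x] @[k --> \oo] --> 1 - Num.sqrt (1 - x).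
Proof.
move=> x01; apply/cvgrPdist_le => e e0.
have := @cvg_harmonic R => /cvgr0Pnorm_le/(_ (e / 2)) [|N _ HN]; first by rewrite divr_gt0.
exists N => // k /= Nk.
have /andP[h1 h2] := sqrt_iter_bound k x01.
rewrite ger0_norm//; apply: (le_trans h2).
have := HN k Nk; rewrite /= ger0_norm ?harmonic_ge0// /harmonic /= => h3.
apply: (@le_trans _ _ (2 / k.+1%:R)).
  by rewrite ler_pM2l// lef_pV2 ?posrE ?ltr0n// ler_nat.
by rewrite -ler_pdivlMl// mulrC.
Qed.

End SquareRootIteration.

Section Subordination.
Variable R : realType.
Local Open Scope classical_set_scope.
Implicit Types (x t : R).

Lemma cvg_exp_partial x :
  \sum_(i < k) x ^+ i / i`!%:R @[k --> \oo] --> expR x.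
Proof.
have h := @is_cvg_series_exp_coeff R x.
have -> : (fun k => \sum_(i < k) x ^+ i / i`!%:R) = series (exp_coeff x).
  by apply/funext => k; rewrite /series /= big_mkord.
exact: h.
Qed.

Lemma horner_nneg_coef_ge0 (I : Type) (s : seq I) (c X : I -> R) (p : {poly R}) :
  (forall m, 0 <= \sum_(i <- s) c i * X i ^+ m) -> nneg_coef p ->
  0 <= \sum_(i <- s) c i * p.[X i].
Proof.
move=> hX hp.
have -> : \sum_(i <- s) c i * p.[X i] =
          \sum_(m < size p) p`_m * \sum_(i <- s) c i * X i ^+ m.
  under eq_bigr do rewrite horner_coef mulr_sumr.
  rewrite exchange_big /=; apply: eq_bigr => m _.
  by rewrite mulr_sumr; apply: eq_bigr => i _; rewrite mulrCA.
by apply: sumr_ge0 => m _; rewrite mulr_ge0.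
Qed.

(** The function is exp (- a) times exp (a (1 - sqrt (1 - X))). Replacing 1 - sqrt (1 - X) by
    [sqrt_iter] and the exponential by a partial sum leaves a polynomial in X with nonnegative
    coefficients. *)
Lemma exp_sqrt_comb_ge0 (I : Type) (s : seq I) (c X : I -> R) (a : R) :
  0 <= a -> (forall i, 0 <= X i <= 1) ->
  (forall m, 0 <= \sum_(i <- s) c i * X i ^+ m) ->
  0 <= \sum_(i <- s) c i * expR (- (a * Num.sqrt (1 - X i))).
Proof.
move=> a0 X01 hX.
have h1 k : 0 <= \sum_(i <- s) c i * expR (a * (sqrt_iter R k).[X i]).
  apply: (@lin_comb_ge0_lim _ _ \oo _ _ _ _
    (fun N i => \sum_(j < N) (a * (sqrt_iter R k).[X i]) ^+ j / j`!%:R)).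
    move=> N; pose P := \sum_(j < N) (a%:P * sqrt_iter R k) ^+ j * (j`!%:R^-1)%:P.
    have -> : \sum_(i <- s) c i * (\sum_(j < N) (a * (sqrt_iter R k).[X i]) ^+ j / j`!%:R)
       = \sum_(i <- s) c i * P.[X i].
      apply: eq_bigr => i _; congr (_ * _); rewrite /P horner_sum.
      by apply: eq_bigr => j _; rewrite !hornerE.
    apply: horner_nneg_coef_ge0 => //.
    apply: nneg_coef_sum => j; apply: nneg_coefM; last first.
      by apply: nneg_coefC; rewrite invr_ge0.
    apply: nneg_coefXn; apply: nneg_coefM; first exact: nneg_coefC.
    exact: nneg_sqrt_iter.
  by move=> i; exact: cvg_exp_partial.
have h2 : 0 <= \sum_(i <- s) c i * expR (a * (1 - Num.sqrt (1 - X i))).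
  apply: (@lin_comb_ge0_lim _ _ \oo _ _ _ _ _ _ h1) => i.
  have h : a * (sqrt_iter R k).[X i] @[k --> \oo] --> a * (1 - Num.sqrt (1 - X i)).
    by apply: cvgM; [exact: cvg_cst|exact: cvg_sqrt_iter].
  exact: (continuous_cvg _ (@continuous_expR R _) h).
have -> : \sum_(i <- s) c i * expR (- (a * Num.sqrt (1 - X i))) =
    expR (- a) * \sum_(i <- s) c i * expR (a * (1 - Num.sqrt (1 - X i))).
  rewrite mulr_sumr; apply: eq_bigr => i _; rewrite mulrCA -expRD.
  by congr (_ * expR _); ring.
by rewrite mulr_ge0// expR_ge0.
Qed.

Lemma cvg_harmonic_exp_quotient x : 0 <= x ->
  (1 - expR (- (k.+1%:R^-1 * x))) * k.+1%:R @[k --> \oo] --> x.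
Proof.
move=> x0; apply/cvgrPdist_le => e e0.
have := @cvg_harmonic R => /cvgr0Pnorm_le/(_ (e / (x ^+ 2 + 1))) [|N _ HN].
  by rewrite divr_gt0// ltr_wpDl// sqr_ge0.
exists N => // k /= Nk.
have := HN k Nk; rewrite /= ger0_norm ?harmonic_ge0// /harmonic /= => h.
set K : R := k.+1%:R in h *.
have K0 : 0 < K by rewrite ltr0n.
set y := K^-1 * x.
have y0 : 0 <= y by rewrite mulr_ge0// invr_ge0 ltW.
have xE : x = y * K by rewrite /y mulrAC mulVf ?mul1r// gt_eqF.
have h1 : 1 - expR (- y) <= y by rewrite lerBlDl addrC -lerBlDl; have := expR_ge1Dx (- y); lra.
have h2 : y - y ^+ 2 <= 1 - expR (- y).
  have : expR (- y) <= (1 + y)^-1.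
    by rewrite expRN lef_pV2 ?posrE ?expR_gt0// ?expR_ge1Dx//; lra.
  have : (1 + y)^-1 <= 1 - y + y ^+ 2; last by lra.
  rewrite -div1r ler_pdivrMr; last by lra.
  have : 0 <= y ^+ 3 by rewrite exprn_ge0.
  have -> : (1 - y + y ^+ 2) * (1 + y) = 1 + y ^+ 3 by ring.
  by lra.
have -> : x - (1 - expR (- y)) * K = (y - (1 - expR (- y))) * K by rewrite [in RHS]mulrBl -xE.
rewrite ger0_norm; last by rewrite mulr_ge0 ?subr_ge0// ltW.
apply: (@le_trans _ _ (y ^+ 2 * K)); first by rewrite ler_pM2r//; lra.
have -> : y ^+ 2 * K = x ^+ 2 * K^-1 by rewrite /y; field; rewrite gt_eqF.
apply: (@le_trans _ _ (x ^+ 2 * (e / (x ^+ 2 + 1)))); first by rewrite ler_wpM2l// sqr_ge0.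
rewrite mulrA ler_pdivrMr; last by rewrite ltr_wpDl// sqr_ge0.
by rewrite mulrC ler_wpM2l// ?ltW//; lra.
Qed.

(* If a linear combination of point evaluations is nonnegative on all the
   exponentials t |-> exp (- a t), it is so on t |-> exp (- sqrt t): with
   X = exp (- t / k), the function exp (- sqrt (k (1 - X))) is a power series in X
   with nonnegative coefficients and tends to exp (- sqrt t). *)
Lemma exp_sqrt_subordination (I : Type) (s : seq I) (c tau : I -> R) :
  (forall i, 0 <= tau i) ->
  (forall a, 0 <= a -> 0 <= \sum_(i <- s) c i * expR (- (a * tau i))) ->
  0 <= \sum_(i <- s) c i * expR (- Num.sqrt (tau i)).
Proof.
move=> tau0 H.
have h k : 0 <= \sum_(i <- s) c i *
    expR (- Num.sqrt ((1 - expR (- (k.+1%:R^-1 * tau i))) * k.+1%:R)).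
  have k0 : 0 <= k.+1%:R^-1 :> R by rewrite invr_ge0.
  have := @exp_sqrt_comb_ge0 _ s c (fun i => expR (- (k.+1%:R^-1 * tau i)))
     (Num.sqrt k.+1%:R) (sqrtr_ge0 _).
  set S := (X in _ -> _ -> 0 <= X) => hS.
  have -> : \sum_(i <- s) c i *
    expR (- Num.sqrt ((1 - expR (- (k.+1%:R^-1 * tau i))) * k.+1%:R)) = S.
    by apply: eq_bigr => i _; rewrite [X in Num.sqrt X]mulrC sqrtrM.
  apply: hS => [i|m].
    by rewrite expR_ge0/= -[leRHS](@expR0 R) ler_expR oppr_le0 mulr_ge0.
  (* The m-th power of X = exp (- tau / (k + 1)) is the exponential with a = m / (k + 1). *)
  have := H (m%:R * k.+1%:R^-1); rewrite mulr_ge0// => /(_ isT); congr (_ <= _).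
  by apply: eq_bigr => i _; rewrite -expRM_natl; congr (_ * expR _); ring.
apply: (@lin_comb_ge0_lim _ _ \oo _ _ _ _ _ _ h) => i.
apply: (continuous_cvg _ (@continuous_expR R _)).
apply: cvgN; apply: (continuous_cvg _ (@sqrt_continuous R _)).
exact: cvg_harmonic_exp_quotient.
Qed.

End Subordination.

(** * Positive definiteness of the exponential kernel *)

Section Kernel.
Variables (R : realType) (n : nat).
Local Open Scope classical_set_scope.
Implicit Types (x y z : 'rV[R]_n) (V W : seq (R * 'rV[R]_n)) (c : R).

Definition dot x y : R := \sum_k x 0 k * y 0 k.
Definition sqn x : R := dot x x.

Lemma dotC x y : dot x y = dot y x.
Proof. by apply: eq_bigr => k _; rewrite mulrC. Qed.

Lemma dotDl x y z : dot (x + y) z = dot x z + dot y z.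
Proof. by rewrite -big_split; apply: eq_bigr => k _; rewrite mxE mulrDl. Qed.

Lemma dotZl c x z : dot (c *: x) z = c * dot x z.
Proof. by rewrite mulr_sumr; apply: eq_bigr => k _; rewrite mxE mulrA. Qed.

Lemma dotDr x y z : dot z (x + y) = dot z x + dot z y.
Proof. by rewrite !(dotC z) dotDl. Qed.

Lemma dotZr c x z : dot z (c *: x) = c * dot z x.
Proof. by rewrite !(dotC z) dotZl. Qed.

Lemma dotNl x z : dot (- x) z = - dot x z.
Proof. by rewrite -scaleN1r dotZl mulN1r. Qed.

Lemma dotNr x z : dot z (- x) = - dot z x.
Proof. by rewrite !(dotC z) dotNl. Qed.

Lemma dot0l x : dot 0 x = 0.
Proof. by rewrite -(scale0r x) dotZl mul0r. Qed.

Lemma sqn_ge0 x : 0 <= sqn x.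
Proof. by rewrite /sqn /dot sumr_ge0// => k _; rewrite -expr2 sqr_ge0. Qed.

Lemma sqnN x : sqn (- x) = sqn x.
Proof. by rewrite /sqn dotNl dotNr opprK. Qed.

Lemma sqnZ c x : sqn (c *: x) = c ^+ 2 * sqn x.
Proof. by rewrite /sqn dotZl dotZr mulrA. Qed.

Lemma sqnD x y : sqn (x + y) = sqn x + 2 * dot x y + sqn y.
Proof. by rewrite /sqn dotDl !dotDr (dotC y x); ring. Qed.

Lemma sqnB x y : sqn (x - y) = sqn x - 2 * dot x y + sqn y.
Proof. by rewrite sqnD sqnN dotNr; ring. Qed.

Lemma sqn_eq0 x : sqn x = 0 -> x = 0.
Proof.
move=> /eqP; rewrite /sqn /dot psumr_eq0 => [/allP h|i _]; last by rewrite -expr2 sqr_ge0.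
apply/rowP => k; rewrite mxE; have := h k; rewrite mem_index_enum => /(_ isT) /=.
by rewrite mulf_eq0 orbb => /eqP.
Qed.

Lemma edistE x y : edist x y = Num.sqrt (sqn (x - y)).
Proof.
by congr Num.sqrt; apply: eq_bigr => k _; rewrite !mxE expr2.
Qed.

Lemma edist_ge0 x y : 0 <= edist x y. Proof. exact: sqrtr_ge0. Qed.

Lemma edistC x y : edist x y = edist y x.
Proof. by rewrite !edistE -opprB sqnN. Qed.

Lemma edistxx x : edist x x = 0.
Proof. by rewrite edistE subrr /sqn dot0l sqrtr0. Qed.

Lemma cauchy_schwarz x y : dot x y <= Num.sqrt (sqn x) * Num.sqrt (sqn y).
Proof.
have [y0|y0] := eqVneq (sqn y) 0.
  by rewrite (sqn_eq0 y0) dotC dot0l /sqn dot0l sqrtr0 mulr0.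
have yp : 0 < sqn y by rewrite lt_neqAle eq_sym y0 sqn_ge0.
rewrite -sqrtrM ?sqn_ge0//; apply: le_trans (ler_norm _) _.
rewrite -sqrtr_sqr ler_sqrt ?mulr_ge0 ?sqn_ge0//.
have := sqn_ge0 (sqn y *: x - dot x y *: y).
rewrite sqnB !sqnZ dotZl dotZr.
have -> : sqn y ^+ 2 * sqn x - 2 * (sqn y * (dot x y * dot x y)) + dot x y ^+ 2 * sqn y
   = sqn y * (sqn x * sqn y - dot x y ^+ 2) by ring.
by rewrite pmulr_rge0// subr_ge0.
Qed.

Lemma sqrt_sqnD x y : Num.sqrt (sqn (x + y)) <= Num.sqrt (sqn x) + Num.sqrt (sqn y).
Proof.
rewrite -(@ler_pXn2r _ 2)// ?nnegrE ?addr_ge0 ?sqrtr_ge0//.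
rewrite sqrrD !sqr_sqrtr ?sqn_ge0// sqnD lerD2r lerD2l mulr_natl.
by rewrite ler_pMn2r// cauchy_schwarz.
Qed.

Lemma edist_triangle x y z : edist x z <= edist x y + edist y z.
Proof.
rewrite !edistE; have -> : x - z = (x - y) + (y - z) by rewrite addrA subrK.
exact: sqrt_sqnD.
Qed.

Definition ker x y : R := expR (- edist x y).

Lemma kerC x y : ker x y = ker y x. Proof. by rewrite /ker edistC. Qed.

Lemma ker_gt0 x y : 0 < ker x y. Proof. exact: expR_gt0. Qed.

Lemma ker_le1 x y : ker x y <= 1.
Proof. by rewrite /ker -[leRHS](@expR0 R) ler_expR oppr_le0 edist_ge0. Qed.

Lemma kerxx x : ker x x = 1. Proof. by rewrite /ker edistxx oppr0 expR0. Qed.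

Lemma expRN_lipschitz (a b : R) : 0 <= a -> 0 <= b -> `|expR (- a) - expR (- b)| <= `|a - b|.
Proof.
suff H (u v : R) : 0 <= u -> u <= v -> `|expR (- u) - expR (- v)| <= `|u - v|.
  move=> a0 b0; have [ab|/ltW ba] := leP a b; first by apply: H.
  by rewrite distrC (distrC a); apply: H.
move=> u0 uv; have uv' : expR (- v) <= expR (- u) by rewrite ler_expR lerN2.
rewrite [leLHS]ger0_norm ?subr_ge0// ler0_norm ?subr_le0// opprB.
have -> : expR (- v) = expR (- u) * expR (u - v) by rewrite -expRD; congr expR; ring.
have h1 := expR_ge1Dx (u - v).
have h2 : 0 <= expR (- u) <= 1 by rewrite expR_ge0 -[leRHS](@expR0 R) ler_expR oppr_le0.
have h3 : expR (u - v) <= 1 by rewrite -[leRHS](@expR0 R) ler_expR; lra.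
have -> : expR (- u) - expR (- u) * expR (u - v) = expR (- u) * (1 - expR (u - v)) by ring.
case/andP: h2 => h2 h4.
apply: (@le_trans _ _ (1 * (1 - expR (u - v)))); last by lra.
by rewrite ler_wpM2r// subr_ge0.
Qed.

Lemma ker_lipschitz x y z : `|ker x z - ker y z| <= edist x y.
Proof.
apply: le_trans (expRN_lipschitz (edist_ge0 _ _) (edist_ge0 _ _)) _.
rewrite ler_norml; have h1 := edist_triangle x y z; have h2 := edist_triangle y x z.
rewrite (edistC y x) in h2; lra.
Qed.

Definition ev V (g : 'rV[R]_n -> R) : R := \sum_(a <- V) a.1 * g a.2.
Definition mass V : R := \sum_(a <- V) a.1.
Definition tvar V : R := \sum_(a <- V) `|a.1|.
Definition pot V x : R := ev V (ker x).
Definition ip V W : R := ev V (pot W).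
Definition scalem c V : seq (R * 'rV[R]_n) := [seq (c * a.1, a.2) | a <- V].

Lemma ev_cat V W g : ev (V ++ W) g = ev V g + ev W g.
Proof. exact: big_cat. Qed.

Lemma ev_scale c V g : ev (scalem c V) g = c * ev V g.
Proof. by rewrite /ev big_map mulr_sumr; apply: eq_bigr => a _; rewrite mulrA. Qed.

Lemma ev_exchange V W (f : 'rV[R]_n -> 'rV[R]_n -> R) :
  ev V (fun x => ev W (f x)) = ev W (fun y => ev V (fun x => f x y)).
Proof.
rewrite /ev; under eq_bigr do rewrite mulr_sumr.
rewrite exchange_big /=; apply: eq_bigr => b _; rewrite mulr_sumr.
by apply: eq_bigr => a _; rewrite mulrCA.
Qed.

Lemma eq_ev V g h : g =1 h -> ev V g = ev V h.
Proof. by move=> gh; apply: eq_bigr => a _; rewrite gh. Qed.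

Lemma eq_in_ev V g h : (forall a, a \in V -> g a.2 = h a.2) -> ev V g = ev V h.
Proof.
by move=> gh; rewrite /ev; apply: eq_big_seq => a aV; rewrite gh.
Qed.

Lemma evD V g h : ev V (fun x => g x + h x) = ev V g + ev V h.
Proof. by rewrite /ev -big_split; apply: eq_bigr => a _; rewrite mulrDr. Qed.

Lemma evZ c V g : ev V (fun x => c * g x) = c * ev V g.
Proof. by rewrite /ev mulr_sumr; apply: eq_bigr => a _; rewrite mulrCA. Qed.

Lemma ev_cst V c : ev V (fun=> c) = mass V * c.
Proof. by rewrite /ev /mass mulr_suml. Qed.

Lemma ev_bound V g e : (forall a, a \in V -> `|g a.2| <= e) -> `|ev V g| <= tvar V * e.
Proof.
move=> h; apply: le_trans (ler_norm_sum _ _ _) _.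
rewrite mulr_suml big_seq [leRHS]big_seq; apply: ler_sum => a aV.
by rewrite normrM ler_wpM2l// h.
Qed.

Lemma tvar_ge0 V : 0 <= tvar V.
Proof. by rewrite sumr_ge0. Qed.

Lemma tvar_cat V W : tvar (V ++ W) = tvar V + tvar W.
Proof. exact: big_cat. Qed.

Lemma tvar_scale c V : tvar (scalem c V) = `|c| * tvar V.
Proof. by rewrite /tvar big_map mulr_sumr; apply: eq_bigr => a _; rewrite normrM. Qed.

Lemma mass_cat V W : mass (V ++ W) = mass V + mass W.
Proof. exact: big_cat. Qed.

Lemma mass_scale c V : mass (scalem c V) = c * mass V.
Proof. by rewrite /mass big_map mulr_sumr. Qed.

Lemma pot_cat V W x : pot (V ++ W) x = pot V x + pot W x.
Proof. exact: ev_cat. Qed.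

Lemma pot_scale c V x : pot (scalem c V) x = c * pot V x.
Proof. exact: ev_scale. Qed.

Lemma ipC V W : ip V W = ip W V.
Proof.
rewrite /ip /pot ev_exchange; apply: eq_ev => y; apply: eq_ev => x.
exact: kerC.
Qed.

Lemma ip_catl V V' W : ip (V ++ V') W = ip V W + ip V' W.
Proof. exact: ev_cat. Qed.

Lemma ip_scalel c V W : ip (scalem c V) W = c * ip V W.
Proof. exact: ev_scale. Qed.

Lemma ip_catr V V' W : ip W (V ++ V') = ip W V + ip W V'.
Proof. by rewrite !(ipC W) ip_catl. Qed.

Lemma ip_scaler c V W : ip W (scalem c V) = c * ip W V.
Proof. by rewrite !(ipC W) ip_scalel. Qed.

(** One factor [dot x y], written out in coordinates, splits the form into a sum over k of forms of
    lower degree, whose weights are multiplied by the k-th coordinate. *)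
Lemma dot_power_psd V m : 0 <= ev V (fun x => ev V (fun y => dot x y ^+ m)).
Proof.
elim: m V => [|m IH] V.
  have E : ev V (fun x => ev V (fun y => dot x y ^+ 0)) = mass V * mass V.
    by rewrite -ev_cst; apply: eq_ev => x; rewrite -[RHS]mulr1 -ev_cst.
  by rewrite E -expr2 sqr_ge0.
pose Vk (k : 'I_n) := [seq (a.1 * a.2 0 k, a.2) | a : R * 'rV[R]_n <- V].
have -> : ev V (fun x => ev V (fun y => dot x y ^+ m.+1)) =
    \sum_k ev (Vk k) (fun x => ev (Vk k) (fun y => dot x y ^+ m)).
  rewrite /ev /Vk; under [RHS]eq_bigr do rewrite big_map.
  rewrite exchange_big /=; apply: eq_bigr => a _.
  under [RHS]eq_bigr do rewrite big_map mulr_sumr.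
  rewrite exchange_big /= mulr_sumr; apply: eq_bigr => b _.
  rewrite exprS {1}/dot mulr_suml !mulr_sumr; apply: eq_bigr => k _; ring.
by apply: sumr_ge0 => k _; exact: IH.
Qed.

(** The kernel is exp (- a |x|^2) exp (- a |y|^2) exp (2 a <x, y>). The weights of [W] absorb the
    first two factors, and the third is a power series in <x, y> with nonnegative coefficients. *)
Lemma gauss_psd V (a : R) : 0 <= a ->
  0 <= ev V (fun x => ev V (fun y => expR (- (a * sqn (x - y))))).
Proof.
move=> a0; pose W : seq (R * 'rV[R]_n) := [seq (b.1 * expR (- (a * sqn b.2)), b.2) | b <- V].
have -> : ev V (fun x => ev V (fun y => expR (- (a * sqn (x - y))))) =
    ev W (fun x => ev W (fun y => expR (2 * a * dot x y))).
  rewrite /ev /W big_map; apply: eq_bigr => b _ /=.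
  rewrite big_map -mulrA; congr (_ * _); rewrite mulr_sumr; apply: eq_bigr => d _ /=.
  rewrite mulrCA -!mulrA; congr (_ * _); rewrite -!expRD; congr expR.
  by rewrite sqnB; ring.
have -> : ev W (fun x => ev W (fun y => expR (2 * a * dot x y))) =
   \sum_(b <- [seq (b, d) | b <- W, d <- W]) (b.1.1 * b.2.1) * expR (2 * a * dot b.1.2 b.2.2).
  rewrite big_allpairs; apply: eq_bigr => b _; rewrite mulr_sumr.
  by apply: eq_bigr => d _; rewrite mulrA.
apply: (@lin_comb_ge0_lim _ _ \oo _ _ _ _
    (fun N (b : (R * 'rV[R]_n) * (R * 'rV[R]_n)) =>
    \sum_(j < N) (2 * a * dot b.1.2 b.2.2) ^+ j / j`!%:R)); last first.
  by move=> i; exact: cvg_exp_partial.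
move=> N.
have -> : \sum_(b <- [seq (b, d) | b <- W, d <- W]) (b.1.1 * b.2.1) *
    \sum_(j < N) (2 * a * dot b.1.2 b.2.2) ^+ j / j`!%:R =
    \sum_(j < N) (2 * a) ^+ j / j`!%:R * ev W (fun x => ev W (fun y => dot x y ^+ j)).
  under eq_bigr do rewrite mulr_sumr.
  rewrite exchange_big /=; apply: eq_bigr => j _.
  rewrite big_allpairs mulr_sumr; apply: eq_bigr => b _.
  rewrite /ev mulrA mulr_sumr; apply: eq_bigr => d _ /=.
  by rewrite exprMn; ring.
apply: sumr_ge0 => j _; rewrite mulr_ge0 ?dot_power_psd// divr_ge0//.
by rewrite exprn_ge0// mulr_ge0.
Qed.

(** Subordination over the list of all pairs of atoms, with tau = |x - y|^2, reduces the claim to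
    Gaussian kernels. *)
Theorem ip_ge0 V : 0 <= ip V V.
Proof.
have E (f : 'rV[R]_n -> 'rV[R]_n -> R) : ev V (fun x => ev V (f x)) =
   \sum_(b <- [seq (b, d) | b <- V, d <- V]) (b.1.1 * b.2.1) * f b.1.2 b.2.2.
  rewrite big_allpairs; apply: eq_bigr => b _; rewrite mulr_sumr.
  by apply: eq_bigr => d _; rewrite mulrA.
have -> : ip V V = ev V (fun x => ev V (fun y => expR (- Num.sqrt (sqn (x - y))))).
  by apply: eq_ev => x; apply: eq_ev => y; rewrite /ker edistE.
rewrite E; apply: exp_sqrt_subordination => [b|a a0]; first exact: sqn_ge0.
by have := gauss_psd V a0; rewrite E.
Qed.

End Kernel.

(** * Mean value estimates and backward differences *)

Section Calculus.
Variable R : realType.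
Local Open Scope classical_set_scope.
Implicit Types (f df g : R -> R) (a b c e t x : R).

Lemma mvt f df a b :
  (forall x, Num.min a b <= x <= Num.max a b -> is_derive x 1 f (df x)) ->
  exists2 c, Num.min a b <= c <= Num.max a b & f b - f a = df c * (b - a).
Proof.
move=> H.
have H0 u v : u <= v -> (forall x, u <= x <= v -> is_derive x 1 f (df x)) ->
    exists2 c, u <= c <= v & f v - f u = df c * (v - u).
  move=> uv Hd; have [x||c] := @MVT_segment R f df u v uv.
  - by rewrite in_itv /= => /andP[/ltW xu /ltW xv]; apply: Hd; rewrite xu.
  - apply: derivable_within_continuous => x; rewrite in_itv /= => xuv.
    by case: (Hd x xuv).
  - by rewrite in_itv /=; exists c.
have [ab|/ltW ba] := leP a b.
  rewrite (min_l ab) (max_r ab) in H *; exact: H0.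
rewrite (min_r ba) (max_l ba) in H *; have [c cI cE] := H0 _ _ ba H.
by exists c => //; rewrite -opprB cE -mulrN opprB.
Qed.

Lemma between_dist a b c : Num.min a b <= c <= Num.max a b -> `|c - a| <= `|b - a|.
Proof.
have [ab|/ltW ba] := leP a b => /andP[h1 h2].
  by rewrite !ger0_norm ?subr_ge0// lerD2r.
by rewrite !ler0_norm ?subr_le0// lerN2 lerD2r.
Qed.

Lemma between_itv a b c u v : u <= a <= v -> u <= b <= v ->
  Num.min a b <= c <= Num.max a b -> u <= c <= v.
Proof.
move=> /andP[ua av] /andP[ub bv] /andP[h1 h2]; rewrite (le_trans _ h1) ?le_min ?ua ?ub//.
by rewrite (le_trans h2)// ge_max av bv.
Qed.

Lemma derive_bound_lipschitz f df u v B a b :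
  (forall x, u <= x <= v -> is_derive x 1 f (df x)) ->
  (forall x, u <= x <= v -> `|df x| <= B) ->
  u <= a <= v -> u <= b <= v -> `|f b - f a| <= B * `|b - a|.
Proof.
move=> Hd HB ha hb; have [|c cI ->] := @mvt f df a b.
  by move=> x xI; apply: Hd; exact: between_itv xI.
by rewrite normrM ler_wpM2r// HB//; exact: between_itv cI.
Qed.

Lemma derive0_cst f u v a b : (forall x, u <= x <= v -> is_derive x 1 f 0) ->
  u <= a <= v -> u <= b <= v -> f a = f b.
Proof.
move=> Hd ha hb; apply/eqP; rewrite eq_sym -subr_eq0 -normr_le0.
rewrite -[leRHS](mul0r `|b - a|); apply: (@derive_bound_lipschitz f (fun=> 0) u v) => //.
by move=> x _; rewrite normr0.
Qed.

Lemma is_derive_sum_seq (I : eqType) (s : seq I) (F : I -> R -> R) (dF : I -> R) x :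
  (forall i, i \in s -> is_derive x 1 (F i) (dF i)) ->
  is_derive x 1 (fun t => \sum_(i <- s) F i t) (\sum_(i <- s) dF i).
Proof.
elim: s => [|i s IH] H.
  under eq_fun do rewrite big_nil; rewrite big_nil; exact: is_derive_cst.
under eq_fun do rewrite big_cons; rewrite big_cons.
apply: is_deriveD; first by apply: H; rewrite mem_head.
by apply: IH => k ks; apply: H; rewrite inE ks orbT.
Qed.

Lemma is_deriveMl c f d x : is_derive x 1 f d -> is_derive x 1 (fun t => c * f t) (c * d).
Proof. by move=> H; exact: (@is_deriveZ _ _ _ f c x 1 d). Qed.

Lemma is_deriveMx f g d d' x : is_derive x 1 f d -> is_derive x 1 g d' ->
  is_derive x 1 (fun t => f t * g t) (d * g x + f x * d').
Proof.
move=> Hf Hg; apply: is_derive_eq; rewrite /GRing.scale /= addrC (mulrC d).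
by congr (_ + _); rewrite mulrC.
Qed.

Lemma is_derive_shift f d c x : is_derive (x - c) 1 f d -> is_derive x 1 (fun t => f (t - c)) d.
Proof.
move=> H; have H1 : is_derive x 1 (fun t => t - c) 1.
  by apply: is_derive_eq; rewrite subr0.
by have := @is_derive1_comp _ f (fun t => t - c) x d 1 H H1; rewrite mulr1.
Qed.

(* Coefficients and node offsets of the m-th backward difference. *)
Fixpoint dcoef (m : nat) : seq (R * nat) :=
  if m is m'.+1 then dcoef m' ++ [seq (- a.1, a.2.+1) | a : R * nat <- dcoef m'] else [:: (1, 0%N)].

Definition bdiff e m f t : R := \sum_(i <- dcoef m) i.1 * f (t - i.2%:R * e).

Lemma bdiff0 e f t : bdiff e 0 f t = f t.
Proof. by rewrite /bdiff /= big_seq1 /= mul1r mul0r subr0. Qed.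

Lemma bdiffS e m f t : bdiff e m.+1 f t = bdiff e m f t - bdiff e m f (t - e).
Proof.
rewrite /bdiff /= big_cat /= big_map -sumrN; congr (_ + _); apply: eq_bigr => a _ /=.
by rewrite mulNr -natr1; congr (- (_ * f _)); ring.
Qed.

Lemma dcoef_le m (a : R * nat) : a \in dcoef m -> (a.2 <= m)%N.
Proof.
elim: m a => [|m IH] a /=; first by rewrite inE => /eqP ->.
by rewrite mem_cat => /orP[/IH /leqW//|/mapP[b /IH h ->]].
Qed.

(** Each difference is exchanged for a derivative by one application of the mean value theorem, to
    [bdiff e m (F j)] on an interval of length e. *)
Lemma bdiff_chain (F : nat -> R -> R) e m j t : 0 <= e ->
  (forall i x, t - m%:R * e <= x <= t -> is_derive x 1 (F i) (F i.+1 x)) ->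
  exists2 x, t - m%:R * e <= x <= t & bdiff e m (F j) t = e ^+ m * F (j + m)%N x.
Proof.
move=> e0; elim: m j t => [|m IH] j t H.
  by exists t; rewrite ?mul0r ?subr0 ?lexx// bdiff0 mul1r addn0.
have me0 : 0 <= m%:R * e by rewrite mulr_ge0.
have mE : m.+1%:R * e = m%:R * e + e by rewrite -natr1 mulrDl mul1r.
have [|x0 x0I E] := @mvt (bdiff e m (F j)) (bdiff e m (F j.+1)) (t - e) t.
  have te : t - e <= t by rewrite gerBl.
  rewrite (min_l te) (max_r te) => x /andP[x1 x2].
  apply: is_derive_sum_seq => a /dcoef_le am; apply: is_deriveMl; apply: is_derive_shift.
  have h1 : a.2%:R * e <= m%:R * e by rewrite ler_wpM2r// ler_nat.
  have h2 : 0 <= a.2%:R * e by rewrite mulr_ge0.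
  by apply: H; apply/andP; split; lra.
move: x0I; rewrite min_l ?max_r ?gerBl// => /andP[x1 x2].
have [i x /andP[h1 h2]|x /andP[h1 h2] Ex] := IH j.+1 x0.
  by apply: H; apply/andP; split; lra.
exists x; first by apply/andP; split; lra.
by rewrite bdiffS E Ex addnS addSn exprS; ring.
Qed.

Lemma bdiff_expR e m a t :
  bdiff e m (fun s => expR (- (a * s))) t = expR (- (a * t)) * (1 - expR (a * e)) ^+ m.
Proof.
elim: m t => [|m IH] t; first by rewrite bdiff0 mulr1.
rewrite bdiffS !IH; have -> : expR (- (a * (t - e))) = expR (- (a * t)) * expR (a * e).
  by rewrite -expRD; congr expR; ring.
by rewrite exprS; ring.
Qed.

Lemma cvg_bdiff_chain (F : nat -> R -> R) (e : nat -> R) m j t u :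
  u < t -> (forall i x, u < x -> is_derive x 1 (F i) (F i.+1 x)) ->
  (forall k, 0 < e k) -> e k @[k --> \oo] --> 0 ->
  bdiff (e k) m (F j) t / e k ^+ m @[k --> \oo] --> F (j + m)%N t.
Proof.
move=> ut H e0 ecv; apply/cvgrPdist_le => d d0.
have cF : {for t, continuous (F (j + m)%N)}.
  apply: differentiable_continuous; apply/derivable1_diffP.
  by case: (H (j + m)%N t ut).
have /cvgrPdist_le/(_ d d0)[z /= z0 Hz] := cF.
have q0 : 0 < Num.min z (t - u) / m.+1%:R.
  by rewrite divr_gt0// lt_min z0 subr_gt0.
have /cvgr0Pnorm_lt/(_ _ q0) [N _ HN] := ecv.
exists N => // k /= Nk; have := HN k Nk; rewrite /= gtr0_norm// ltr_pdivlMr// => hk.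
have hk2 : m%:R * e k < Num.min z (t - u).
  by apply: le_lt_trans hk; rewrite [leLHS]mulrC ler_wpM2l ?ler_nat// ltW.
move: hk2; rewrite lt_min => /andP[hz hu].
have [i x /andP[h1 h2]|x /andP[h1 h2] ->] := @bdiff_chain F (e k) m j t (ltW (e0 k)).
  by apply: H; lra.
rewrite mulrAC divff ?mul1r; last by rewrite expf_neq0// gt_eqF.
apply: Hz; rewrite /= ger0_norm ?subr_ge0//; lra.
Qed.

End Calculus.

(** * Reverse Bessel functions and their Hankel determinants *)

Section Psi.
Variable R : realType.
Local Open Scope classical_set_scope.
Implicit Types (s t x r : R).

Fixpoint psi_pair (j : nat) s : R * R :=
  if j is j'.+1 then
    let: (a, b) := psi_pair j' s in (b, (a + (2 * j' + 1)%:R * b) / s ^+ 2)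
  else (expR (- s), expR (- s) / s).

(* psi_j is the j-th iterate of - (1/s) d/ds on exp (- s). *)
Definition psi j s : R := (psi_pair j s).1.

Lemma psi_pairE j s : psi_pair j s = (psi j s, psi j.+1 s).
Proof. by rewrite /psi /=; case: (psi_pair j s). Qed.

Lemma psi0 s : psi 0 s = expR (- s). Proof. by []. Qed.

Lemma psi1 s : psi 1 s = expR (- s) / s. Proof. by []. Qed.

Lemma psiSS j s : psi j.+2 s = (psi j s + (2 * j + 1)%:R * psi j.+1 s) / s ^+ 2.
Proof. by rewrite {1}/psi /= psi_pairE. Qed.

Lemma psi_rec j s : s != 0 -> s ^+ 2 * psi j.+2 s = psi j s + (2 * j + 1)%:R * psi j.+1 s.
Proof. by move=> s0; rewrite psiSS mulrC divfK// expf_neq0. Qed.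

Lemma psi_gt0 j s : 0 < s -> 0 < psi j s.
Proof.
move=> s0; suff: 0 < psi j s /\ 0 < psi j.+1 s by case.
elim: j => [|j [h1 h2]]; first by rewrite psi0 psi1 divr_gt0 ?expR_gt0.
split=> //; rewrite psiSS divr_gt0 ?exprn_gt0// ltr_pwDl// mulr_ge0// ltW//.
Qed.

Lemma chiR_psi j s : s != 0 -> chiR j s = psi j s * s ^+ (2 * j) * expR s.
Proof.
move=> s0; suff: chiR j s = psi j s * s ^+ (2 * j) * expR s /\
   chiR j.+1 s = psi j.+1 s * s ^+ (2 * j.+1) * expR s by case.
have chiE i : chi_pair i = (chi i, chi i.+1) by rewrite /chi /=; case: (chi_pair i).
have e1 : expR (- s) * expR s = 1 by rewrite -expRD addNr expR0.
elim: j => [|j [h1 h2]].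
  split; first by rewrite /chiR /chi /= psi0 rmorph1 hornerC mulr1 e1.
  rewrite /chiR /chi /= psi1 map_polyX hornerX -[LHS]mul1r -e1.
  by rewrite (_ : 2 * 1 = 2)%N//; field.
split => //.
have -> : chiR j.+2 s = s ^+ 2 * chiR j s + (2 * j + 1)%:R * chiR j.+1 s.
  rewrite /chiR {1}/chi /= chiE /=.
  rewrite rmorphD !rmorphM /= ?rmorphXn /= map_polyX rmorph_nat expr2.
  by rewrite !hornerE /= -polyC_natr !hornerE.
rewrite h1 h2 psiSS.
have E1 : s ^+ (2 * j.+2) = s ^+ 2 * s ^+ (2 * j.+1) by rewrite -exprD; congr (_ ^+ _); lia.
have E2 : s ^+ (2 * j.+1) = s ^+ 2 * s ^+ (2 * j) by rewrite -exprD; congr (_ ^+ _); lia.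
by rewrite E1 E2; field.
Qed.

Lemma is_derive_psi j s : 0 < s -> is_derive s 1 (psi j) (- (s * psi j.+1 s)).
Proof.
move=> s0; have sn0 : s != 0 by rewrite gt_eqF.
have dexp : is_derive s 1 (fun t => expR (- t)) (- expR (- s)).
  have d1 : is_derive s 1 (fun t => - t) (-1) by apply: is_derive_eq.
  have := @is_derive1_comp _ expR (fun t => - t) s (expR (- s)) (-1).
  by rewrite mulrN1; apply.
suff: is_derive s 1 (psi j) (- (s * psi j.+1 s)) /\
      is_derive s 1 (psi j.+1) (- (s * psi j.+2 s)) by case.
have dinv : is_derive s 1 (fun t : R => t^-1) (- (s ^- 2)).
  by have := @is_deriveV R id s 1 1 sn0 _; rewrite /GRing.scale /= mulr1; apply.
elim: j => [|j [h1 h2]].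
  split; first by apply: is_derive_eq; rewrite psi1 mulrC divfK.
  have := is_deriveMx dexp dinv; congr is_derive.
  by rewrite psiSS psi0 psi1; field.
split=> //.
have -> : psi j.+2 = fun t => (psi j t + (2 * j + 1)%:R * psi j.+1 t) * (t^-1 * t^-1).
  by apply/funext => t; rewrite psiSS expr2 invfM.
have := is_deriveMx (is_deriveD h1 (is_deriveMl (2 * j + 1)%:R h2)) (is_deriveMx dinv dinv).
congr is_derive.
have E3 := psi_rec j.+1 sn0; have E2 := psi_rec j sn0.
have -> : psi j.+3 s = (psi j.+1 s + (2 * j + 3)%:R * psi j.+2 s) / s ^+ 2.
  by rewrite psiSS; congr ((_ + _%:R * _) / _); lia.
rewrite !fctE -E2 psiSS.
have -> : (2 * j + 3)%:R = (2 * j + 1)%:R + 2 :> R by rewrite -natrD; congr (_%:R); lia.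
by field.
Qed.

Lemma psi_decreasing j s t : 0 < s -> s <= t -> psi j t <= psi j s.
Proof.
move=> s0 st; have [|x xI E] := @mvt R (psi j) (fun x => - (x * psi j.+1 x)) s t.
  by rewrite min_l// => x /andP[sx _]; apply: is_derive_psi; exact: lt_le_trans sx.
move: xI; rewrite min_l// => /andP[sx _].
have x0 : 0 < x by exact: lt_le_trans sx.
rewrite -subr_le0 E mulNr oppr_le0 mulr_ge0 ?subr_ge0// mulr_ge0 ?ltW//; exact: psi_gt0.
Qed.

(** In the variable t = s^2 the operator - (1/s) d/ds is - 2 d/dt, so the [fpsi j] are successive
    derivatives up to powers of - 2. *)
Definition fpsi j t : R := psi j (Num.sqrt t).

Lemma is_derive_fpsi j t : 0 < t -> is_derive t 1 (fpsi j) (- 2^-1 * fpsi j.+1 t).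
Proof.
move=> t0; have s0 : 0 < Num.sqrt t by rewrite sqrtr_gt0.
have := is_derive1_comp (is_derive_psi j s0) (is_derive1_sqrt t0); congr is_derive.
by rewrite /fpsi; field; rewrite gt_eqF.
Qed.

Lemma fpsi_sqr j s : 0 <= s -> fpsi j (s ^+ 2) = psi j s.
Proof. by move=> s0; rewrite /fpsi sqrtr_sqr ger0_norm. Qed.

Definition gpsi j t : R := (- 2^-1) ^+ j * fpsi j t.

Lemma is_derive_gpsi j t : 0 < t -> is_derive t 1 (gpsi j) (gpsi j.+1 t).
Proof.
move=> t0; have := is_deriveMl ((- 2^-1) ^+ j) (is_derive_fpsi j t0).
by congr is_derive; rewrite /gpsi exprSr mulrA.
Qed.

Lemma bdiff_scale e m c (f : R -> R) t : bdiff e m (fun x => c * f x) t = c * bdiff e m f t.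
Proof. by rewrite /bdiff mulr_sumr; apply: eq_bigr => a _; rewrite mulrCA. Qed.

Lemma cvg_bdiff_psi (e : nat -> R) m j s : 0 < s ->
  (forall k, 0 < e k) -> e k @[k --> \oo] --> 0 ->
  bdiff (e k) m (fpsi j) (s ^+ 2) / e k ^+ m @[k --> \oo] --> (- 2^-1) ^+ m * psi (j + m) s.
Proof.
move=> s0 e0 ecv.
have c0 : (-2 : R) ^+ j != 0 by rewrite expf_neq0// oppr_eq0.
have h : bdiff (e k) m (gpsi j) (s ^+ 2) / e k ^+ m @[k --> \oo] --> gpsi (j + m) (s ^+ 2).
  apply: (@cvg_bdiff_chain R gpsi e m j (s ^+ 2) 0) => //; first by rewrite exprn_gt0.
  by move=> i x; exact: is_derive_gpsi.
have -> : (- 2^-1) ^+ m * psi (j + m) s = (-2) ^+ j * gpsi (j + m) (s ^+ 2).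
  rewrite /gpsi fpsi_sqr ?ltW// exprD !mulrA -exprMn.
  by rewrite mulrNN divff// expr1n mul1r.
have -> : (fun k => bdiff (e k) m (fpsi j) (s ^+ 2) / e k ^+ m) =
  (fun k => (-2) ^+ j * (bdiff (e k) m (gpsi j) (s ^+ 2) / e k ^+ m)).
  apply/funext => k; rewrite bdiff_scale !mulrA -exprMn.
  by rewrite mulrNN divff// expr1n mul1r.
by apply: cvgM => //; exact: cvg_cst.
Qed.

End Psi.

(** * Positivity and nonvanishing of the Hankel determinants of [psi] *)

Section Hankel.
Variable R : realType.
Local Open Scope classical_set_scope.
Implicit Types (s t x r : R).

(** By subordination exp (- sqrt t) may be replaced by exp (- a t). There a backward difference is
    multiplication by 1 - exp (a e), and the Hankel form becomes a square. *)
Lemma hankel_bdiff_ge0 (N : nat) (w : nat -> R) (e t : R) : 0 <= e -> (2 * N)%:R * e <= t ->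
  0 <= \sum_(q <- [seq (i, j) | i <- iota 0 N, j <- iota 0 N])
         w q.1 * w q.2 * bdiff e (q.1 + q.2) (@fpsi R 0) t.
Proof.
move=> e0 tN; set ps := [seq _ | _ <- _, _ <- _].
pose L := [seq (q, a) | q <- ps, a <- dcoef R (q.1 + q.2)].
pose c (l : (nat * nat) * (R * nat)) := w l.1.1 * w l.1.2 * l.2.1.
(* The absolute value makes every node nonnegative, as subordination asks; on [L] it changes
   nothing. *)
have E f : \sum_(q <- ps) w q.1 * w q.2 * bdiff e (q.1 + q.2) f t =
    \sum_(l <- L) c l * f `|t - l.2.2%:R * e|.
  rewrite [RHS]big_allpairs_dep; apply: eq_big_seq => q.
  move=> /allpairsP[[i j] /= [iN jN ->]]; rewrite /bdiff mulr_sumr /=; apply: eq_big_seq => a /dcoef_le /= aN.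
  rewrite /c /= mulrA; congr (_ * f _); rewrite ger0_norm// subr_ge0; apply: le_trans tN.
  rewrite ler_wpM2r// ler_nat; move: iN jN aN; rewrite !mem_iota /=; lia.
rewrite E; apply: exp_sqrt_subordination => [l|a a0]; first exact: normr_ge0.
rewrite -(E (fun x => expR (- (a * x)))).
have -> : \sum_(q <- ps) w q.1 * w q.2 * bdiff e (q.1 + q.2) (fun x => expR (- (a * x))) t =
   expR (- (a * t)) * (\sum_(i <- iota 0 N) w i * (1 - expR (a * e)) ^+ i) ^+ 2.
  rewrite expr2 /ps big_allpairs mulr_suml mulr_sumr; apply: eq_bigr => i _.
  rewrite mulr_sumr mulr_sumr; apply: eq_bigr => j _ /=.
  by rewrite bdiff_expR exprD; ring.
by rewrite mulr_ge0 ?expR_ge0// sqr_ge0.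
Qed.

Lemma hankel_psd (N : nat) (v : nat -> R) s : 0 < s ->
  0 <= \sum_(q <- [seq (i, j) | i <- iota 0 N, j <- iota 0 N])
         v q.1 * v q.2 * psi (q.1 + q.2) s.
Proof.
move=> s0; set ps := [seq _ | _ <- _, _ <- _].
(* The factor keeps all nodes s^2 - a e with a <= 2 N nonnegative. *)
pose e k : R := s ^+ 2 / (2 * N).+1%:R * harmonic k.
have e0 k : 0 < e k by rewrite mulr_gt0 ?divr_gt0 ?exprn_gt0// /harmonic /= invr_gt0.
have ecv : e k @[k --> \oo] --> 0.
  by rewrite -[X in _ --> X](mulr0 (s ^+ 2 / (2 * N).+1%:R)); apply: cvgM;
    [exact: cvg_cst|exact: cvg_harmonic].
have -> : \sum_(q <- ps) v q.1 * v q.2 * psi (q.1 + q.2) s =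
  \sum_(q <- ps) ((-2) ^+ q.1 * v q.1 * ((-2) ^+ q.2 * v q.2)) *
    ((- 2^-1) ^+ (q.1 + q.2) * psi (0 + (q.1 + q.2)) s).
  apply: eq_bigr => q _; rewrite add0n.
  have E i : (-2 : R) ^+ i * (- 2^-1) ^+ i = 1 by rewrite -exprMn mulrNN divff// expr1n.
  rewrite exprD [RHS](_ : _ = ((-2) ^+ q.1 * (- 2^-1) ^+ q.1) * ((-2) ^+ q.2 * (- 2^-1) ^+ q.2) *
    (v q.1 * v q.2 * psi (q.1 + q.2) s)); last by ring.
  by rewrite !E !mul1r.
apply: (@lin_comb_ge0_lim _ _ \oo _ _ _ _
   (fun k q => bdiff (e k) (q.1 + q.2) (@fpsi R 0) (s ^+ 2) / e k ^+ (q.1 + q.2))); last first.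
  by move=> q; exact: cvg_bdiff_psi.
move=> k; have := @hankel_bdiff_ge0 N (fun i => (-2) ^+ i * v i / e k ^+ i) (e k) (s ^+ 2) (ltW (e0 k)).
have h : (2 * N)%:R * e k <= s ^+ 2.
  rewrite /e mulrA -[leRHS]mulr1; apply: ler_pM.
  - by rewrite mulr_ge0// divr_ge0// sqr_ge0.
  - by rewrite /harmonic /= invr_ge0.
  - by rewrite mulrCA ler_piMr ?sqr_ge0// ler_pdivrMr// mul1r ler_nat.
  - by rewrite /harmonic /= invf_le1// ler1n.
move=> /(_ h); congr (_ <= _); apply: eq_bigr => q _.
by rewrite exprD; field; rewrite !expf_neq0// gt_eqF.
Qed.

(* A null vector of a positive semidefinite form lies in its radical; as the
   form extends to all indices and psi grows superexponentially, it vanishes. *)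
Lemma hankel_psi_det_neq0 (p : nat) s : 0 < s ->
  \det (\matrix_(i < p.+1, j < p.+1) psi (i + j) s) != 0.
Proof.
move=> s0; apply/negP => /det0P[u u0 uH].
pose v k := if insub k is Some i then u 0 i else 0 : R.
have vE (i : 'I_p.+1) : v i = u 0 i by rewrite /v valK.
have v0 k : (p < k)%N -> v k = 0 by move=> kp; rewrite /v insubF// ltnNge kp.
have hv j : (j <= p)%N -> \sum_(i < p.+1) v i * psi (i + j) s = 0.
  rewrite -ltnS => jp; have := congr1 (fun A : 'rV__ => A 0 (Ordinal jp)) uH.
  rewrite !mxE => {2}<-; apply: eq_bigr => i _; by rewrite !mxE vE.
have hall j : \sum_(i < p.+1) v i * psi (i + j) s = 0.
  set S := \sum_(i < p.+1) _.
  pose N := (maxn j p).+1.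
  (* Moving the null vector by t in direction j leaves only the cross term and the square;
     nonnegativity for all t forces S = 0. *)
  have H (t : R) : 0 <= 2 * t * S + t ^+ 2 * psi (j + j) s.
    have := @hankel_psd N (fun i => v i + (if i == j then t else 0)) s s0.
    have sumN (F : nat -> R) : \sum_(i <- iota 0 N) v i * F i = \sum_(i < p.+1) v i * F i.
      rewrite -[iota 0 N]/(index_iota 0 N) (big_cat_nat (n := p.+1))//=; last by rewrite /N ltnS leq_maxr.
      rewrite [X in _ + X]big_nat_cond [X in _ + X]big1 ?addr0 ?big_mkord// => i.
      by rewrite andbT => /andP[pi _]; rewrite v0// mul0r.
    have sumj (F : nat -> R) : \sum_(i <- iota 0 N) (if i == j then t else 0) * F i = t * F j.
      have jN : j \in iota 0 N by rewrite mem_iota /= add0n /N ltnS leq_maxl.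
      rewrite (bigD1_seq j jN (iota_uniq _ _)) /= eqxx big1 ?addr0// => i /negPf ->.
      by rewrite mul0r.
    have -> : \sum_(q <- [seq (i, k) | i <- iota 0 N, k <- iota 0 N])
       (v q.1 + (if q.1 == j then t else 0)) * (v q.2 + (if q.2 == j then t else 0)) * psi (q.1 + q.2) s
       = 2 * t * S + t ^+ 2 * psi (j + j) s; last by [].
    rewrite big_allpairs /=.
    have inner i : \sum_(k <- iota 0 N) (v i + (if i == j then t else 0)) *
        (v k + (if k == j then t else 0)) * psi (i + k) s =
      (v i + (if i == j then t else 0)) * (\sum_(k < p.+1) v k * psi (k + i) s + t * psi (i + j) s).
      under eq_bigr do rewrite -mulrA.
      rewrite -mulr_sumr; congr (_ * _).
      under eq_bigr do rewrite mulrDl.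
      rewrite big_split /= sumN sumj; congr (_ + _).
      by apply: eq_bigr => k _; rewrite addnC.
    under eq_bigr do rewrite inner mulrDl.
    rewrite big_split /= sumN sumj -/S.
    rewrite (eq_bigr (fun i : 'I_p.+1 => t * (v i * psi (i + j) s))) => [|i _].
      by rewrite -mulr_sumr -/S; ring.
    by rewrite hv ?add0r 1?mulrCA// -ltnS.
  have P0 := psi_gt0 (j + j) s0; set P := psi (j + j) s in H P0.
  have := H (- (S / P)).
  have -> : 2 * - (S / P) * S + (- (S / P)) ^+ 2 * P = - (S ^+ 2 / P).
    by field; rewrite gt_eqF.
  rewrite oppr_ge0 => h; apply/eqP; rewrite -sqrf_eq0 eq_le sqr_ge0 andbT.
  by move: h; rewrite pmulr_lle0// invr_gt0.
have [J JV] : exists J : 'I_p.+1, v J != 0 /\ forall i : 'I_p.+1, (J < i)%N -> v i = 0.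
  have [i0 i0P] : exists i : 'I_p.+1, u 0 i != 0 by apply/existsP; rewrite -negb_forall;
     apply: contra u0 => /forallP h; apply/eqP/rowP => i; rewrite mxE; apply/eqP; exact: h.
  have := arg_maxnP (P := fun i : 'I_p.+1 => u 0 i != 0) (fun i => i : nat) i0P.
  case=> J JP Jmax; exists J; rewrite vE; split=> // i Ji; rewrite vE; apply/eqP/negPn/negP => /Jmax /= iJ.
  by move: Ji; rewrite ltnNge iJ.
case: JV => vJ0 vJ.
have rat k : (2 * k + 1)%:R * psi k.+1 s <= s ^+ 2 * psi k.+2 s.
  by rewrite psi_rec ?gt_eqF// lerDr ltW// psi_gt0.
pose C := \sum_(i < p.+1) `|v i|.
have mono k i : s ^+ 2 <= (2 * k + 1)%:R -> (k < i)%N -> psi i s <= psi i.+1 s.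
  move=> hk; case: i => // i ki.
  have p1 := psi_gt0 i.+1 s0.
  rewrite -(@ler_pM2l _ (s ^+ 2)) ?exprn_gt0//; apply: le_trans (rat i).
  by rewrite (ler_wpM2r (ltW p1))// (le_trans hk)// ler_nat; lia.
(* From this index on, the ratios of consecutive [psi] are at least 1 + C / |v J|. In the relation
   [hall k.+2] the last nonzero term, that of J, then outweighs all the others together. *)
pose k := Num.trunc (s ^+ 2 * (1 + C / `|v J|)).
have hk : s ^+ 2 * (1 + C / `|v J|) <= (2 * k + 1)%:R.
  apply: (@le_trans _ _ k.+1%:R); last by rewrite ler_nat; lia.
  have s20 : 0 <= s ^+ 2 * (1 + C / `|v J|).
    by rewrite mulr_ge0 ?sqr_ge0// addr_ge0// divr_ge0// sumr_ge0.
  by rewrite ltW// truncnS_gt.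
have C0 : 0 <= C by rewrite sumr_ge0.
have vJp : 0 < `|v J| by rewrite normr_gt0.
have hs : s ^+ 2 <= (2 * k + 1)%:R.
  apply: le_trans hk; rewrite ler_peMr ?sqr_ge0// lerDl divr_ge0//.
have h0 := hall k.+2.
have mono2 i l : (k < i)%N -> (i <= l)%N -> psi i s <= psi l s.
  move=> ki; elim: l => [|l IH]; first by rewrite leqn0 => /eqP ->.
  rewrite leq_eqVlt => /orP[/eqP ->//|]; rewrite ltnS => il.
  by apply: le_trans (IH il) _; apply: (mono k) => //; exact: leq_trans il.
have big1' : `|v J| * psi (J + k.+2) s <= C * psi (J + k.+1) s.
  have -> : `|v J| * psi (J + k.+2) s = `|v J * psi (J + k.+2) s|.
    by rewrite normrM (ger0_norm (ltW (psi_gt0 _ s0))).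
  move: h0; rewrite (bigD1 J)//= => /eqP; rewrite addr_eq0 => /eqP ->.
  rewrite normrN; apply: le_trans (ler_norm_sum _ _ _) _.
  rewrite /C mulr_suml [leRHS](bigD1 J)//= -[leLHS]add0r; apply: lerD.
    by rewrite mulr_ge0// ltW// psi_gt0.
  apply: ler_sum => i iJ; rewrite normrM.
  have [iJ'|Ji] := ltnP J i; first by rewrite vJ// normr0 mul0r mulr_ge0// ltW// psi_gt0.
  have {}Ji : (i < J)%N by rewrite ltn_neqAle Ji andbT.
  rewrite (ger0_norm (ltW (psi_gt0 _ s0))) ler_wpM2l// mono2//; lia.
have h1 : s ^+ 2 * (1 + C / `|v J|) * psi (J + k.+1) s <= s ^+ 2 * psi (J + k.+2) s.
  rewrite !addnS; apply: le_trans (rat (J + k)%N).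
  rewrite (ler_wpM2r (ltW (psi_gt0 _ s0)))//; apply: le_trans hk _.
  by rewrite ler_nat; lia.
have {}h1 : (`|v J| + C) * psi (J + k.+1) s <= `|v J| * psi (J + k.+2) s.
  rewrite -(@ler_pM2l _ (s ^+ 2 / `|v J|)) ?divr_gt0 ?exprn_gt0//.
  have -> : s ^+ 2 / `|v J| * (`|v J| * psi (J + k.+2) s) = s ^+ 2 * psi (J + k.+2) s.
    by field; rewrite gt_eqF.
  apply: le_trans h1; rewrite le_eqVlt; apply/orP; left; apply/eqP.
  by field; rewrite gt_eqF.
have := le_trans h1 big1'; rewrite mulrDl gerDr leNgt => /negP; apply.
by rewrite mulr_gt0// psi_gt0.
Qed.

End Hankel.

(** * Radial solutions regular at the origin *)

Lemma is_derive_exprn (R : realType) (i : nat) (b : R) :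
  is_derive b 1 (fun x : R => x ^+ i.+1) (i.+1%:R * b ^+ i).
Proof.
elim: i => [|i IH]; first by apply: is_derive_eq; rewrite mul1r.
have := is_deriveMx (is_derive_id b (1 : R)) IH; congr is_derive => //=.
by rewrite -natr1 (exprS b i); ring.
Qed.

Section RegularSolutions.
Variable R : realType.
Local Open Scope classical_set_scope.
Implicit Types (b x : R) (m l : nat).

(** These are the coefficients of 0F1 (; m/2; b/4), a modified Bessel function up to a power of b.
    For m = n and b = |x|^2 the series is the radial solution of Delta u = u with value 1 at the
    origin. *)
Definition bcoef m l : R := (l`!%:R * 2 ^+ l * \prod_(q < l) (m + 2 * q)%:R)^-1.

Lemma bprod_gt0 m l : (0 < m)%N -> 0 < \prod_(q < l) (m + 2 * q)%:R :> R.
Proof. by move=> m0; rewrite prodr_gt0// => q _; rewrite ltr0n ltn_addr. Qed.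

Lemma bcoef_den_gt0 m l : (0 < m)%N ->
  0 < l`!%:R * 2 ^+ l * \prod_(q < l) (m + 2 * q)%:R :> R.
Proof. by move=> m0; rewrite !mulr_gt0 ?exprn_gt0 ?bprod_gt0 ?ltr0n ?fact_gt0. Qed.

Lemma bcoef_gt0 m l : (0 < m)%N -> 0 < bcoef m l.
Proof. by move=> m0; rewrite invr_gt0 bcoef_den_gt0. Qed.

Lemma bprodS m l : \prod_(q < l.+1) (m + 2 * q)%:R =
  m%:R * \prod_(q < l) (m.+2 + 2 * q)%:R :> R.
Proof.
rewrite big_ord_recl /= muln0 addn0; congr (_ * _); apply: eq_bigr => q _.
by congr (_%:R); rewrite /bump /=; lia.
Qed.

Lemma bcoef_diffs m : (0 < m)%N -> pseries_diffs (bcoef m) = fun l => (2 * m%:R)^-1 * bcoef m.+2 l.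
Proof.
move=> m0; apply/funext => l; rewrite /pseries_diffs /bcoef bprodS factS natrM exprS.
have h := @bprod_gt0 m.+2 l isT.
have m1 : m%:R != 0 :> R by rewrite pnatr_eq0 -lt0n.
have l1 : l`!%:R != 0 :> R by rewrite pnatr_eq0 -lt0n fact_gt0.
have l2 : l.+1%:R != 0 :> R by rewrite pnatr_eq0.
have l3 : (2 : R) ^+ l != 0 by rewrite expf_neq0.
move: h l2; set P := \prod_(q < l) _; set L : R := l.+1%:R => h l2.
have h0 := lt0r_neq0 h.
by field; do ?(apply/andP; split).
Qed.

Lemma bcoef_le m l : (0 < m)%N -> bcoef m l <= l`!%:R^-1.
Proof.
move=> m0; rewrite lef_pV2 ?posrE ?bcoef_den_gt0 ?ltr0n ?fact_gt0//.
rewrite -mulrA ler_peMr// mulr_ege1// ?exprn_ege1 ?ler1n//.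
by elim/big_ind: _ => // [x y|q _]; [exact: mulr_ege1|rewrite ler1n addn_gt0 m0].
Qed.

Lemma cvg_bcoef_norm m x : (0 < m)%N -> cvgn (series (fun l => `|bcoef m l * x ^+ l|)).
Proof.
move=> m0; apply: (series_le_cvg _ _ _ (is_cvg_series_exp_coeff `|x|)) => l.
- exact: normr_ge0.
- by rewrite divr_ge0// exprn_ge0.
rewrite normrM normrX mulrC ler_wpM2l ?exprn_ge0// ger0_norm ?bcoef_le//.
exact/ltW/bcoef_gt0.
Qed.

Lemma cvg_bcoef m x : (0 < m)%N -> cvgn (pseries (bcoef m) x).
Proof. by move=> /cvg_bcoef_norm-/(_ x)/normed_cvg. Qed.

Definition bser m b : R := limn (pseries (bcoef m) b).

Lemma cvg_bser m b : (0 < m)%N ->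
  \sum_(l < N) bcoef m l * b ^+ l @[N --> \oo] --> bser m b.
Proof.
move=> m0; have := @cvg_bcoef m b m0; rewrite /bser /pseries.
have -> : (fun N => \sum_(l < N) bcoef m l * b ^+ l) = series (fun l => bcoef m l * b ^+ l).
  by apply/funext => N; rewrite /series /= big_mkord.
by [].
Qed.

Lemma pseriesZ c (u : nat -> R) b : pseries (fun l => c * u l) b = fun N => c * pseries u b N.
Proof.
apply/funext => N; rewrite /pseries /series /= mulr_sumr.
by apply: eq_bigr => i _; rewrite mulrA.
Qed.

Lemma is_derive_bser m b : (0 < m)%N ->
  is_derive b 1 (bser m) ((2 * m%:R)^-1 * bser m.+2 b).
Proof.
move=> m0; have H := @pseries_snd_diffs R (bcoef m) (`|b| + 1) b.
have E0 x : limn (pseries (fun l => (2 * m%:R)^-1 * bcoef m.+2 l) x) =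
   (2 * m%:R)^-1 * bser m.+2 x.
  rewrite pseriesZ; apply/cvg_lim => //; apply: cvgM; [exact: cvg_cst|exact: cvg_bcoef].
have cM c u x : cvgn (pseries u x) -> cvgn (pseries (fun l => c * u l) x).
  by move=> h; rewrite pseriesZ; apply: is_cvgM => //; exact: is_cvg_cst.
have dZ c u : pseries_diffs (fun l => c * u l) = fun l => c * pseries_diffs u l.
  by apply/funext => l; rewrite /pseries_diffs mulrCA.
move: H; rewrite bcoef_diffs// (E0 b) dZ bcoef_diffs//; apply.
- exact: cvg_bcoef.
- by apply: cM; exact: cvg_bcoef.
- by apply: (cM); apply: cM; exact: cvg_bcoef.
- by rewrite [ltRHS]ger0_norm ?addr_ge0// ltrDl.
Qed.

Lemma bser_rec m b : (0 < m)%N ->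
  bser m b = bser m.+2 b + b / (m%:R * m.+2%:R) * bser m.+4 b.
Proof.
move=> m0; have h1 := @cvg_bser m b m0.
have h2 := @cvg_bser m.+2 b isT; have h4 := @cvg_bser m.+4 b isT.
have {}h1 : \sum_(l < N.+1) bcoef m l * b ^+ l @[N --> \oo] --> bser m b.
  by move: h1; rewrite -(cvg_shiftS (fun N => \sum_(l < N) bcoef m l * b ^+ l)).
have {}h2 : \sum_(l < N.+1) bcoef m.+2 l * b ^+ l @[N --> \oo] --> bser m.+2 b.
  by move: h2; rewrite -(cvg_shiftS (fun N => \sum_(l < N) bcoef m.+2 l * b ^+ l)).
have h3 : \sum_(l < N.+1) bcoef m.+2 l * b ^+ l +
   b / (m%:R * m.+2%:R) * (\sum_(l < N) bcoef m.+4 l * b ^+ l) @[N --> \oo] -->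
   bser m.+2 b + b / (m%:R * m.+2%:R) * bser m.+4 b.
  by apply: cvgD => //; apply: cvgM => //; exact: cvg_cst.
suff EQ N : \sum_(l < N.+1) bcoef m l * b ^+ l = \sum_(l < N.+1) bcoef m.+2 l * b ^+ l +
   b / (m%:R * m.+2%:R) * (\sum_(l < N) bcoef m.+4 l * b ^+ l).
  by move: h1; under eq_fun do rewrite EQ; move=> h1; exact: (cvg_unique _ h1 h3).
rewrite !big_ord_recl /= !expr0 -addrA; congr (_ + _).
  by rewrite /bcoef !big_ord0.
rewrite mulr_sumr -big_split /=; apply: eq_bigr => l _.
rewrite /bump /= add1n.
have -> : bcoef m l.+1 = bcoef m.+2 l.+1 + (m%:R * m.+2%:R)^-1 * bcoef m.+4 l.
  rewrite /bcoef (bprodS m.+2) factS natrM !exprS.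
  have E : \prod_(q < l.+1) (m + 2 * q)%:R * (m + 2 * l.+1)%:R =
           m%:R * (m.+2%:R * \prod_(q < l) (m.+4 + 2 * q)%:R) :> R.
    by rewrite -(bprodS m.+2) -(bprodS m l.+1) [RHS]big_ord_recr.
  have P0 := lt0r_neq0 (@bprod_gt0 m.+4 l isT).
  have Q0 := lt0r_neq0 (@bprod_gt0 m l.+1 m0).
  have m1 : m%:R != 0 :> R by rewrite pnatr_eq0 -lt0n.
  have m2 : m.+2%:R != 0 :> R by rewrite pnatr_eq0.
  have l1 : l`!%:R != 0 :> R by rewrite pnatr_eq0 -lt0n fact_gt0.
  have l2 : l.+1%:R != 0 :> R by rewrite pnatr_eq0.
  have l3 : (2 : R) ^+ l != 0 by rewrite expf_neq0.
  have k0 : (m + 2 * l.+1)%:R != 0 :> R by rewrite pnatr_eq0 addn_eq0 negb_and muln_eq0 orbT.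
  have kE : (m + 2 * l.+1)%:R = m%:R + 2 * l.+1%:R :> R by rewrite natrD natrM.
  have -> : \prod_(q < l.+1) (m + 2 * q)%:R =
      m%:R * (m.+2%:R * \prod_(q < l) (m.+4 + 2 * q)%:R) / (m + 2 * l.+1)%:R :> R.
    by rewrite -E mulfK.
  rewrite kE in k0 *; move: P0 l1 l2 l3 m1 m2 k0.
  set P := \prod_(q < l) _; set L : R := l.+1%:R; set F : R := l`!%:R; set T : R := 2 ^+ l.
  set M : R := m%:R; set M2 : R := m.+2%:R => *.
  by field; do ?(apply/andP; split).
by rewrite mulrDl exprS; congr (_ + _); ring.
Qed.

Lemma bser0 m : (0 < m)%N -> bser m 0 = 1.
Proof.
move=> m0; have h := @cvg_bser m 0 m0.
have {}h : \sum_(l < N.+1) bcoef m l * 0 ^+ l @[N --> \oo] --> bser m 0.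
  by move: h; rewrite -(cvg_shiftS (fun N => \sum_(l < N) bcoef m l * 0 ^+ l)).
suff EQ N : \sum_(l < N.+1) bcoef m l * 0 ^+ l = 1.
  by move: h; under eq_fun do rewrite EQ; move=> h; exact: (cvg_unique _ h (cvg_cst _)).
rewrite big_ord_recl expr0 mulr1 /bcoef big_ord0 expr0 !mulr1 fact0 invr1.
by rewrite big1 ?addr0// => i _; rewrite expr0n mulr0.
Qed.

Lemma bser_ge1 m b : (0 < m)%N -> 0 <= b -> 1 <= bser m b.
Proof.
move=> m0 b0; have h := @cvg_bser m b m0.
have {}h : \sum_(l < N.+1) bcoef m l * b ^+ l @[N --> \oo] --> bser m b.
  by move: h; rewrite -(cvg_shiftS (fun N => \sum_(l < N) bcoef m l * b ^+ l)).
apply: (cvgr_to_ge h); apply: nearW => N.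
rewrite big_ord_recl expr0 mulr1 {1}/bcoef big_ord0 expr0 !mulr1 fact0 invr1 lerDl.
by rewrite sumr_ge0// => i _; rewrite mulr_ge0 ?exprn_ge0//; exact/ltW/bcoef_gt0.
Qed.

Variable n : nat.
Hypothesis n0 : (0 < n)%N.

(* The j-th derivative of bser n. *)
Definition gser j b : R := bser (n + 2 * j) b / (2 ^+ j * \prod_(q < j) (n + 2 * q)%:R).

Lemma is_derive_gser j b : is_derive b 1 (gser j) (gser j.+1 b).
Proof.
have nj : (0 < n + 2 * j)%N by rewrite addn_gt0 n0.
have -> : gser j = fun b => (2 ^+ j * \prod_(q < j) (n + 2 * q)%:R)^-1 * bser (n + 2 * j) b.
  by apply/funext => x; rewrite /gser mulrC.
have := is_deriveMl (2 ^+ j * \prod_(q < j) (n + 2 * q)%:R)^-1 (@is_derive_bser _ b nj).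
congr is_derive.
rewrite /gser big_ord_recr /= exprS !invfM.
have -> : (n + 2 * j.+1)%N = (n + 2 * j).+2 by lia.
by ring.
Qed.

(** This is 4 b y'' + 2 n y' = y differentiated j times; it is also the contiguous relation
    [bser_rec] at index n + 2 j, rescaled. *)
Lemma gser_rec j b :
  4 * b * gser j.+2 b + (4 * j%:R + 2 * n%:R) * gser j.+1 b = gser j b.
Proof.
have nj : (0 < n + 2 * j)%N by rewrite addn_gt0 n0.
rewrite /gser !big_ord_recr /= (@bser_rec _ b nj) !exprS.
have -> : (n + 2 * j.+1)%N = (n + 2 * j).+2 by lia.
have -> : (n + 2 * j.+2)%N = (n + 2 * j).+4 by lia.
have P0 := lt0r_neq0 (@bprod_gt0 n j n0).
have T0 : (2 : R) ^+ j != 0 by rewrite expf_neq0.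
have m0 : (n + 2 * j)%:R != 0 :> R by rewrite pnatr_eq0 -lt0n.
have m2 : (n + 2 * j).+2%:R != 0 :> R by rewrite pnatr_eq0.
have mE : 4 * j%:R + 2 * n%:R = 2 * (n + 2 * j)%:R :> R by rewrite natrD natrM; ring.
rewrite mE; move: P0 T0 m0 m2.
set P := \prod_(q < j) _; set T : R := 2 ^+ j; set M : R := (n + 2 * j)%:R.
set M2 : R := (n + 2 * j).+2%:R => *; clearbody P T M M2.
by field; do ?(apply/andP; split).
Qed.

Lemma gser00 : gser 0 0 = 1.
Proof. by rewrite /gser muln0 addn0 bser0// big_ord0 expr0 mulr1 divr1. Qed.

Lemma gser0_ge1 b : 0 <= b -> 1 <= gser 0 b.
Proof. by move=> b0; rewrite /gser muln0 addn0 big_ord0 expr0 mulr1 divr1 bser_ge1. Qed.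

(* mon (i + 2) b = b^i / i!, padded by zeros so that differentiation is a shift. *)
Definition mon (i : nat) b : R := if i is i'.+2 then b ^+ i' / i'`!%:R else 0.

Lemma is_derive_mon i b : is_derive b 1 (mon i) (mon i.-1 b).
Proof.
case: i => [|[|[|i]]] /=.
- exact: is_derive_cst.
- exact: is_derive_cst.
- have -> : mon 2 = cst 1 by apply/funext => x; rewrite /= expr0 fact0 divr1.
  exact: is_derive_cst.
have -> : mon i.+3 = fun b : R => (i.+1`!%:R)^-1 * b ^+ i.+1.
  by apply/funext => x; rewrite mulrC.
have h := is_derive_exprn i b.
have := is_deriveMl (i.+1`!%:R)^-1 h; congr is_derive.
have l1 : i`!%:R != 0 :> R by rewrite pnatr_eq0 -lt0n fact_gt0.
have l2 : i.+1%:R != 0 :> R by rewrite pnatr_eq0.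
by rewrite factS natrM; move: l1 l2; set L : R := i.+1%:R => *; field; do ?(apply/andP; split).
Qed.

Lemma mon_mul i b : b * mon i b = (i%:R - 1) * mon i.+1 b.
Proof.
case: i => [|[|i]] /=; rewrite ?mulr0 ?subrr ?mul0r//.
have l1 : i`!%:R != 0 :> R by rewrite pnatr_eq0 -lt0n fact_gt0.
have l2 : i.+1%:R != 0 :> R by rewrite pnatr_eq0.
rewrite factS natrM exprS -(@natr1 _ i.+1) addrK.
by move: l1 l2; set L : R := i.+1%:R => *; field; do ?(apply/andP; split).
Qed.

(** The functions p_j of the overview. The regular radial solution of Delta u = (1 + mu) u is
    [gser 0] at (1 + mu) |x|^2, and [preg j] is its coefficient of mu^j; comparing coefficients
    explains Delta p_j = p_j + p_(j-1). *)
Definition preg j b : R := mon j.+2 b * gser j b.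
Definition dpreg j b : R := mon j.+1 b * gser j b + mon j.+2 b * gser j.+1 b.
Definition ddpreg j b : R :=
  mon j b * gser j b + 2 * (mon j.+1 b * gser j.+1 b) + mon j.+2 b * gser j.+2 b.

Lemma is_derive_preg j b : is_derive b 1 (preg j) (dpreg j b).
Proof. exact: is_deriveMx (is_derive_mon _ _) (is_derive_gser _ _). Qed.

Lemma is_derive_dpreg j b : is_derive b 1 (dpreg j) (ddpreg j b).
Proof.
have := is_deriveD (is_deriveMx (is_derive_mon j.+1 b) (is_derive_gser j b))
                   (is_deriveMx (is_derive_mon j.+2 b) (is_derive_gser j.+1 b)).
by congr is_derive; rewrite /ddpreg /=; ring.
Qed.

Lemma continuous_ddpreg j : continuous (ddpreg j).
Proof.
move=> b; apply: differentiable_continuous; apply/derivable1_diffP.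
have := is_deriveD (is_deriveD (is_deriveMx (is_derive_mon j b) (is_derive_gser j b))
  (is_deriveMl 2 (is_deriveMx (is_derive_mon j.+1 b) (is_derive_gser j.+1 b))))
                   (is_deriveMx (is_derive_mon j.+2 b) (is_derive_gser j.+2 b)).
by case.
Qed.

(* 4 b y'' + 2 n y' is the Laplacian on R^n of the radial function y (|x|^2). *)
Lemma preg_laplacian j b :
  4 * b * ddpreg j b + 2 * n%:R * dpreg j b =
  preg j b + (if j is j'.+1 then preg j' b else 0).
Proof.
have -> : 4 * b * ddpreg j b + 2 * n%:R * dpreg j b =
   4 * (b * mon j b) * gser j b + 8 * (b * mon j.+1 b) * gser j.+1 b +
   mon j.+2 b * (4 * b * gser j.+2 b + (4 * j%:R + 2 * n%:R) * gser j.+1 b)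
   - 4 * j%:R * mon j.+2 b * gser j.+1 b + 2 * n%:R * mon j.+1 b * gser j b.
  by rewrite /ddpreg /dpreg; ring.
rewrite gser_rec !mon_mul -(@natr1 _ j) addrK /preg.
case: j => [|j]; first by rewrite /=; ring.
rewrite -(gser_rec j b) -(@natr1 _ j).
have -> : mon j.+2 b * (4 * b * gser j.+2 b + (4 * j%:R + 2 * n%:R) * gser j.+1 b) =
   4 * (b * mon j.+2 b) * gser j.+2 b + (4 * j%:R + 2 * n%:R) * mon j.+2 b * gser j.+1 b by ring.
rewrite mon_mul -(@natr1 _ j.+1) -(@natr1 _ j); ring.
Qed.

End RegularSolutions.

(** * The radial kernel of a sphere and its Wronskian *)

Section RadialKernel.
Variables (R : realType) (p : nat).
Local Open Scope classical_set_scope.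
Implicit Types (s t a rho sig : R) (i j k : nat).
Local Notation n := (p.*2.+1).
Local Notation preg := (@preg R n).
Local Notation dpreg := (@dpreg R n).
Local Notation ddpreg := (@ddpreg R n).

Lemma odd_dimE : n%:R = 2 * p%:R + 1 :> R.
Proof. by rewrite -natr1 -mul2n natrM. Qed.

(** The scaling for which w_j = acoef j * psi j (|x|) satisfies Delta w_j = w_j + w_(j+1) away from
    the origin; see [psi_laplacian]. It vanishes for j > p, which ends the chain and makes the
    expansion finite. *)
Definition acoef j : R := (-2) ^+ j * (p ^_ j)%:R.

Lemma acoef_eq0 j : (p < j)%N -> acoef j = 0.
Proof. by move=> pj; rewrite /acoef ffact_small// mulr0. Qed.

Lemma acoefS j : acoef j.+1 = -2 * (p%:R - j%:R) * acoef j.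
Proof.
have [jp|pj] := leqP j p; last by rewrite !acoef_eq0 ?mulr0// ltnW.
by rewrite /acoef ffactnSr natrM natrB// exprS; ring.
Qed.

Lemma psi_laplacian j s : s != 0 ->
  s ^+ 2 * psi j.+2 s - n%:R * psi j.+1 s = psi j s - 2 * (p%:R - j%:R) * psi j.+1 s.
Proof. by move=> s0; rewrite psi_rec// odd_dimE natrD natrM; ring. Qed.

Lemma sum_preg_shift i (f : nat -> R) (q : nat -> R) :
  \sum_(k < p.+1) acoef (k + i) * f (k + i)%N * (if k : nat is k'.+1 then q k' else 0) =
  \sum_(k < p.+1) acoef (k + i).+1 * f (k + i).+1 * q k.
Proof.
rewrite big_ord_recl /= mulr0 add0r [RHS]big_ord_recr /= acoef_eq0 ?mul0r ?addr0; last first.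
  by rewrite ltnS leq_addr.
by apply: eq_bigr => k _; rewrite /bump /= add1n.
Qed.

(** Index 0 is the expansion of the average. Index i is the i-th iterate of Delta - 1 on it, in
    either of the two variables. *)
Definition radker i rho sig : R :=
  \sum_(k < p.+1) acoef (k + i) * psi (k + i) rho * preg k (sig ^+ 2).

Definition dradker i rho sig : R :=
  2 * sig * \sum_(k < p.+1) acoef (k + i) * psi (k + i) rho * dpreg k (sig ^+ 2).

Definition dradker' i sig rho : R :=
  - (sig * \sum_(k < p.+1) acoef (k + i) * psi (k + i).+1 sig * preg k (rho ^+ 2)).

Lemma is_derive_sqr s : is_derive s 1 (fun x : R => x ^+ 2) (2 * s).
Proof. by have := is_derive_exprn 1 s; rewrite expr1. Qed.

Lemma is_derive_comp_sqr (f : R -> R) d s : is_derive (s ^+ 2) 1 f d ->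
  is_derive s 1 (fun x => f (x ^+ 2)) (d * (2 * s)).
Proof. by move=> h; exact: (@is_derive1_comp _ f (fun x => x ^+ 2) s d (2 * s) h (is_derive_sqr s)). Qed.

Lemma is_derive_radker i rho sig : is_derive sig 1 (radker i rho) (dradker i rho sig).
Proof.
rewrite /dradker mulr_sumr; apply: is_derive_sum_seq => k _.
have := is_deriveMl (acoef (k + i) * psi (k + i) rho)
  (is_derive_comp_sqr (is_derive_preg (isT : (0 < n)%N) k (sig ^+ 2))).
by congr is_derive; ring.
Qed.

Lemma is_derive_radker' i rho sig : 0 < sig ->
  is_derive sig 1 (fun s => radker i s rho) (dradker' i sig rho).
Proof.
move=> s0; rewrite /dradker' mulr_sumr -sumrN; apply: is_derive_sum_seq => k _.
have -> : (fun t => acoef (k + i) * psi (k + i) t * preg k (rho ^+ 2)) =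
  fun t => (acoef (k + i) * preg k (rho ^+ 2)) * psi (k + i) t.
  by apply/funext => t; ring.
have := is_deriveMl (acoef (k + i) * preg k (rho ^+ 2)) (is_derive_psi (k + i) s0).
by congr is_derive; ring.
Qed.

(** The radial Laplacian is used in divergence form, s^(n-1) Delta u = (s^(n-1) u')', with n - 1 = 2
    p. *)
Lemma radker_laplacian i rho sig :
  is_derive sig 1 (fun s => s ^+ p.*2 * dradker i rho s)
    (sig ^+ p.*2 * (radker i rho sig + radker i.+1 rho sig)).
Proof.
have -> : (fun s => s ^+ p.*2 * dradker i rho s) = fun s =>
   \sum_(k < p.+1) (2 * (acoef (k + i) * psi (k + i) rho)) * (s ^+ p.*2.+1 * dpreg k (s ^+ 2)).
  apply/funext => s; rewrite /dradker mulrA mulr_sumr; apply: eq_bigr => k _.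
  by rewrite (exprS _ p.*2); ring.
have -> : sig ^+ p.*2 * (radker i rho sig + radker i.+1 rho sig) =
  \sum_(k < p.+1) (2 * (acoef (k + i) * psi (k + i) rho)) *
    (n%:R * sig ^+ p.*2 * dpreg k (sig ^+ 2) + sig ^+ n * (ddpreg k (sig ^+ 2) * (2 * sig))).
  have -> : radker i.+1 rho sig = \sum_(k < p.+1) acoef (k + i).+1 * psi (k + i).+1 rho * preg k (sig ^+ 2).
    by apply: eq_bigr => k _; rewrite addnS.
  rewrite -(@sum_preg_shift i (fun j => psi j rho) (fun k => preg k (sig ^+ 2))).
  rewrite /radker -big_split mulr_sumr; apply: eq_bigr => k _ /=.
  rewrite -mulrDr -preg_laplacian// (exprS _ p.*2); ring.
apply: is_derive_sum_seq => k _; apply: is_deriveMl.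
apply: is_deriveMx; first exact: is_derive_exprn.
by apply: is_derive_comp_sqr; exact: is_derive_dpreg.
Qed.

Lemma radker_laplacian' i rho sig : 0 < sig ->
  is_derive sig 1 (fun s => s ^+ p.*2 * dradker' i s rho)
    (sig ^+ p.*2 * (radker i sig rho + radker i.+1 sig rho)).
Proof.
move=> s0; have sn0 := lt0r_neq0 s0.
have -> : (fun s => s ^+ p.*2 * dradker' i s rho) = fun s =>
   \sum_(k < p.+1) (- (acoef (k + i) * preg k (rho ^+ 2))) * (s ^+ p.*2.+1 * psi (k + i).+1 s).
  apply/funext => s; rewrite /dradker' mulrN mulrA mulr_sumr -sumrN; apply: eq_bigr => k _.
  by rewrite (exprS _ p.*2); ring.
have -> : sig ^+ p.*2 * (radker i sig rho + radker i.+1 sig rho) =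
  \sum_(k < p.+1) (- (acoef (k + i) * preg k (rho ^+ 2))) *
    (n%:R * sig ^+ p.*2 * psi (k + i).+1 sig + sig ^+ n * (- (sig * psi (k + i).+2 sig))).
  rewrite /radker -big_split mulr_sumr; apply: eq_bigr => k _ /=.
  have E : acoef (k + i).+1 * psi (k + i).+1 sig = acoef (k + i) *
     (sig ^+ 2 * psi (k + i).+2 sig - n%:R * psi (k + i).+1 sig - psi (k + i) sig).
    by rewrite psi_laplacian// acoefS; ring.
  by rewrite addnS E (exprS _ p.*2); ring.
apply: is_derive_sum_seq => k _; apply: is_deriveMl.
apply: is_deriveMx; first exact: is_derive_exprn.
exact: is_derive_psi.
Qed.

(* s^(2p) times the jump across the diagonal of the derivative of radker i. *)
Definition wronsk i s : R := s ^+ p.*2 * (dradker i s s - dradker' i s s).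

(** Along the diagonal the mixed second derivatives cancel, and the Laplacians in the two variables
    agree, both being radker i + radker i.+1. *)
Lemma is_derive_wronsk i s : 0 < s -> is_derive s 1 (wronsk i) 0.
Proof.
move=> s0; have sn0 := lt0r_neq0 s0.
have -> : wronsk i = fun s => \sum_(k < p.+1) acoef (k + i) *
   (2 * (s ^+ n * (psi (k + i) s * dpreg k (s ^+ 2))) + s ^+ n * (psi (k + i).+1 s * preg k (s ^+ 2))).
  apply/funext => t; rewrite /wronsk /dradker /dradker' opprK mulrDr !mulrA !mulr_sumr -big_split.
  by apply: eq_bigr => k _; rewrite (exprS _ p.*2) /=; ring.
have E0 : \sum_(k < p.+1) acoef (k + i) *
  (2 * ((n%:R * s ^+ p.*2) * (psi (k + i) s * dpreg k (s ^+ 2)) +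
     s ^+ n * ((- (s * psi (k + i).+1 s)) * dpreg k (s ^+ 2) +
                 psi (k + i) s * (ddpreg k (s ^+ 2) * (2 * s)))) +
  ((n%:R * s ^+ p.*2) * (psi (k + i).+1 s * preg k (s ^+ 2)) +
    s ^+ n * ((- (s * psi (k + i).+2 s)) * preg k (s ^+ 2) +
       psi (k + i).+1 s * (dpreg k (s ^+ 2) * (2 * s))))) = 0.
  have E := @sum_preg_shift i (fun j => psi j s) (fun k => preg k (s ^+ 2)).
  have {}E : \sum_(k < p.+1) (acoef (k + i) * psi (k + i) s *
     (if k : nat is k'.+1 then preg k' (s ^+ 2) else 0) -
     acoef (k + i).+1 * psi (k + i).+1 s * preg k (s ^+ 2)) = 0.
    by rewrite sumrB E subrr.
  symmetry; rewrite -[LHS](mulr0 (s ^+ p.*2)) -[in LHS]E mulr_sumr; apply: eq_bigr => k _.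
  have -> : (if (k : nat) is k'.+1 then preg k' (s ^+ 2) else 0) =
     4 * s ^+ 2 * ddpreg k (s ^+ 2) + 2 * n%:R * dpreg k (s ^+ 2) - preg k (s ^+ 2).
    by rewrite preg_laplacian// addrAC subrr add0r.
  have -> : acoef (k + i).+1 * psi (k + i).+1 s = acoef (k + i) *
     (s ^+ 2 * psi (k + i).+2 s - n%:R * psi (k + i).+1 s - psi (k + i) s).
    by rewrite psi_laplacian// acoefS; ring.
  by rewrite (exprS _ p.*2); ring.
refine (is_derive_eq _ E0).
apply: is_derive_sum_seq => k _; apply: is_deriveMl; apply: is_deriveD.
  apply: is_deriveMl; apply: is_deriveMx; first exact: is_derive_exprn.
  apply: is_deriveMx; first exact: is_derive_psi.
  by apply: is_derive_comp_sqr; exact: is_derive_dpreg.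
apply: is_deriveMx; first exact: is_derive_exprn.
apply: is_deriveMx; first exact: is_derive_psi.
by apply: is_derive_comp_sqr; exact: is_derive_preg.
Qed.

End RadialKernel.

Section WronskianValue.
Variables (R : realType) (p : nat).
Local Open Scope classical_set_scope.
Implicit Types (s t a rho sig : R) (i j k : nat).
Local Notation n := (p.*2.+1).
Local Notation preg := (@preg R n).
Local Notation dpreg := (@dpreg R n).
Local Notation ddpreg := (@ddpreg R n).
Local Notation acoef := (@acoef R p).
Local Notation radker := (@radker R p).
Local Notation wronsk := (@wronsk R p).

Fixpoint xi_pair j s : R * R :=
  if j is j'.+1 then
    let: (a, b) := xi_pair j' s in (b, s ^+ 2 * a + (2 * j' + 3)%:R * b)
  else (expR (- s), (s + 1) * expR (- s)).

(* xi_j (s) = s^(2j+1) psi_(j+1) (s), which extends continuously to s = 0. *)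
Definition xi j s : R := (xi_pair j s).1.

Lemma xiSS j s : xi j.+2 s = s ^+ 2 * xi j s + (2 * j + 3)%:R * xi j.+1 s.
Proof.
have E i : xi_pair i s = (xi i s, xi i.+1 s) by rewrite /xi /=; case: (xi_pair i s).
by rewrite {1}/xi /= E.
Qed.

Lemma xiE j s : s != 0 -> xi j s = s ^+ (2 * j).+1 * psi j.+1 s.
Proof.
move=> s0; suff: xi j s = s ^+ (2 * j).+1 * psi j.+1 s /\
   xi j.+1 s = s ^+ (2 * j.+1).+1 * psi j.+2 s by case.
elim: j => [|j [h1 h2]].
  split; first by rewrite muln0 expr1 psi1 mulrC divfK.
  rewrite psiSS psi0 psi1 /xi /=; rewrite (_ : (2 * 1).+1 = 3)%N//.
  by field.
split=> //; rewrite xiSS h1 h2.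
have -> : (2 * j.+2).+1 = (2 + (2 * j.+1).+1)%N by lia.
have -> : (2 * j.+1).+1 = (2 + (2 * j).+1)%N by lia.
rewrite !exprD (psiSS j.+1).
have -> : (2 * j.+1 + 1)%N = (2 * j + 3)%N by lia.
move: (s ^+ (2 * j).+1) => T; move: ((2 * j + 3)%:R : R) => N; by field.
Qed.

Lemma continuous_xi j : continuous (xi j).
Proof.
suff: continuous (xi j) /\ continuous (xi j.+1) by case.
have ce : continuous (fun s : R => expR (- s)).
  by move=> s; apply: continuous_comp; [exact: opp_continuous|exact: continuous_expR].
elim: j => [|j [h1 h2]].
  split; first exact: ce.
  move=> s; apply: cvgM; last exact: ce.
  by apply: cvgD; [exact: cvg_id|exact: cvg_cst].
split=> //; have -> : xi j.+2 = fun s => s ^+ 2 * xi j s + (2 * j + 3)%:R * xi j.+1 s.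
  by apply/funext => s; exact: xiSS.
move=> s; apply: cvgD; apply: cvgM; [|exact: h1|exact: cvg_cst|exact: h2].
exact: exprn_continuous.
Qed.

Lemma xi_at0 j : xi j 0 = \prod_(q < j) (2 * q + 1)%:R.
Proof.
suff: xi j 0 = \prod_(q < j) (2 * q + 1)%:R /\ xi j.+1 0 = \prod_(q < j.+1) (2 * q + 1)%:R by case.
elim: j => [|j [h1 h2]].
  by rewrite big_ord0 big_ord_recr big_ord0 /xi /= oppr0 expR0 add0r !mulr1.
split=> //; rewrite xiSS h2 expr0n /= mul0r add0r [RHS]big_ord_recr /= mulrC.
by congr (_ * _%:R); lia.
Qed.

(** [wronsk] written through [xi], so that each term is continuous at 0 and the constant can be read
    off there. *)
Definition wronsk_ext i s : R := \sum_(k < p.+1) acoef (k + i) *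
  (2 * ((if (k + i)%N is j.+1 then s ^+ (2 * (p - j)) * xi j s else s ^+ n * expR (- s)) *
        dpreg k (s ^+ 2)) +
   s ^+ (2 * (p - (k + i))) * xi (k + i) s * preg k (s ^+ 2)).

Lemma wronsk_extE i s : 0 < s -> wronsk i s = wronsk_ext i s.
Proof.
move=> s0; have sn0 := lt0r_neq0 s0.
rewrite /wronsk /dradker /dradker' opprK mulrDr !mulrA !mulr_sumr -big_split.
apply: eq_bigr => k _ /=; have [ki|ki] := leqP (k + i) p; last first.
  by rewrite acoef_eq0// !mul0r !mulr0 addr0.
have E j : (j <= p)%N -> s ^+ (2 * (p - j)) * xi j s = s ^+ n * psi j.+1 s.
  move=> jp; rewrite xiE// mulrA -exprD; congr (_ ^+ _ * _).
  by rewrite addnS -mulnDr subnK// mul2n.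
rewrite E//.
have -> : (if (k + i)%N is j.+1 then s ^+ (2 * (p - j)) * xi j s else s ^+ n * expR (- s)) =
   s ^+ n * psi (k + i) s.
  by case: (k + i)%N ki => [|j] jp; rewrite ?psi0// E// ltnW.
by rewrite (exprS _ p.*2); ring.
Qed.

Lemma continuous_wronsk_ext i : continuous (wronsk_ext i).
Proof.
have csq (f : R -> R) : continuous f -> continuous (fun s => f (s ^+ 2)).
  by move=> cf s; apply: continuous_comp; [exact: exprn_continuous|exact: cf].
have der (f : R -> R) (df : R -> R) : (forall x : R, is_derive x 1 f (df x)) -> continuous f.
  move=> h x; apply: differentiable_continuous; apply/derivable1_diffP.
  by case: (h x).
have cp k : continuous (preg k) by apply: (der _ (dpreg k)) => x; exact: is_derive_preg.
have cdp k : continuous (dpreg k) by apply: (der _ (ddpreg k)) => x; exact: is_derive_dpreg.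
move=> s; apply: cvg_sum_seq => k; apply: cvgM; first exact: cvg_cst.
apply: cvgD; last first.
  apply: cvgM; last exact: csq.
  by apply: cvgM; [exact: exprn_continuous|exact: continuous_xi].
apply: cvgM; first exact: cvg_cst.
apply: cvgM; last exact: csq.
case: (k + i)%N => [|j]; (apply: cvgM; first exact: exprn_continuous).
  by apply: continuous_comp; [exact: opp_continuous|exact: continuous_expR].
exact: continuous_xi.
Qed.

Lemma preg_at0 k : preg k 0 = (k == 0)%:R.
Proof.
rewrite /preg; case: k => [|k] /=.
  by rewrite gser00// fact0 expr0 divr1 mulr1.
by rewrite expr0n /= !mul0r.
Qed.

(** The [dpreg] terms carry a positive power of s. Among the others only [preg 0] survives, with the
    factor s^(2 (p - i)), which is nonzero at 0 only for i = p. *)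
Lemma wronsk_ext_at0 i : wronsk_ext i 0 = if i == p then acoef p * xi p 0 else 0.
Proof.
rewrite /wronsk_ext big_ord_recl big1 ?addr0 => [|k _].
  rewrite add0n; have [pi|ip] := ltnP p i.
    by rewrite acoef_eq0// mul0r gtn_eqF.
  have -> : (if i is j.+1 then (0 : R) ^+ (2 * (p - j)) * xi j 0 else 0 ^+ n * expR (- 0)) = 0.
    case: i ip => [|j] jp; rewrite expr0n ?mul0r//=.
    by rewrite muln_eq0 subn_eq0 leqNgt jp mul0r.
  rewrite mul0r mulr0 add0r expr0n muln_eq0 subn_eq0 /= expr0n /= preg_at0 eqxx mulr1.
  have [->|ne] := eqVneq i p; first by rewrite leqnn mul1r.
  by rewrite leqNgt ltn_neqAle ne ip /= !mul0r mulr0.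
have [ki|ki] := leqP (lift ord0 k + i) p; last by rewrite acoef_eq0// mul0r.
rewrite [0 ^+ 2]expr0n /= preg_at0 /= mulr0 addr0.
have jp : (0 + k + i < p)%N by [].
by rewrite expr0n muln_eq0 subn_eq0 leqNgt jp /= !mul0r !mulr0.
Qed.

(** For i < p the kernel and its flip agree to first order across the diagonal; for i = p there is a
    jump, as for a fundamental solution. *)
Lemma wronskE i s : 0 < s -> wronsk i s = if i == p then acoef p * xi p 0 else 0.
Proof.
move=> s0; rewrite -wronsk_ext_at0.
have cst t : 0 < t -> wronsk i t = wronsk i s.
  move=> t0; have m0 : 0 < Num.min s t by rewrite lt_min s0.
  apply: (@derive0_cst _ (wronsk i) (Num.min s t) (Num.max s t)).
  - move=> x /andP[x1 _]; apply: is_derive_wronsk; exact: lt_le_trans x1.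
  - by rewrite ge_min le_max lexx !orbT.
  - by rewrite ge_min le_max lexx.
have h1 : wronsk_ext i t @[t --> 0^'+] --> wronsk_ext i 0.
  by apply: cvg_at_right_filter; exact: continuous_wronsk_ext.
have h2 : wronsk_ext i t @[t --> 0^'+] --> wronsk i s.
  apply: cvg_near_cst; near=> t; rewrite -wronsk_extE ?cst//.
by apply: (cvg_unique _ h2 h1).
Unshelve. all: by end_near.
Qed.

Lemma fact_double : (p.*2)`!%:R = 2 ^+ p * p`!%:R * \prod_(q < p) (2 * q + 1)%:R :> R.
Proof.
elim: p => [|q IH]; first by rewrite /= fact0 big_ord0 !mulr1.
rewrite doubleS !factS !natrM IH big_ord_recr /= exprS.
have -> : (q.*2.+2)%:R = 2 * q.+1%:R :> R by rewrite -natrM mul2n doubleS.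
have -> : (2 * q + 1)%:R = q.*2.+1%:R :> R by rewrite addn1 mul2n.
ring.
Qed.

(** Only i = p contributes, and 2^p p! (2 p - 1)!! = (2 p)!. The normalization of the interior
    density comes from here. *)
Lemma wronsk_alternating_sum s : 0 < s ->
  \sum_(i < p.+1) (-1) ^+ i * wronsk i s = (p.*2)`!%:R.
Proof.
move=> s0; rewrite big_ord_recr /= big1 => [|i _]; last first.
  by rewrite wronskE// ltn_eqF// mulr0.
rewrite wronskE// eqxx add0r xi_at0 fact_double /acoef ffactnn !mulrA -exprMn.
by rewrite mulrNN mul1r.
Qed.

End WronskianValue.

Lemma continuous_bounded_itv (R : realType) (f : R -> R) (a b : R) :
  (forall x, a <= x <= b -> {for x, continuous f}) ->
  exists2 C, 0 <= C & forall x, a <= x <= b -> `|f x| <= C.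
Proof.
move=> cf; have [ab|ba] := leP a b; last first.
  by exists 0 => // x /andP[ax xb]; move: (lt_le_trans ba (le_trans ax xb)); rewrite ltxx.
have cn : {within `[a, b], continuous (fun x => `|f x|)}%classic.
  apply: continuous_in_subspaceT => x /set_mem; rewrite /= in_itv /= => xab.
  by apply: continuous_comp; [exact: cf|exact: norm_continuous].
have [c _ hc] := EVT_max ab cn; by exists `|f c|.
Qed.

(** * Symmetry of the radial kernel near the diagonal *)

Section FlipBound.
Variables (R : realType) (p : nat).
Implicit Types (s t rho sig : R) (i j k : nat).
Local Notation n := (p.*2.+1).
Local Notation preg := (@preg R n).
Local Notation dpreg := (@dpreg R n).
Local Notation acoef := (@acoef R p).
Local Notation radker := (@radker R p).
Local Notation dradker := (@dradker R p).
Local Notation dradker' := (@dradker' R p).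

Lemma bilinear_bounded (a r : R) (N : nat) (c : nat -> R) (f g : nat -> R -> R) :
  (forall k, exists2 C, 0 <= C & forall x, a <= x <= r -> `|f k x| <= C) ->
  (forall k, exists2 C, 0 <= C & forall x, a <= x <= r -> `|g k x| <= C) ->
  exists2 C, 0 <= C & forall x y, a <= x <= r -> a <= y <= r ->
    `|\sum_(k < N) c k * f k x * g k y| <= C.
Proof.
move=> hf hg; elim: N => [|N [C C0 hC]].
  by exists 0 => // x y _ _; rewrite big_ord0 normr0.
have [Cf Cf0 hCf] := hf N; have [Cg Cg0 hCg] := hg N.
exists (C + `|c N| * Cf * Cg) => [|x y hx hy]; first by rewrite addr_ge0// !mulr_ge0.
rewrite big_ord_recr /=; apply: le_trans (ler_normD _ _) _; apply: lerD; first exact: hC.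
rewrite !normrM; apply: ler_pM => //; last exact: hCg.
by rewrite ler_wpM2l//; exact: hCf.
Qed.

Lemma psi_bounded (a r : R) k : 0 < a -> exists2 C, 0 <= C & forall x, a <= x <= r -> `|psi k x| <= C.
Proof.
move=> a0; exists (psi k a) => [|x /andP[ax _]]; first exact/ltW/psi_gt0.
rewrite ger0_norm; last exact/ltW/psi_gt0/(lt_le_trans a0).
exact: psi_decreasing.
Qed.

Lemma continuous_sqr_comp (f df : R -> R) : (forall x : R, is_derive x 1 f (df x)) ->
  continuous (fun s => f (s ^+ 2)).
Proof.
move=> h x; apply: continuous_comp; first exact: exprn_continuous.
apply: differentiable_continuous; apply/derivable1_diffP.
by case: (h (x ^+ 2)).
Qed.

Lemma preg_bounded (a r : R) k :
  exists2 C, 0 <= C & forall x, a <= x <= r -> `|preg k (x ^+ 2)| <= C.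
Proof.
apply: continuous_bounded_itv => x _; apply: (@continuous_sqr_comp _ (dpreg k)) => y.
exact: is_derive_preg.
Qed.

Lemma dpreg_bounded (a r : R) k :
  exists2 C, 0 <= C & forall x, a <= x <= r -> `|dpreg k (x ^+ 2)| <= C.
Proof.
apply: continuous_bounded_itv => x _; apply: (@continuous_sqr_comp _ (@ddpreg R n k)) => y.
exact: is_derive_dpreg.
Qed.

Lemma flip_derivative_bounded i (a r : R) : 0 < a ->
  exists2 C, 0 <= C & forall rho sig, a <= rho <= r -> a <= sig <= r ->
    `|dradker i rho sig - dradker' i sig rho| <= C.
Proof.
move=> a0.
have [C1 C10 h1] := @bilinear_bounded a r p.+1 (fun k => acoef (k + i)) (fun k => psi (k + i))
   (fun k x => dpreg k (x ^+ 2)) (fun k => psi_bounded r (k + i) a0) (dpreg_bounded a r).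
have [C2 C20 h2] := @bilinear_bounded a r p.+1 (fun k => acoef (k + i)) (fun k => psi (k + i).+1)
   (fun k x => preg k (x ^+ 2)) (fun k => psi_bounded r (k + i).+1 a0) (preg_bounded a r).
exists (2 * `|r| * C1 + `|r| * C2) => [|rho sig hr hs]; first by rewrite addr_ge0 ?mulr_ge0.
have sr : `|sig| <= `|r|.
  case/andP: hs => h3 h4; have s0 := le_trans (ltW a0) h3.
  by rewrite !ger0_norm// (le_trans s0).
rewrite /dradker /dradker' opprK; apply: le_trans (ler_normD _ _) _; rewrite !normrM ger0_norm//.
apply: lerD; apply: ler_pM; rewrite ?mulr_ge0//; last 2 first.
- exact: h1.
- exact: h2.
by rewrite ler_wpM2l.
Qed.

(** The difference of the kernel and its flip vanishes on the diagonal, and so does its derivative,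
    since the Wronskian is 0 for i < p. Integrating the bound on its Laplacian twice gains two
    powers; the weight s^(2p) costs the factor (r / a)^(2p). *)
Lemma flip_step i l (a r C : R) : 0 < a -> 0 <= C -> (i < p)%N ->
  (forall rho sig, a <= rho <= r -> a <= sig <= r ->
    `|(radker i rho sig + radker i.+1 rho sig) - (radker i sig rho + radker i.+1 sig rho)|
       <= C * `|sig - rho| ^+ l) ->
  forall rho sig, a <= rho <= r -> a <= sig <= r ->
    `|radker i rho sig - radker i sig rho| <= (r / a) ^+ p.*2 * C * `|sig - rho| ^+ l.+2.
Proof.
move=> a0 C0 ip H rho sig hr hs.
have pos x : a <= x <= r -> 0 < x by case/andP => h _; exact: lt_le_trans h.
pose D x := radker i rho x - radker i x rho.
pose dD x := dradker i rho x - dradker' i x rho.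
have hD x : a <= x <= r -> is_derive x 1 D (dD x).
  by move=> hx; apply: is_deriveB; [exact: is_derive_radker|exact/is_derive_radker'/pos].
have hU x : a <= x <= r -> is_derive x 1 (fun x => x ^+ p.*2 * dD x) (x ^+ p.*2 *
   ((radker i rho x + radker i.+1 rho x) - (radker i x rho + radker i.+1 x rho))).
  move=> hx; have := is_deriveB (radker_laplacian p i rho x) (radker_laplacian' p i rho (pos x hx)).
  congr is_derive; last by rewrite mulrBr.
  by apply/funext => y; rewrite /dD mulrBr.
have U0 : rho ^+ p.*2 * dD rho = 0.
  by have := wronskE p i (pos rho hr); rewrite ltn_eqF.
have D0 : D rho = 0 by rewrite /D subrr.
have rp : 0 < r by case/andP: hr => h1 h2; exact: lt_le_trans (lt_le_trans a0 h1) h2.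
have hdD x : a <= x <= r -> `|x - rho| <= `|sig - rho| ->
    `|dD x| <= (r / a) ^+ p.*2 * C * `|sig - rho| ^+ l.+1.
  move=> hx xs.
  have [|y yI E] := mvt (f := fun x => x ^+ p.*2 * dD x) (a := rho) (b := x)
     (df := fun x => x ^+ p.*2 *
   ((radker i rho x + radker i.+1 rho x) - (radker i x rho + radker i.+1 x rho))).
    by move=> y yI; apply: hU; exact: (between_itv hr hx yI).
  have hy := between_itv hr hx yI; have yd := le_trans (between_dist yI) xs.
  rewrite U0 subr0 in E.
  have xp : 0 < x ^+ p.*2 by rewrite exprn_gt0// pos.
  rewrite -(@ler_pM2l _ (x ^+ p.*2))// -{1}(ger0_norm (ltW xp)) -normrM E !normrM.
  have y0 := ltW (pos y hy).
  have h1 : `|y ^+ p.*2| <= r ^+ p.*2.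
    by rewrite ger0_norm ?exprn_ge0// lerXn2r ?nnegrE// ?(ltW rp)//; case/andP: hy.
  have h2 : r ^+ p.*2 <= x ^+ p.*2 * (r / a) ^+ p.*2.
    have rx : r <= x * (r / a).
      by rewrite mulrCA ler_peMr ?(ltW rp)// ler_pdivlMr// mul1r; case/andP: hx.
    by rewrite -exprMn lerXn2r ?nnegrE ?(ltW rp)// (le_trans (ltW rp)).
  apply: (@le_trans _ _ (r ^+ p.*2 * (C * `|sig - rho| ^+ l) * `|sig - rho|)).
    have h3 := le_trans (H _ _ hr hy) (ler_wpM2l C0 (lerXn2r l (normr_ge0 _) (normr_ge0 _) yd)).
    by rewrite ler_pM ?mulr_ge0// ler_pM.
  rewrite -!mulrA -exprSr [leRHS]mulrA; apply: ler_pM => //.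
  - by rewrite exprn_ge0// ltW.
  - by rewrite mulr_ge0// exprn_ge0.
have [|y yI E] := mvt (f := D) (df := dD) (a := rho) (b := sig).
  by move=> y yI; apply: hD; exact: (between_itv hr hs yI).
rewrite -[radker i rho sig - _]/(D sig) -[D sig]subr0 -D0 E normrM exprSr mulrA.
by rewrite ler_wpM2r// hdD//; [exact: (between_itv hr hs yI)|exact: between_dist yI].
Qed.

Lemma flip_lipschitz i (a r : R) : 0 < a ->
  exists2 C, 0 <= C & forall rho sig, a <= rho <= r -> a <= sig <= r ->
    `|radker i rho sig - radker i sig rho| <= C * `|sig - rho|.
Proof.
move=> a0; have [C C0 hC] := flip_derivative_bounded i r a0.
exists C => // rho sig hr hs.
have := @derive_bound_lipschitz R (fun x => radker i rho x - radker i x rho)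
  (fun x => dradker i rho x - dradker' i x rho) a r C rho sig.
rewrite subrr subr0; apply=> // x hx; last exact: hC.
apply: is_deriveB; first exact: is_derive_radker.
by apply: is_derive_radker'; case/andP: hx => h _; exact: lt_le_trans h.
Qed.

(** Descending induction from index p, where only a Lipschitz bound is available; each level below
    gains two powers. The Laplacian at one level involves the difference at that level too, so an
    inner induction on l raises its order step by step. *)
Lemma flip_bound_aux (d : nat) (a r : R) : 0 < a -> (d <= p)%N ->
  exists2 C, 0 <= C & forall rho sig, a <= rho <= r -> a <= sig <= r ->
    `|radker (p - d) rho sig - radker (p - d) sig rho| <= C * `|sig - rho| ^+ d.*2.+1.
Proof.
move=> a0; elim: d => [|d IH] dp.
  have [C C0 hC] := flip_lipschitz (p - 0) r a0.
  by exists C => // rho sig hr hs; rewrite expr1; exact: hC.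
have [C1 C10 h1] := IH (ltnW dp).
suff H l : (l <= d.+1)%N -> exists2 C, 0 <= C & forall rho sig, a <= rho <= r -> a <= sig <= r ->
    `|radker (p - d.+1) rho sig - radker (p - d.+1) sig rho| <= C * `|sig - rho| ^+ l.*2.+1.
  exact: H.
elim: l => [|l IHl] ld.
  have [C C0 hC] := flip_lipschitz (p - d.+1) r a0.
  by exists C => // rho sig hr hs; rewrite expr1; exact: hC.
have [C C0 hC] := IHl (ltnW ld).
have C2 : 0 <= C + C1 * `|r| ^+ (d - l).*2 by rewrite addr_ge0// mulr_ge0// exprn_ge0.
exists ((r / a) ^+ p.*2 * (C + C1 * `|r| ^+ (d - l).*2)) => [|rho sig hr hs].
  rewrite mulr_ge0// -mul2n exprM exprn_ge0// sqr_ge0//.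
have ip : (p - d.+1 < p)%N by rewrite ltn_subrL /= (leq_trans _ dp).
apply: (flip_step a0 C2 ip) => // {hr hs}rho {}sig hr hs.
have -> : radker (p - d.+1) rho sig + radker (p - d.+1).+1 rho sig -
   (radker (p - d.+1) sig rho + radker (p - d.+1).+1 sig rho) =
   (radker (p - d.+1) rho sig - radker (p - d.+1) sig rho) +
   (radker (p - d.+1).+1 rho sig - radker (p - d.+1).+1 sig rho) by ring.
apply: le_trans (ler_normD _ _) _; rewrite mulrDl; apply: lerD; first exact: hC.
rewrite subnSK//; apply: le_trans (h1 _ _ hr hs) _.
rewrite -mulrA ler_wpM2l//.
have -> : d.*2.+1 = ((d - l).*2 + l.*2.+1)%N by rewrite addnS -doubleD subnK.
rewrite exprD ler_wpM2r ?exprn_ge0// lerXn2r ?nnegrE//.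
case/andP: hr => r1 r2; case/andP: hs => s1 s2.
by rewrite (ger0_norm (le_trans (ltW a0) (le_trans r1 r2))) ler_norml; lra.
Qed.

Lemma flip_bound (a r : R) : 0 < a ->
  exists2 C, 0 <= C & forall rho sig, a <= rho <= r -> a <= sig <= r ->
    `|radker 0 rho sig - radker 0 sig rho| <= C * `|sig - rho| ^+ n.
Proof. by move=> a0; have := @flip_bound_aux p a r a0 (leqnn p); rewrite subnn. Qed.

End FlipBound.

(** * Averages over spheres *)

Section Reflections.
Variables (R : realType) (n : nat).
Implicit Types (x y z u v w : 'rV[R]_n) (V W : seq (R * 'rV[R]_n)) (h c : R).

Lemma ip_cauchy_schwarz V W : ip V W ^+ 2 <= ip V V * ip W W.
Proof.
have H a b : 0 <= a ^+ 2 * ip V V + 2 * a * b * ip V W + b ^+ 2 * ip W W.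
  have := ip_ge0 (scalem a V ++ scalem b W).
  rewrite ip_catl !ip_catr !ip_scalel !ip_scaler (ipC W V); congr (_ <= _); ring.
have [W0|W0] := eqVneq (ip W W) 0.
  have [->|VW] := eqVneq (ip V W) 0; first by rewrite W0 mulr0 expr0n.
  have := H 1 (- (ip V V + 1) / (2 * ip V W)); rewrite W0 mulr0 addr0.
  have -> : 1 ^+ 2 * ip V V + 2 * 1 * (- (ip V V + 1) / (2 * ip V W)) * ip V W = -1.
    by field.
  by rewrite lerNr oppr0 ler10.
have Wp : 0 < ip W W by rewrite lt_neqAle eq_sym W0 ip_ge0.
have := H (ip W W) (- ip V W).
have -> : ip W W ^+ 2 * ip V V + 2 * ip W W * - ip V W * ip V W + (- ip V W) ^+ 2 * ip W W
  = ip W W * (ip V V * ip W W - ip V W ^+ 2) by ring.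
by rewrite pmulr_rge0// subr_ge0.
Qed.

Definition nrm x : R := Num.sqrt (sqn x).

Lemma nrm_ge0 x : 0 <= nrm x. Proof. exact: sqrtr_ge0. Qed.

Lemma sqr_nrm x : nrm x ^+ 2 = sqn x.
Proof. by rewrite sqr_sqrtr// sqn_ge0. Qed.

Lemma nrmD x y : nrm (x + y) <= nrm x + nrm y.
Proof. exact: sqrt_sqnD. Qed.

Lemma nrmN x : nrm (- x) = nrm x.
Proof. by rewrite /nrm sqnN. Qed.

Lemma nrmB_ge x y : nrm x - nrm y <= nrm (x - y).
Proof. by rewrite lerBlDr -{1}(subrK y x); exact: nrmD. Qed.

Lemma nrmB_le x y : nrm (x - y) <= nrm x + nrm y.
Proof. by rewrite -(nrmN y); exact: nrmD. Qed.

Lemma nrmZ c x : nrm (c *: x) = `|c| * nrm x.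
Proof. by rewrite /nrm sqnZ sqrtrM ?sqr_ge0// sqrtr_sqr. Qed.

Lemma nrm0 : nrm 0 = 0.
Proof. by rewrite /nrm /sqn dot0l sqrtr0. Qed.

Lemma dot_le_nrm x y : `|dot x y| <= nrm x * nrm y.
Proof.
rewrite ler_norml cauchy_schwarz andbT lerNl -dotNl -(nrmN x).
exact: cauchy_schwarz.
Qed.

(* Householder reflection; as x / 0 = 0, it is the identity when w = 0. *)
Definition refl w x : 'rV[R]_n := x - (2 * dot x w / sqn w) *: w.

Lemma reflD w x y : refl w (x + y) = refl w x + refl w y.
Proof.
rewrite /refl dotDl mulrDr mulrDl scalerDl opprD; rewrite !addrA; congr (_ - _).
by rewrite addrAC.
Qed.

Lemma reflZ w c x : refl w (c *: x) = c *: refl w x.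
Proof. by rewrite /refl dotZl scalerBr scalerA; congr (_ - _ *: _); ring. Qed.

Lemma reflB w x y : refl w (x - y) = refl w x - refl w y.
Proof. by rewrite reflD -scaleN1r reflZ scaleN1r. Qed.

Lemma refl0 x : refl 0 x = x.
Proof. by rewrite /refl scaler0 subr0. Qed.

Lemma sqn_refl w x : sqn (refl w x) = sqn x.
Proof.
have [w0|w0] := eqVneq (sqn w) 0; first by rewrite (sqn_eq0 w0) refl0.
by rewrite /refl sqnB sqnZ dotZr; field.
Qed.

Lemma nrm_refl w x : nrm (refl w x) = nrm x.
Proof. by rewrite /nrm sqn_refl. Qed.

Lemma dot_refl w x y : dot (refl w x) y = dot x (refl w y).
Proof.
rewrite /refl dotDl dotDr dotNl dotNr dotZl dotZr (dotC w y).
by congr (_ - _); ring.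
Qed.

Lemma ker_refl w x y : ker (refl w x) (refl w y) = ker x y.
Proof. by rewrite /ker !edistE -reflB sqn_refl. Qed.

Lemma refl_transitive x y : sqn x = sqn y -> exists w, refl w x = y.
Proof.
move=> xy; exists (x - y); have [e0|e0] := eqVneq (sqn (x - y)) 0.
  by have /eqP := sqn_eq0 e0; rewrite subr_eq0 => /eqP ->; rewrite subrr refl0.
rewrite /refl; have -> : 2 * dot x (x - y) / sqn (x - y) = 1.
  have -> : 2 * dot x (x - y) = sqn (x - y).
    by rewrite sqnB -xy /sqn dotDr dotNr; ring.
  by rewrite divff.
by rewrite scale1r opprB addrCA subrr addr0.
Qed.

(** Reflecting the standard basis yields orthonormal frames that make second differences covariant
    under reflections. *)
Definition frame w (i : 'I_n) : 'rV[R]_n := refl w (delta_mx 0 i).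

Lemma dot_delta x i : dot x (delta_mx 0 i) = x 0 i.
Proof.
rewrite /dot (bigD1 i)//= mxE !eqxx mulr1 big1 ?addr0// => j ji.
by rewrite mxE eqxx (negPf ji) mulr0.
Qed.

Lemma sqn_frame w i : sqn (frame w i) = 1.
Proof. by rewrite sqn_refl /sqn dot_delta mxE !eqxx. Qed.

Lemma frame_parseval w z : \sum_i dot z (frame w i) ^+ 2 = sqn z.
Proof.
under eq_bigr do rewrite -dot_refl dot_delta.
by rewrite -(sqn_refl w z); apply: eq_bigr => i _; rewrite expr2.
Qed.

Definition sdiff w h (F : 'rV[R]_n -> R) x : R :=
  \sum_i (F (x + h *: frame w i) + F (x - h *: frame w i) - 2 * F x).

Lemma sdiff_refl w h F x : 0 <= h -> (forall z, nrm z <= nrm x + h -> F (refl w z) = F z) ->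
  sdiff w h F (refl w x) = sdiff 0 h F x.
Proof.
move=> h0 Fw; apply: eq_bigr => i _; rewrite /frame !refl0.
have nd : nrm (h *: delta_mx 0 i) = h.
  by rewrite nrmZ /nrm /sqn dot_delta mxE !eqxx sqrtr1 mulr1 ger0_norm.
rewrite -!reflZ -reflD -reflB !Fw// ?lerDl//.
- by rewrite -[in leRHS]nd nrmB_le.
- by rewrite -[in leRHS]nd nrmD.
Qed.

End Reflections.

Section Taylor.
Variable R : realType.
Implicit Types (t d w : R).

Lemma taylor2 (P P1 P2 : R -> R) t d w u v :
  u <= t <= v -> u <= t + d <= v ->
  (forall s, u <= s <= v -> is_derive s 1 P (P1 s)) ->
  (forall s, u <= s <= v -> is_derive s 1 P1 (P2 s)) ->
  (forall s, u <= s <= v -> `|s - t| <= `|d| -> `|P2 s - P2 t| <= w) ->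
  `|P (t + d) - P t - P1 t * d - 2^-1 * P2 t * d ^+ 2| <= w * d ^+ 2.
Proof.
move=> ht htd h1 h2 hw.
pose g1 s := P1 s - P1 t - P2 t * (s - t).
pose g s := P s - P t - P1 t * (s - t) - 2^-1 * P2 t * (s - t) ^+ 2.
have dl (s : R) : is_derive s 1 (fun s : R => s - t) 1 by apply: is_derive_eq; rewrite subr0.
have dg1 (s : R) : u <= s <= v -> is_derive s 1 g1 (P2 s - P2 t).
  move=> hs; have := is_deriveB (is_deriveB (h2 s hs) (is_derive_cst (P1 t) s 1))
     (is_deriveMl (P2 t) (dl s)).
  by rewrite subr0 mulr1.
have dg (s : R) : u <= s <= v -> is_derive s 1 g (g1 s).
  move=> hs; have := is_deriveB (is_deriveB (is_deriveB (h1 s hs) (is_derive_cst (P t) s 1))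
     (is_deriveMl (P1 t) (dl s))) (is_deriveMl (2^-1 * P2 t) (is_deriveMx (dl s) (dl s))).
  by congr is_derive; rewrite /g1; field.
have b1 (s : R) : u <= s <= v -> `|s - t| <= `|d| -> `|g1 s| <= w * `|d|.
  move=> hs sd; have [|c cI E] := mvt (f := g1) (df := fun s => P2 s - P2 t) (a := t) (b := s).
    by move=> c cI; apply: dg1; exact: between_itv cI.
  have g10 : g1 t = 0 by rewrite /g1 !subrr mulr0 subrr.
  rewrite -[g1 s]subr0 -g10 E normrM ler_pM// hw//; first exact: between_itv cI.
  exact: le_trans (between_dist cI) sd.
have [|c cI E] := mvt (f := g) (df := g1) (a := t) (b := t + d).
  by move=> c cI; apply: dg; exact: between_itv cI.
have gt0 : g t = 0 by rewrite /g !subrr !mulr0 expr0n mulr0 !subrr.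
have td : t + d - t = d by rewrite addrAC subrr add0r.
have gd : g (t + d) = P (t + d) - P t - P1 t * d - 2^-1 * P2 t * d ^+ 2.
  by rewrite /g td.
rewrite -gd -[g (t + d)]subr0 -gt0 E td normrM.
rewrite -[d ^+ 2]real_normK ?num_real// expr2 mulrA ler_wpM2r//.
apply: b1; first exact: between_itv cI.
by have := between_dist cI; rewrite td.
Qed.

End Taylor.

Section SecondDifferences.
Variables (R : realType) (n : nat).
Implicit Types (x y z u v w : 'rV[R]_n) (h c : R).

Lemma sqnD_frame z w h i (e : R) : e ^+ 2 = 1 ->
  sqn (z + (e * h) *: frame w i) = sqn z + (h ^+ 2 + 2 * e * h * dot z (frame w i)).
Proof.
by move=> e1; rewrite sqnD sqnZ dotZr sqn_frame exprMn e1; ring.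
Qed.

(** Along a frame vector f, |z|^2 changes by h^2 + 2 h <z, f> or h^2 - 2 h <z, f>. In Taylor's
    formula the odd terms cancel in pairs, and the squares <z, f>^2 add up to |z|^2 by Parseval. *)
Lemma sdiff_radial (P P1 P2 : R -> R) w z h (om lo hi : R) :
  0 <= h -> 0 <= om -> lo <= sqn z <= hi ->
  (forall i e, e ^+ 2 = 1 -> lo <= sqn (z + (e * h) *: frame w i) <= hi) ->
  (forall s, lo <= s <= hi -> is_derive s 1 P (P1 s)) ->
  (forall s, lo <= s <= hi -> is_derive s 1 P1 (P2 s)) ->
  (forall s, lo <= s <= hi -> `|s - sqn z| <= h * (h + 2 * nrm z) -> `|P2 s - P2 (sqn z)| <= om) ->
  `|sdiff w h (fun x => P (sqn x)) z -
     h ^+ 2 * (4 * sqn z * P2 (sqn z) + 2 * n%:R * P1 (sqn z))| <=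
  h ^+ 2 * (n%:R * h ^+ 2 * `|P2 (sqn z)| + om * (2 * n%:R * h ^+ 2 + 8 * sqn z)).
Proof.
move=> h0 om0 hz hzh d1 d2 hom; set t := sqn z.
pose dp e i : R := h ^+ 2 + 2 * e * h * dot z (frame w i).
have nf i : nrm (frame w i) = 1 by rewrite /nrm sqn_frame sqrtr1.
have T e i : e ^+ 2 = 1 -> `|P (sqn (z + (e * h) *: frame w i)) - P t - P1 t * dp e i -
     2^-1 * P2 t * dp e i ^+ 2| <= om * dp e i ^+ 2.
  move=> e1; rewrite sqnD_frame//; apply: (@taylor2 _ P P1 P2 t (dp e i) om lo hi) => //.
    by rewrite /dp -sqnD_frame//; exact: hzh.
  move=> s hs sd; apply: hom => //; apply: le_trans sd _.
  have e1' : `|e| = 1.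
    by move/eqP: e1; rewrite sqrf_eq1 => /orP[] /eqP ->; rewrite ?normrN normr1.
  rewrite /dp; apply: le_trans (ler_normD _ _) _.
  rewrite ger0_norm ?sqr_ge0// expr2 mulrDr lerD2l !normrM e1' (ger0_norm h0) normr_nat mulr1.
  have := dot_le_nrm z (frame w i); rewrite nf mulr1 => h3.
  rewrite mulrAC mulrC; rewrite ler_wpM2l// ler_wpM2l//.
pose r e i := P (sqn (z + (e * h) *: frame w i)) - P t - P1 t * dp e i -
     2^-1 * P2 t * dp e i ^+ 2.
have S1 : \sum_i dot z (frame w i) ^+ 2 = t by exact: frame_parseval.
have S3 c : \sum_(i < n) c = n%:R * c by rewrite sumr_const card_ord mulr_natl.
have E : sdiff w h (fun x => P (sqn x)) z - h ^+ 2 * (4 * t * P2 t + 2 * n%:R * P1 t) =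
  n%:R * h ^+ 4 * P2 t + \sum_i (r 1 i + r (-1) i).
  rewrite /sdiff.
  have -> : \sum_i (P (sqn (z + h *: frame w i)) + P (sqn (z - h *: frame w i)) - 2 * P (sqn z)) =
    \sum_i (r 1 i + r (-1) i + (2 * h ^+ 2 * P1 t + h ^+ 4 * P2 t) +
       4 * h ^+ 2 * P2 t * dot z (frame w i) ^+ 2).
    by apply: eq_bigr => i _; rewrite /r /dp mul1r mulN1r scaleNr -/t; field.
  have S2 : \sum_i 4 * h ^+ 2 * P2 t * dot z (frame w i) ^+ 2 = 4 * h ^+ 2 * P2 t * t.
    by rewrite -mulr_sumr S1.
  by rewrite !big_split /= S2 !S3; ring.
rewrite E; apply: le_trans (ler_normD _ _) _.
have -> : h ^+ 2 * (n%:R * h ^+ 2 * `|P2 t| + om * (2 * n%:R * h ^+ 2 + 8 * t)) =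
  `|n%:R * h ^+ 4 * P2 t| + om * (2 * n%:R * h ^+ 4 + 8 * h ^+ 2 * t).
  have h40 : 0 <= n%:R * h ^+ 4 by rewrite mulr_ge0// exprn_ge0.
  by rewrite (normrM (n%:R * h ^+ 4)) (ger0_norm h40); ring.
rewrite lerD2l; apply: le_trans (ler_norm_sum _ _ _) _.
have -> : om * (2 * n%:R * h ^+ 4 + 8 * h ^+ 2 * t) = \sum_(i < n) om * (dp 1 i ^+ 2 + dp (-1) i ^+ 2).
  rewrite -mulr_sumr; congr (_ * _).
  have -> : \sum_(i < n) (dp 1 i ^+ 2 + dp (-1) i ^+ 2) =
    \sum_(i < n) (2 * h ^+ 4 + 8 * h ^+ 2 * dot z (frame w i) ^+ 2).
    by apply: eq_bigr => i _; rewrite /dp; ring.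
  have S2 : \sum_i 8 * h ^+ 2 * dot z (frame w i) ^+ 2 = 8 * h ^+ 2 * t.
    by rewrite -mulr_sumr S1.
  by rewrite big_split /= S2 S3; ring.
apply: ler_sum => i _; apply: le_trans (ler_normD _ _) _; rewrite mulrDr; apply: lerD; apply: T.
  by rewrite expr1n.
by rewrite sqrrN expr1n.
Qed.

End SecondDifferences.

(** * Near minimizers of the energy on a sphere *)

Section NearMinimizers.
Variables (R : realType) (n : nat) (rho : R).
Local Open Scope classical_set_scope.
Implicit Types (x y w : 'rV[R]_n) (V W : seq (R * 'rV[R]_n)).

Definition sphere_prob V :=
  (forall a, a \in V -> 0 <= a.1 /\ sqn a.2 = rho ^+ 2) /\ mass V = 1.

Lemma sphere_prob_tvar V : sphere_prob V -> tvar V = 1.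
Proof.
move=> [h <-]; apply: eq_big_seq => a aV; rewrite ger0_norm//; by case: (h a aV).
Qed.

Definition energies : set R := [set ip V V | V in [set V | sphere_prob V]].

Lemma energy_ge_inf V : sphere_prob V -> inf energies <= ip V V.
Proof.
move=> hV; apply: ge_inf; last by exists V.
by exists 0 => _ [W _ <-]; exact: ip_ge0.
Qed.

Definition half_sum V W := scalem 2^-1 V ++ scalem 2^-1 W.

Lemma sphere_prob_half_sum V W : sphere_prob V -> sphere_prob W -> sphere_prob (half_sum V W).
Proof.
move=> [hV mV] [hW mW]; split; last by rewrite mass_cat !mass_scale mV mW; field.
move=> a; rewrite mem_cat => /orP[] /mapP[b bV ->] /=.
  by have [b1 b2] := hV b bV; rewrite mulr_ge0.
by have [b1 b2] := hW b bV; rewrite mulr_ge0.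
Qed.

(* Parallelogram identity: near minimizers of a convex energy are close. *)
Lemma near_minimizers_close V W d x : 0 <= d -> sphere_prob V -> sphere_prob W ->
  ip V V <= inf energies + d ^+ 2 -> ip W W <= inf energies + d ^+ 2 ->
  `|pot V x - pot W x| <= 2 * d.
Proof.
move=> d0 pV pW hV hW; have := energy_ge_inf (sphere_prob_half_sum pV pW).
rewrite /half_sum ip_catl !ip_catr !ip_scalel !ip_scaler (ipC W V) => hm.
pose D := V ++ scalem (-1) W.
have DD : ip D D <= (2 * d) ^+ 2.
  rewrite /D ip_catl !ip_catr !ip_scalel !ip_scaler (ipC W V) exprMn; lra.
(* Evaluating a potential at x is pairing with the unit atom at x, of energy 1; by Cauchy-Schwarz an
   energy bound is a uniform bound. *)
have E : pot V x - pot W x = ip D [:: (1, x)].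
  rewrite ipC /ip /ev big_seq1 /= mul1r /D pot_cat pot_scale mulN1r //.
have XX : ip [:: (1, x)] [:: (1, x)] = 1.
  by rewrite /ip /pot /ev !big_seq1 /= kerxx !mul1r.
have := ip_cauchy_schwarz D [:: (1, x)]; rewrite -E XX mulr1 => h.
have {}h := le_trans h DD.
by rewrite -(@ler_pXn2r _ 2)// ?nnegrE ?mulr_ge0// real_normK// num_real.
Qed.

Definition refl_meas w V := [seq (a.1, refl w a.2) | a : R * 'rV[R]_n <- V].

Lemma pot_refl w V x : pot (refl_meas w V) (refl w x) = pot V x.
Proof.
rewrite /pot /ev big_map; apply: eq_bigr => a _ /=; by rewrite ker_refl.
Qed.

Lemma ip_refl w V : ip (refl_meas w V) (refl_meas w V) = ip V V.
Proof.
rewrite {1}/ip {1}/refl_meas /ev big_map; apply: eq_bigr => a _ /=; by rewrite pot_refl.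
Qed.

Lemma sphere_prob_refl w V : sphere_prob V -> sphere_prob (refl_meas w V).
Proof.
move=> [h m]; split; last by rewrite /mass big_map.
by move=> a /mapP[b bV ->] /=; rewrite sqn_refl; exact: h.
Qed.

End NearMinimizers.

Section UltraMean.
Variable R : realType.
Local Open Scope classical_set_scope.

Lemma ultra_bounded_cvg (T : Type) (U : set_system T) (u : T -> R) (C : R) : UltraFilter U ->
  (forall k, `|u k| <= C) -> cvg (u k @[k --> U]).
Proof.
move=> UU uC; have FU : ProperFilter (u @ U) by exact: fmap_proper_filter.
have : (u @ U) `[- C, C].
  by apply: nearW => k /=; rewrite in_itv /= -ler_norml.
move=> /(@segment_compact R (- C) C _ FU) [l [_ lcl]].
apply/cvg_ex; exists l => N Nl /=.
have [//|h] := in_ultra_setVsetC (u @^-1` N) UU.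
by have [x [] ] := lcl (~` N) N h Nl.
Qed.

End UltraMean.

(** [V k] has energy within (k + 1)^(-2) of the infimum. Closeness of near minimizers makes the
    potentials uniformly Cauchy, and applied to [V k] and its reflection it makes them
    asymptotically invariant. *)
Lemma exists_near_minimizers (R : realType) (n : nat) (rho : R) : 0 <= rho ->
  exists V : nat -> seq (R * 'rV[R]_n.+1), [/\
    forall k, sphere_prob rho (V k),
    forall k l x, (k <= l)%N -> `|pot (V k) x - pot (V l) x| <= 2 * k.+1%:R^-1 &
    forall k w x, `|pot (V k) (refl w x) - pot (V k) x| <= 2 * k.+1%:R^-1].
Proof.
move=> rho0.
have hinf : has_inf (@energies R n.+1 rho).
  split; last by exists 0 => _ [W _ <-]; exact: ip_ge0.
  pose e : R * 'rV[R]_n.+1 := (1, rho *: delta_mx 0 ord0).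
  exists (ip [:: e] [:: e]); exists [:: e] => //; split; last by rewrite /mass big_seq1.
  move=> a; rewrite inE => /eqP -> /=; split=> //.
  by rewrite sqnZ /sqn dot_delta mxE !eqxx mulr1.
have /choice[V hV] : forall k : nat, exists V : seq (R * 'rV[R]_n.+1),
    sphere_prob rho V /\ ip V V <= inf (energies n.+1 rho) + (k.+1%:R^-1) ^+ 2.
  move=> k; have e0 : 0 < (k.+1%:R^-1 : R) ^+ 2 by rewrite exprn_gt0// invr_gt0.
  by have [_ [V pV <-] h] := inf_adherent e0 hinf; exists V; split=> //; exact: ltW.
exists V; split=> [k|k l x kl|k w x]; first by case: (hV k).
  have [p1 h1] := hV k; have [p2 h2] := hV l.
  apply: (@near_minimizers_close _ _ rho) => //.
  apply: le_trans h2 _; rewrite lerD2l lerXn2r ?nnegrE ?invr_ge0//.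
  by rewrite lef_pV2 ?posrE ?ltr0n// ler_nat.
have [p1 h1] := hV k; rewrite -(pot_refl w (V k) x).
apply: (@near_minimizers_close _ _ rho) => //; first exact: sphere_prob_refl.
by rewrite ip_refl.
Qed.

(** * Laplacians as limits of second differences *)

Section LaplacianLimit.
Variables (R : realType) (n : nat).
Implicit Types (x w : 'rV[R]_n) (F G : 'rV[R]_n -> R) (c e h : R).

(* g is the Laplacian of F at x, computed by second differences uniformly over
   reflected standard frames. *)
Definition lapl F x (g : R) := forall e, 0 < e ->
  exists2 h0, 0 < h0 & forall h w, 0 < h <= h0 -> `|sdiff w h F x - h ^+ 2 * g| <= e * h ^+ 2.

Lemma lapl_eq F x g g' : lapl F x g -> g = g' -> lapl F x g'.
Proof. by move=> h <-. Qed.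

Lemma laplD F G x f g : lapl F x f -> lapl G x g -> lapl (fun y => F y + G y) x (f + g).
Proof.
move=> hF hG e e0; have e2 : 0 < e / 2 by rewrite divr_gt0.
have [a a0 ha] := hF _ e2; have [b b0 hb] := hG _ e2.
exists (Num.min a b) => [|h w /andP[h0 hh]]; first by rewrite lt_min a0.
move: hh; rewrite le_min => /andP[hA hB].
have -> : sdiff w h (fun y => F y + G y) x = sdiff w h F x + sdiff w h G x.
  by rewrite -big_split; apply: eq_bigr => i _ /=; ring.
rewrite mulrDr opprD addrACA; apply: le_trans (ler_normD _ _) _.
have -> : e * h ^+ 2 = e / 2 * h ^+ 2 + e / 2 * h ^+ 2 by field.
by apply: lerD; [apply: ha; rewrite h0|apply: hb; rewrite h0].
Qed.

Lemma laplZ c F x f : lapl F x f -> lapl (fun y => c * F y) x (c * f).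
Proof.
move=> hF e e0; have c0 : 0 < `|c| + 1 by rewrite ltr_wpDl.
have [a a0 ha] := hF (e / (`|c| + 1)) (divr_gt0 e0 c0).
exists a => // h w hh.
have -> : sdiff w h (fun y => c * F y) x = c * sdiff w h F x.
  by rewrite mulr_sumr; apply: eq_bigr => i _ /=; ring.
have -> : c * sdiff w h F x - h ^+ 2 * (c * f) = c * (sdiff w h F x - h ^+ 2 * f) by ring.
rewrite normrM; apply: (@le_trans _ _ (`|c| * (e / (`|c| + 1) * h ^+ 2))).
  by rewrite ler_wpM2l// ha.
have c1 : `|c| / (`|c| + 1) <= 1 by rewrite ler_pdivrMr// mul1r lerDl.
have -> : `|c| * (e / (`|c| + 1) * h ^+ 2) = `|c| / (`|c| + 1) * (e * h ^+ 2) by ring.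
by rewrite ler_piMl// mulr_ge0 ?sqr_ge0// ltW.
Qed.

Lemma lapl_sum (N : nat) (F : nat -> 'rV[R]_n -> R) x (f : nat -> R) :
  (forall k, lapl (F k) x (f k)) ->
  lapl (fun y => \sum_(k < N) F k y) x (\sum_(k < N) f k).
Proof.
move=> hF; elim: N => [|N IH].
  move=> e e0; exists 1 => // h w _; rewrite big_ord0 mulr0 subr0 /sdiff big1 ?normr0.
    by rewrite mulr_ge0 ?sqr_ge0// ltW.
  by move=> i _; rewrite !big_ord0 mulr0 subr0 addr0.
rewrite big_ord_recr /=.
have -> : (fun y => \sum_(k < N.+1) F k y) = fun y => \sum_(k < N) F k y + F N y.
  by apply/funext => y; rewrite big_ord_recr.
exact: laplD.
Qed.

(** By [sdiff_refl] the two Laplacians are limits of the same second differences at x. Invariance is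
    required only on a slightly larger ball, since F will be known only inside a sphere. *)
Lemma lapl_refl F x w f g d : 0 < d -> (forall z, nrm z <= nrm x + d -> F (refl w z) = F z) ->
  lapl F x f -> lapl F (refl w x) g -> f = g.
Proof.
move=> d0 Fw hf hg; apply/eqP; rewrite -subr_eq0 -normr_le0; apply/ler_addgt0Pl => e e0.
rewrite addr0; have e2 : 0 < e / 2 by rewrite divr_gt0.
have [a a0 ha] := hf _ e2; have [b b0 hb] := hg _ e2.
pose h := Num.min d (Num.min a b).
have h0 : 0 < h by rewrite !lt_min d0 a0 b0.
have hd : h <= d by rewrite ge_min lexx.
have hA : h <= a by rewrite !ge_min lexx /= orbT.
have hB : h <= b by rewrite !ge_min lexx /= !orbT.
have := ha h 0; rewrite h0 hA => /(_ isT) h1.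
have Fw' z : nrm z <= nrm x + h -> F (refl w z) = F z.
  by move=> hz; apply: Fw; apply: le_trans hz _; rewrite lerD2l.
have := hb h w; rewrite h0 hB (sdiff_refl (ltW h0) Fw') => /(_ isT) h2.
rewrite -(@ler_pM2r _ (h ^+ 2)) ?exprn_gt0// -{1}(ger0_norm (sqr_ge0 h)) -normrM.
have -> : (f - g) * h ^+ 2 = (sdiff 0 h F x - h ^+ 2 * g) - (sdiff 0 h F x - h ^+ 2 * f) by ring.
apply: le_trans (ler_normB _ _) _.
have -> : e * h ^+ 2 = e / 2 * h ^+ 2 + e / 2 * h ^+ 2 by field.
exact: lerD.
Qed.

Lemma lapl_radial (P dP ddP : R -> R) x :
  (forall s : R, is_derive s 1 P (dP s)) -> (forall s : R, is_derive s 1 dP (ddP s)) ->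
  continuous ddP ->
  lapl (fun y => P (sqn y)) x (4 * sqn x * ddP (sqn x) + 2 * n%:R * dP (sqn x)).
Proof.
move=> h1 h2 ch e e0; set t := sqn x; have t0 : 0 <= t by exact: sqn_ge0.
pose K := 2 * n%:R + 8 * t + 1; have K0 : 0 < K by rewrite ltr_wpDl// addr_ge0// mulr_ge0.
pose L := n%:R * `|ddP t| + 1; have L0 : 0 < L by rewrite ltr_wpDl// mulr_ge0.
pose om := e / (2 * K); have om0 : 0 < om by rewrite divr_gt0// mulr_gt0.
have /cvgrPdist_le/(_ om om0)[d /= d0 hd] := ch t.
pose N := 2 * nrm x + 2; have N0 : 0 < N by rewrite ltr_wpDl// mulr_ge0// nrm_ge0.
pose h0 := Num.min 1 (Num.min (d / N) (e / (2 * L))).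
exists h0 => [|h w /andP[hp hh]].
  by rewrite !lt_min ltr01 !divr_gt0// mulr_gt0.
have {hh}[hh1 [hh2 hh3]] : h <= 1 /\ h <= d / N /\ h <= e / (2 * L).
  by move: hh; rewrite !le_min => /and3P[].
have := @sdiff_radial R n P dP ddP w x h om (t - (h * N + 1)) (t + (h * N + 1)).
have hN0 : 0 <= h * N by apply: mulr_ge0; exact: ltW.
have hN : h * (h + 2 * nrm x) < h * N by rewrite ltr_pM2l// /N; lra.
move=> /(_ (ltW hp) (ltW om0)) H; apply: le_trans (H _ _ _ _ _) _ => //.
- by rewrite -/t; apply/andP; split; lra.
- move=> i c c1; rewrite sqnD_frame// -/t.
  have : `|h ^+ 2 + 2 * c * h * dot x (frame w i)| <= h * N; last first.
    by rewrite ler_norml => /andP[h3 h4]; apply/andP; split; lra.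
  apply: le_trans (ltW hN); apply: le_trans (ler_normD _ _) _.
  have c1' : `|c| = 1.
    by move/eqP: c1; rewrite sqrf_eq1 => /orP[] /eqP ->; rewrite ?normrN normr1.
  rewrite ger0_norm ?sqr_ge0// expr2 mulrDr lerD2l.
  rewrite (normrM _ (dot _ _)) (normrM _ h) (normrM 2 c) c1' (ger0_norm (ltW hp)) normr_nat mulr1.
  rewrite mulrAC mulrC ler_wpM2l ?(ltW hp)// ler_wpM2l//.
  by have := dot_le_nrm x (frame w i); rewrite [nrm (frame _ _)]/nrm sqn_frame sqrtr1 mulr1.
- move=> s _ hs; rewrite distrC; apply: hd; rewrite /= distrC; apply: le_lt_trans hs _.
  by apply: lt_le_trans hN _; rewrite -ler_pdivlMr.
rewrite -/t [leRHS]mulrC ler_wpM2l ?sqr_ge0//.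
have b1 : n%:R * h ^+ 2 * `|ddP t| <= e / 2.
  apply: (@le_trans _ _ (h * L)).
    rewrite mulrAC mulrC expr2 -mulrA ler_wpM2l ?(ltW hp)//.
    apply: (@le_trans _ _ (1 * (n%:R * `|ddP t|))); first by rewrite ler_wpM2r// mulr_ge0.
    by rewrite mul1r lerDl.
  by rewrite -ler_pdivlMr//; apply: le_trans hh3 _; rewrite invfM mulrA.
have b2 : om * (2 * n%:R * h ^+ 2 + 8 * t) <= e / 2.
  apply: (@le_trans _ _ (om * K)).
    rewrite ler_wpM2l ?(ltW om0)// /K -addrA; apply: lerD; last by rewrite lerDl.
    by rewrite -[leRHS]mulr1 ler_wpM2l ?mulr_ge0// exprn_ile1// ltW.
  by rewrite /om; rewrite le_eqVlt; apply/orP; left; apply/eqP; field; rewrite gt_eqF.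
lra.
Qed.

End LaplacianLimit.

(** * Averages over a sphere along an ultrafilter *)

Section SphereMean.
Variables (R : realType) (p : nat) (rho : R).
Local Open Scope classical_set_scope.
Local Notation n := (p.*2.+1).
Local Notation acoef := (@acoef R p).
Implicit Types (x y z w : 'rV[R]_n) (g : 'rV[R]_n -> R) (h d e : R).

Variables (V : nat -> seq (R * 'rV[R]_n)) (U : set_system nat).
Hypothesis rho0 : 0 < rho.
Hypothesis hV : forall k, sphere_prob rho (V k).
Hypothesis hC : forall k l x, (k <= l)%N -> `|pot (V k) x - pot (V l) x| <= 2 * k.+1%:R^-1.
Hypothesis hR : forall k w x, `|pot (V k) (refl w x) - pot (V k) x| <= 2 * k.+1%:R^-1.
Hypothesis UU : UltraFilter U.
Hypothesis Uoo : \oo `<=` U.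

(** Near minimality gives convergence of potentials only. The singular kernels [fpsi j] must be
    averaged as well, and an ultrafilter limit is a linear functional on all functions bounded on
    the sphere. *)
Definition mean g : R := lim (ev (V k) g @[k --> U]).

Definition sph_le C g := forall y, sqn y = rho ^+ 2 -> `|g y| <= C.

Lemma sph_leZ C c g : sph_le C g -> sph_le (`|c| * C) (fun y => c * g y).
Proof. by move=> hg y hy; rewrite normrM ler_wpM2l// hg. Qed.

Lemma sph_leD C D g (h : 'rV[R]_n -> R) :
  sph_le C g -> sph_le D h -> sph_le (C + D) (fun y => g y + h y).
Proof.
by move=> a b y hy; apply: le_trans (ler_normD _ _) _; apply: lerD; [exact: a|exact: b].
Qed.

Lemma ev_sph_le k C g : sph_le C g -> `|ev (V k) g| <= C.
Proof.
move=> hg; have := @ev_bound R n (V k) g C; rewrite (sphere_prob_tvar (hV k)) mul1r.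
by apply=> a aV; apply: hg; have [h _] := hV k; case: (h a aV).
Qed.

Lemma cvg_mean C g : sph_le C g -> ev (V k) g @[k --> U] --> mean g.
Proof.
move=> hg; have : cvg (ev (V k) g @[k --> U]) by apply: (@ultra_bounded_cvg _ _ _ _ C) => // k; exact: ev_sph_le.
by [].
Qed.

Lemma mean_unique g l : ev (V k) g @[k --> U] --> l -> mean g = l.
Proof. by move=> h; apply/cvg_lim. Qed.

Lemma meanD C D g (h : 'rV[R]_n -> R) : sph_le C g -> sph_le D h -> mean (fun y => g y + h y) = mean g + mean h.
Proof.
move=> hg hh; apply: mean_unique; under eq_fun do rewrite evD.
by apply: cvgD; [exact: cvg_mean hg|exact: cvg_mean hh].
Qed.

Lemma meanZ C c g : sph_le C g -> mean (fun y => c * g y) = c * mean g.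
Proof.
move=> hg; apply: mean_unique; under eq_fun do rewrite evZ.
by apply: cvgM; [exact: cvg_cst|exact: cvg_mean hg].
Qed.

Lemma mean_sum (N : nat) (g : 'I_N -> 'rV[R]_n -> R) (C : R) : (forall i, sph_le C (g i)) ->
  mean (fun y => \sum_i g i y) = \sum_i mean (g i).
Proof.
move=> hg; apply: mean_unique.
have -> : (fun k => ev (V k) (fun y => \sum_i g i y)) = fun k => \sum_i ev (V k) (g i).
  apply/funext => k; rewrite /ev exchange_big /=; apply: eq_bigr => a _.
  by rewrite mulr_sumr.
by apply: cvg_sum_seq => i; exact: cvg_mean (hg i).
Qed.

Lemma mean_dist C D e g (h : 'rV[R]_n -> R) : sph_le C g -> sph_le D h ->
  (forall y, sqn y = rho ^+ 2 -> `|g y - h y| <= e) -> `|mean g - mean h| <= e.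
Proof.
move=> hg hh hgh.
have c : `|ev (V k) g - ev (V k) h| @[k --> U] --> `|mean g - mean h|.
  by apply: cvg_norm; apply: cvgB; [exact: cvg_mean hg|exact: cvg_mean hh].
apply: (cvgr_to_le c); apply: nearW => k.
have -> : ev (V k) g - ev (V k) h = ev (V k) (fun y => g y - h y).
  by rewrite /ev -sumrB; apply: eq_bigr => a _; rewrite mulrBr.
exact: ev_sph_le.
Qed.

Lemma mean_cst_on g c : (forall y, sqn y = rho ^+ 2 -> g y = c) -> mean g = c.
Proof.
move=> hg; apply: mean_unique.
have -> : (fun k => ev (V k) g) = fun=> c.
  apply/funext => k; rewrite (@eq_in_ev R n (V k) g (fun=> c)).
    by rewrite ev_cst; have [_ ->] := hV k; rewrite mul1r.
  by move=> a aV; apply: hg; have [h _] := hV k; case: (h a aV).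
exact: cvg_cst.
Qed.

Definition shell_pot x : R := mean (ker x).

Lemma sph_le_ker x : sph_le 1 (ker x).
Proof. by move=> y _; rewrite ger0_norm ?ker_le1// ltW// ker_gt0. Qed.

Lemma near_U k : \forall l \near U, (k <= l)%N.
Proof. by apply: Uoo; exists k. Qed.

Lemma shell_pot_approx k x : `|pot (V k) x - shell_pot x| <= 2 * k.+1%:R^-1.
Proof.
have c : `|pot (V k) x - pot (V l) x| @[l --> U] --> `|pot (V k) x - shell_pot x|.
  by apply: cvg_norm; apply: cvgB; [exact: cvg_cst|exact: cvg_mean (sph_le_ker x)].
apply: (cvgr_to_le c); near=> l; apply: hC; near: l; exact: near_U.
Unshelve. all: by end_near.
Qed.

Lemma shell_pot_refl w x : shell_pot (refl w x) = shell_pot x.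
Proof.
have c : pot (V l) (refl w x) - pot (V l) x @[l --> U] --> shell_pot (refl w x) - shell_pot x.
  by apply: cvgB; exact: cvg_mean (sph_le_ker _).
apply/eqP; rewrite -subr_eq0; apply/eqP.
suff c0 : pot (V l) (refl w x) - pot (V l) x @[l --> U] --> (0 : R) by exact: (cvg_unique _ c c0).
apply/cvgr0Pnorm_le => e e0.
have := @cvg_harmonic R => /cvgr0Pnorm_le/(_ (e / 2)) [|N _ HN]; first by rewrite divr_gt0.
near=> l; apply: le_trans (hR _ _ _) _.
have Nl : (N <= l)%N by near: l; exact: near_U.
have := HN l Nl; rewrite /= ger0_norm ?harmonic_ge0// /harmonic /= => h.
by rewrite -ler_pdivlMl// mulrC.
Unshelve. all: by end_near.
Qed.

(* Averages of the iterates of - (1/s) d/ds on exp (- s); F_0 is the potential. *)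
Definition psi_mean j x : R := mean (fun y => fpsi j (sqn (x - y))).

Lemma psi_mean0 x : psi_mean 0 x = shell_pot x.
Proof.
by congr mean; apply/funext => y; rewrite /fpsi psi0 /ker edistE.
Qed.

Lemma nrm_sph y : sqn y = rho ^+ 2 -> nrm y = rho.
Proof. by move=> h; rewrite /nrm h sqrtr_sqr ger0_norm// ltW. Qed.

Lemma fpsi_sph_le j x d : 0 < d -> d <= rho - nrm x -> sph_le (psi j d) (fun y => fpsi j (sqn (x - y))).
Proof.
move=> d0 hd y /nrm_sph hy; rewrite -[fpsi _ _]/(psi j (nrm (x - y))).
have h : d <= nrm (x - y).
  by rewrite -(nrmN (x - y)) opprB; apply: le_trans (nrmB_ge y x); rewrite hy.
by rewrite ger0_norm ?psi_decreasing// ltW// psi_gt0// (lt_le_trans d0).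
Qed.

Lemma sdiff_psi_mean j x h w d : 0 < d -> 0 <= h -> d + h <= rho - nrm x ->
  sdiff w h (psi_mean j) x = mean (fun y => sdiff w h (fun z => fpsi j (sqn z)) (x - y)).
Proof.
move=> d0 h0 hd.
have nf i e : `|e| = 1 -> d <= rho - nrm (x + (e * h) *: frame w i).
  move=> e1; have := nrmD x ((e * h) *: frame w i).
  rewrite nrmZ {3}/nrm sqn_frame sqrtr1 mulr1 normrM e1 mul1r ger0_norm//; lra.
have b e i : `|e| = 1 -> sph_le (psi j d) (fun y => fpsi j (sqn (x + (e * h) *: frame w i - y))).
  by move=> e1; apply: fpsi_sph_le => //; exact: nf.
have b0 : sph_le (psi j d) (fun y => fpsi j (sqn (x - y))) by apply: fpsi_sph_le => //; lra.
have b0' : sph_le (2 * psi j d) (fun y => (- 2) * fpsi j (sqn (x - y))).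
  by move=> y hy; rewrite normrM normrN normr_nat ler_wpM2l// b0.
have n1 : `|1 : R| = 1 by rewrite normr1.
have nn1 : `|-1 : R| = 1 by rewrite normrN normr1.
have b12 i : sph_le (psi j d + psi j d) (fun y => fpsi j (sqn (x + (1 * h) *: frame w i - y)) +
    fpsi j (sqn (x + (-1 * h) *: frame w i - y))).
  by move=> y hy; apply: le_trans (ler_normD _ _) _; apply: lerD; apply: b.
have b123 i : sph_le (psi j d + psi j d + 2 * psi j d)
   (fun y => fpsi j (sqn (x + (1 * h) *: frame w i - y)) +
    fpsi j (sqn (x + (-1 * h) *: frame w i - y)) + (- 2) * fpsi j (sqn (x - y))).
  by move=> y hy; apply: le_trans (ler_normD _ _) _; apply: lerD; [exact: b12|exact: b0'].
have -> : (fun y => sdiff w h (fun z => fpsi j (sqn z)) (x - y)) = (fun y =>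
   \sum_i (fpsi j (sqn (x + (1 * h) *: frame w i - y)) +
    fpsi j (sqn (x + (-1 * h) *: frame w i - y)) + (- 2) * fpsi j (sqn (x - y)))).
  apply/funext => y; apply: eq_bigr => i _ /=.
  by rewrite mul1r mulN1r scaleNr mulNr !(addrAC x (- y)).
rewrite (mean_sum b123); apply: eq_bigr => i _.
rewrite (meanD (b12 i) b0') (meanD (b 1 i n1) (b (-1) i nn1)) (meanZ (-2) b0).
by rewrite mul1r mulN1r scaleNr mulNr.
Qed.

Lemma fpsi_nrm j z : fpsi j (sqn z) = psi j (nrm z).
Proof. by []. Qed.

(** The Laplacian passes under the mean because |x - y| >= 2 d for all y on the sphere, which makes
    the error of the second differences uniform in y. *)
Lemma lapl_psi_mean j x : nrm x < rho ->
  lapl (psi_mean j) x (psi_mean j x - 2 * (p%:R - j%:R) * psi_mean j.+1 x).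
Proof.
move=> xr e e0; pose d := (rho - nrm x) / 2.
have d0 : 0 < d by rewrite divr_gt0// subr_gt0.
have dr : 2 * d = rho - nrm x by rewrite /d; field.
have x0 := nrm_ge0 x.
pose B := 8^-1 * psi j.+3 d.
have B0 : 0 <= B by rewrite mulr_ge0// ltW// psi_gt0.
pose K := 4^-1 * psi j.+2 d.
have K0 : 0 <= K by rewrite mulr_ge0// ltW// psi_gt0.
pose C := n%:R * rho * K + B * (5 * rho) * ((2 * n%:R + 32) * rho ^+ 2).
have r0 := ltW rho0.
have C0 : 0 <= C by do ?[apply: addr_ge0 => //|apply: mulr_ge0 => //|exact: sqr_ge0].
have C1 : 0 < C + 1 by rewrite ltr_wpDl.
exists (Num.min d (e / (C + 1))) => [|h w /andP[hp]]; first by rewrite lt_min d0 divr_gt0.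
rewrite le_min => /andP[hd he].
have h0 := ltW hp.
have hr : h <= rho by lra.
pose G y := fpsi j (sqn (x - y)) - 2 * (p%:R - j%:R) * fpsi j.+1 (sqn (x - y)).
have b0 i : sph_le (psi i d) (fun y => fpsi i (sqn (x - y))) by apply: fpsi_sph_le => //; lra.
have G1 := sph_leZ (- (2 * (p%:R - j%:R))) (b0 j.+1).
have GE : G = fun y => fpsi j (sqn (x - y)) + - (2 * (p%:R - j%:R)) * fpsi j.+1 (sqn (x - y)).
  by apply/funext => y; rewrite /G mulNr.
have bG := sph_leD (b0 j) G1; rewrite -GE in bG.
have EG : mean G = psi_mean j x - 2 * (p%:R - j%:R) * psi_mean j.+1 x.
  by rewrite GE (meanD (b0 j) G1) (meanZ _ (b0 j.+1)) mulNr.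
rewrite -EG -(meanZ (h ^+ 2) bG) (@sdiff_psi_mean j x h w d)//; last by lra.
have key y : sqn y = rho ^+ 2 ->
  `|sdiff w h (fun z => fpsi j (sqn z)) (x - y) - h ^+ 2 * G y| <= e * h ^+ 2.
  move=> /nrm_sph hy; set z := x - y.
  have z1 : 2 * d <= nrm z by rewrite dr /z -(nrmN (x - y)) opprB; apply: le_trans (nrmB_ge y x); rewrite hy.
  have z2 : nrm z <= 2 * rho by apply: le_trans (nrmB_le x y) _; rewrite hy; lra.
  have z0 : 0 < nrm z by apply: lt_le_trans z1; rewrite mulr_gt0.
  have -> : G y = 4 * sqn z * (4^-1 * fpsi j.+2 (sqn z)) + 2 * n%:R * (- 2^-1 * fpsi j.+1 (sqn z)).
    by rewrite /G -/z !fpsi_nrm -psi_laplacian ?gt_eqF// -(sqr_nrm z); field.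
  have sq_le (a b : R) : 0 <= a -> a <= b -> a ^+ 2 <= b ^+ 2 by move=> a0 ab; rewrite lerXn2r ?nnegrE// (le_trans a0).
  pose om := B * (h * (h + 2 * nrm z)).
  have om0 : 0 <= om by rewrite mulr_ge0// mulr_ge0// addr_ge0// mulr_ge0// nrm_ge0.
  have pos (s : R) : d ^+ 2 <= s -> 0 < s by move=> h1; apply: lt_le_trans h1; rewrite exprn_gt0.
  have H := @sdiff_radial R n (fpsi j) (fun s => - 2^-1 * fpsi j.+1 s) (fun s => 4^-1 * fpsi j.+2 s)
     w z h om (d ^+ 2) ((3 * rho) ^+ 2) h0 om0.
  have d2 (s : R) : 0 < s -> is_derive s 1 (fun s => - 2^-1 * fpsi j.+1 s) (4^-1 * fpsi j.+2 s).
    by move=> s0; have := is_deriveMl (- 2^-1) (is_derive_fpsi j.+1 s0); congr is_derive; field.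
  have d3 (s : R) : 0 < s -> is_derive s 1 (fun s => 4^-1 * fpsi j.+2 s) (- 8^-1 * fpsi j.+3 s).
    by move=> s0; have := is_deriveMl (4^-1) (is_derive_fpsi j.+2 s0); congr is_derive; field.
  apply: le_trans (H _ _ _ _ _) _.
  - by rewrite -sqr_nrm !sq_le ?nrm_ge0//; lra.
  - move=> i c c1; rewrite -sqr_nrm.
    have c1' : `|c| = 1.
      by move/eqP: c1; rewrite sqrf_eq1 => /orP[] /eqP ->; rewrite ?normrN normr1.
    have nh : nrm ((c * h) *: frame w i) = h.
      by rewrite nrmZ {1}/nrm sqn_frame sqrtr1 mulr1 normrM c1' mul1r ger0_norm.
    have h1 := nrmD z ((c * h) *: frame w i).
    have h2 := nrmB_ge z (- ((c * h) *: frame w i)); rewrite opprK nrmN nh in h2; rewrite nh in h1.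
    by rewrite !sq_le ?nrm_ge0//; lra.
  - by move=> s /andP[/pos s0 _]; exact: is_derive_fpsi.
  - by move=> s /andP[/pos s0 _]; exact: d2.
  - move=> s hs hsz; apply: le_trans (ler_wpM2l B0 hsz).
    apply: (@derive_bound_lipschitz _ (fun s => 4^-1 * fpsi j.+2 s) (fun s => - 8^-1 * fpsi j.+3 s) (d ^+ 2) ((3 * rho) ^+ 2)) => //.
    + by move=> t /andP[/pos t0 _]; exact: d3.
    + move=> t /andP[t1 _]; have t0 := pos t t1.
      have dt : d <= Num.sqrt t.
        by rewrite -(ger0_norm (ltW d0)) -sqrtr_sqr ler_sqrt// ltW.
      rewrite mulNr normrN normrM ger0_norm// /B ler_wpM2l// ger0_norm; last first.
        by rewrite ltW// psi_gt0// (lt_le_trans d0).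
      exact: psi_decreasing.
    + by rewrite -sqr_nrm !sq_le ?nrm_ge0//; lra.
  rewrite mulrC ler_wpM2r ?sqr_ge0//.
  have zz : sqn z <= 4 * rho ^+ 2.
    by rewrite -sqr_nrm; apply: le_trans (sq_le _ _ (ltW z0) z2) _; rewrite exprMn; lra.
  have omb : om <= B * (5 * rho) * h.
    rewrite /om -mulrA ler_wpM2l// mulrC ler_wpM2r//; lra.
  have p2 : `|4^-1 * fpsi j.+2 (sqn z)| <= K.
    rewrite normrM ger0_norm// ler_wpM2l// fpsi_nrm ger0_norm; last by rewrite ltW// psi_gt0.
    by apply: psi_decreasing => //; lra.
  have t1 : n%:R * h ^+ 2 * `|4^-1 * fpsi j.+2 (sqn z)| <= (n%:R * rho * K) * h.
    apply: (@le_trans _ _ (n%:R * h ^+ 2 * K)); first by rewrite ler_wpM2l// mulr_ge0// sqr_ge0.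
    have -> : n%:R * h ^+ 2 * K = (n%:R * h * K) * h by ring.
    by rewrite ler_wpM2r// ler_wpM2r// ler_wpM2l.
  have t2 : om * (2 * n%:R * h ^+ 2 + 8 * sqn z) <= B * (5 * rho) * ((2 * n%:R + 32) * rho ^+ 2) * h.
    apply: (@le_trans _ _ ((B * (5 * rho) * h) * ((2 * n%:R + 32) * rho ^+ 2))); last first.
      by rewrite mulrAC.
    apply: ler_pM => //.
      by rewrite addr_ge0// !mulr_ge0// ?sqr_ge0// sqn_ge0.
    rewrite [leRHS]mulrDl; apply: lerD; last by lra.
    by rewrite ler_wpM2l ?mulr_ge0// sq_le.
  apply: le_trans (lerD t1 t2) _; rewrite -mulrDl -/C.
  apply: (@le_trans _ _ ((C + 1) * h)); first by rewrite ler_wpM2r// lerDl.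
  by rewrite mulrC -ler_pdivlMr.
have bS : sph_le (e * h ^+ 2 + `|h ^+ 2| * (psi j d + `|- (2 * (p%:R - j%:R))| * psi j.+1 d))
    (fun y => sdiff w h (fun z => fpsi j (sqn z)) (x - y)).
  move=> y hy; rewrite -[X in `|X|](subrK (h ^+ 2 * G y)).
  by apply: le_trans (ler_normD _ _) _; apply: lerD; [exact: key|exact: (sph_leZ _ bG)].
exact: (mean_dist bS (sph_leZ _ bG) key).
Qed.

(** For j = 0 the invariance comes from energy minimization. An invariant function has an invariant
    Laplacian, and by [lapl_psi_mean] this contains psi_mean j.+1 with coefficient - 2 (p - j),
    nonzero for j < p. *)
Lemma psi_mean_refl j x w : (j <= p)%N -> nrm x < rho -> psi_mean j (refl w x) = psi_mean j x.
Proof.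
elim: j x => [|j IH] x jp xr; first by rewrite !psi_mean0 shell_pot_refl.
have jp' := ltnW jp.
have l1 := lapl_psi_mean j xr.
have xr' : nrm (refl w x) < rho by rewrite nrm_refl.
have l2 := lapl_psi_mean j xr'.
have d0 : 0 < (rho - nrm x) / 2 by rewrite divr_gt0// subr_gt0.
have := lapl_refl d0 _ l1 l2.
have h z : nrm z <= nrm x + (rho - nrm x) / 2 -> psi_mean j (refl w z) = psi_mean j z.
  by move=> hz; apply: IH => //; lra.
move=> /(_ h); rewrite (IH x jp' xr) => E.
have c0 : 2 * (p%:R - j%:R) != 0 :> R.
  by rewrite mulf_neq0// subr_eq0 eqr_nat gtn_eqF.
by apply: (mulfI c0); apply: oppr_inj; apply: (addrI (psi_mean j x)); rewrite E.
Qed.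

End SphereMean.

(** * A maximum principle for radial functions *)

Section MaximumPrinciple.
Variables (R : realType) (m : nat).
Local Open Scope classical_set_scope.
Local Notation n := m.+1.
Implicit Types (x y z w : 'rV[R]_n).

Definition e0 : 'rV[R]_n := delta_mx 0 ord0.

Lemma nrm_e0 (t : R) : nrm (t *: e0) = `|t|.
Proof. by rewrite nrmZ /nrm /sqn dot_delta mxE !eqxx sqrtr1 mulr1. Qed.

Lemma radial_of_refl (A : Type) (F : 'rV[R]_n -> A) x y :
  (forall w, F (refl w x) = F x) -> nrm x = nrm y -> F y = F x.
Proof.
move=> Fr xy; have [|w <-] := @refl_transitive R n x y; last exact: Fr.
by rewrite -!sqr_nrm xy.
Qed.

(** As Z is radial, its maximum over the ball is a maximum over a segment. If positive, it is
    attained in the interior, where second differences are at most 0 although the Laplacian equals Z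
    > 0. *)
Lemma lapl_max_principle (Z : 'rV[R]_n -> R) (s0 : R) : 0 < s0 ->
  (forall z, nrm z <= s0 -> Z z = Z (nrm z *: e0)) ->
  (forall t : R, 0 <= t <= s0 -> {for t, continuous (fun t : R => Z (t *: e0))}) ->
  (forall z, nrm z < s0 -> lapl Z z (Z z)) ->
  Z (s0 *: e0) <= 0 -> Z 0 <= 0.
Proof.
move=> s00 rad cont lap bd; rewrite leNgt; apply/negP => Z0.
have cn : {within `[0, s0], continuous (fun t : R => Z (t *: e0))}%classic.
  apply: continuous_in_subspaceT => t /set_mem; rewrite /= in_itv /= => ht; exact: cont.
have [t tI hmax] := EVT_max (ltW s00) cn; rewrite in_itv /= in tI; case/andP: tI => t0 ts.
set M := Z (t *: e0) in hmax.
have M0 : 0 < M.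
  by apply: lt_le_trans Z0 _; have := hmax 0; rewrite in_itv /= lexx ltW// scale0r; apply.
have ts' : t < s0.
  rewrite lt_neqAle ts andbT; apply/eqP => E; move: M0; rewrite /M E ltNge.
  by rewrite bd.
have nt : nrm (t *: e0) = t by rewrite nrm_e0 ger0_norm.
have [|a a0 ha] := lap (t *: e0) _ (M / 2) (divr_gt0 M0 (ltr0n _ 2)); first by rewrite nt.
pose h := Num.min a (s0 - t).
have h0 : 0 < h by rewrite lt_min a0 subr_gt0.
have ha' : h <= a by rewrite ge_min lexx.
have hs : h <= s0 - t by rewrite ge_min lexx orbT.
have le_M z : nrm z <= s0 -> Z z <= M.
  by move=> hz; rewrite rad//; apply: hmax; rewrite in_itv /= nrm_ge0.
have nf i : nrm (h *: frame (0 : 'rV[R]_n) i) = h.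
  by rewrite nrmZ /nrm sqn_frame sqrtr1 mulr1 gtr0_norm.
have sd : sdiff 0 h Z (t *: e0) <= 0.
  apply: sumr_le0 => i _.
  have h1 : Z (t *: e0 + h *: frame 0 i) <= M.
    by apply: le_M; apply: le_trans (nrmD _ _) _; rewrite nt nf; lra.
  have h2 : Z (t *: e0 - h *: frame 0 i) <= M.
    by apply: le_M; apply: le_trans (nrmB_le _ _) _; rewrite nt nf; lra.
  rewrite -/M; lra.
have := ha h 0; rewrite h0 ha' => /(_ isT); rewrite -/M ler_norml => /andP[h1 _].
have : 0 < h ^+ 2 * M by rewrite mulr_gt0// exprn_gt0.
lra.
Qed.

End MaximumPrinciple.

(** * The potential of a sphere at interior points *)

Section ShellPotential.
Variables (R : realType) (p : nat) (rho : R).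
Local Open Scope classical_set_scope.
Local Notation n := (p.*2.+1).
Local Notation acoef := (@acoef R p).
Local Notation radker := (@radker R p).
Implicit Types (x y z w : 'rV[R]_n).

Variables (V : nat -> seq (R * 'rV[R]_n)) (U : set_system nat).
Hypothesis rho0 : 0 < rho.
Hypothesis hV : forall k, sphere_prob rho (V k).
Hypothesis hC : forall k l x, (k <= l)%N -> `|pot (V k) x - pot (V l) x| <= 2 * k.+1%:R^-1.
Hypothesis hR : forall k w x, `|pot (V k) (refl w x) - pot (V k) x| <= 2 * k.+1%:R^-1.
Hypothesis UU : UltraFilter U.
Hypothesis Uoo : \oo `<=` U.
Local Notation psi_mean := (@psi_mean R p V U).
Local Notation e0 := (@e0 R p.*2).

Definition wmean j x : R := acoef j * psi_mean j x.
Definition wker j x : R := radker j rho (nrm x).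
Definition reg0 x : R := @preg R n 0 (sqn x).

Lemma lapl_wmean j x : nrm x < rho -> lapl (wmean j) x (wmean j x + wmean j.+1 x).
Proof.
move=> xr; apply: (lapl_eq (laplZ (acoef j) (lapl_psi_mean rho0 hV UU j xr))).
by rewrite /wmean acoefS; ring.
Qed.

Lemma wmean_refl j x w : nrm x < rho -> wmean j (refl w x) = wmean j x.
Proof.
move=> xr; have [jp|pj] := leqP j p; last by rewrite /wmean acoef_eq0// !mul0r.
by rewrite /wmean (psi_mean_refl rho0 hV hR UU Uoo).
Qed.

Lemma lapl_preg k x : lapl (fun y => @preg R n k (sqn y)) x
  (@preg R n k (sqn x) + (if k is k'.+1 then @preg R n k' (sqn x) else 0)).
Proof.
have := @lapl_radial R n (@preg R n k) (@dpreg R n k) (@ddpreg R n k) x.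
rewrite preg_laplacian//; apply.
- by move=> s; exact: is_derive_preg.
- by move=> s; exact: is_derive_dpreg.
- exact: continuous_ddpreg.
Qed.

Lemma lapl_wker j x : lapl (wker j) x (wker j x + wker j.+1 x).
Proof.
have E i : wker i = fun y => \sum_(k < p.+1) acoef (k + i) * psi (k + i) rho * @preg R n k (sqn y).
  by apply/funext => y; apply: eq_bigr => k _; rewrite sqr_nrm.
have := @lapl_sum R n p.+1 (fun k y => acoef (k + j) * psi (k + j) rho * @preg R n k (sqn y)) x
  (fun k => acoef (k + j) * psi (k + j) rho *
    (@preg R n k (sqn x) + (if k is k'.+1 then @preg R n k' (sqn x) else 0)))
  (fun k => laplZ _ (lapl_preg k x)).
rewrite -(E j) => /lapl_eq; apply; rewrite !E.
under eq_bigr do rewrite mulrDr.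
rewrite big_split /=; congr (_ + _).
rewrite (sum_preg_shift p j (fun i => psi i rho) (fun k => @preg R n k (sqn x))).
by apply: eq_bigr => k _; rewrite addnS.
Qed.

Lemma continuous_psi_mean j t : `|t| < rho ->
  {for t, continuous (fun t : R => psi_mean j (t *: e0))}.
Proof.
move=> tr; pose d := (rho - `|t|) / 2.
have d0 : 0 < d by rewrite divr_gt0// subr_gt0.
have dr : 2 * d = rho - `|t| by rewrite /d; field.
pose L := 3 * rho * psi j.+1 d.
have L0 : 0 <= L by rewrite !mulr_ge0 ?(ltW rho0)// ltW// psi_gt0.
have L1 : 0 < L + 1 by rewrite ltr_wpDl.
apply/cvgrPdist_le => e ep.
exists (Num.min d (e / (L + 1))) => [|s /=]; first by rewrite /= lt_min d0 divr_gt0.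
rewrite lt_min => /andP[sd se].
have st : `|s| <= `|t| + d.
  by have := ler_normB t (t - s); rewrite subKr; lra.
have bs : sph_le rho (psi j d) (fun y => fpsi j (sqn (s *: e0 - y))).
  by apply: fpsi_sph_le => //; rewrite nrm_e0; lra.
have bt : sph_le rho (psi j d) (fun y => fpsi j (sqn (t *: e0 - y))).
  by apply: fpsi_sph_le => //; rewrite nrm_e0; lra.
apply: (mean_dist hV UU bt bs) => y /(nrm_sph rho0) hy.
rewrite !fpsi_nrm.
have nb u : `|u| <= `|t| + d -> d <= nrm (u *: e0 - y) <= 3 * rho.
  move=> hu; apply/andP; split.
    by rewrite -(nrmN (_ - y)) opprB; apply: le_trans (nrmB_ge _ _); rewrite hy nrm_e0; lra.
  apply: le_trans (nrmB_le _ _) _; rewrite hy nrm_e0.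
  have := normr_ge0 t; lra.
have hs := nb s st; have ht : d <= nrm (t *: e0 - y) <= 3 * rho by apply: nb; lra.
apply: (@le_trans _ _ (L * `|nrm (t *: e0 - y) - nrm (s *: e0 - y)|)).
  apply: (@derive_bound_lipschitz _ (psi j) (fun u : R => - (u * psi j.+1 u)) d (3 * rho)) => //.
    by move=> x /andP[dx _]; apply: is_derive_psi; exact: lt_le_trans dx.
  move=> x /andP[dx xr]; have x0 : 0 < x by exact: lt_le_trans dx.
  have px := ltW (psi_gt0 j.+1 x0).
  rewrite normrN ger0_norm ?mulr_ge0 ?(ltW x0)//; apply: ler_pM => //; first exact: ltW.
  exact: psi_decreasing.
have h1 : `|nrm (t *: e0 - y) - nrm (s *: e0 - y)| <= `|t - s|.
  have E u v : (u *: e0 - y) - (v *: e0 - y) = (u - v) *: e0.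
    by rewrite opprB addrA subrK scalerBl.
  rewrite ler_norml; have a1 := nrmB_ge (t *: e0 - y) (s *: e0 - y).
  have a2 := nrmB_ge (s *: e0 - y) (t *: e0 - y).
  rewrite E nrm_e0 in a1; rewrite E nrm_e0 distrC in a2; lra.
apply: (@le_trans _ _ (L * (e / (L + 1)))); first by rewrite ler_wpM2l// (le_trans h1)// ltW.
rewrite mulrA ler_pdivrMr// mulrC ler_wpM2l ?(ltW ep)//; lra.
Qed.

Lemma continuous_wker j (t : R) : {for t, continuous (fun t : R => wker j (t *: e0))}.
Proof.
have -> : (fun t : R => wker j (t *: e0)) = radker j rho.
  apply/funext => s; rewrite /wker nrm_e0; apply: eq_bigr => k _.
  by rewrite real_normK// num_real.
apply: differentiable_continuous; apply/derivable1_diffP.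
by case: (is_derive_radker p j rho t).
Qed.

Lemma continuous_reg0 (t : R) : {for t, continuous (fun t : R => reg0 (t *: e0))}.
Proof.
have -> : (fun t : R => reg0 (t *: e0)) = fun t => @preg R n 0 (t ^+ 2).
  by apply/funext => s; rewrite /reg0 -sqr_nrm nrm_e0 real_normK// num_real.
have h : forall s : R, is_derive s 1 (@preg R n 0) (@dpreg R n 0 s).
  by move=> s; exact: is_derive_preg.
exact: (continuous_sqr_comp h).
Qed.

Lemma reg0_ge1 x : 1 <= reg0 x.
Proof. by rewrite /reg0 /preg /= fact0 expr0 divr1 mul1r gser0_ge1// sqn_ge0. Qed.

Lemma wmean0 j : wmean j 0 = wker j 0.
Proof.
rewrite /wmean /wker nrm0 /radker big_ord_recl big1 => [|k _]; last first.
  by rewrite expr0n /= preg_at0 mulr0.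
rewrite addr0 add0n expr0n preg_at0 eqxx mulr1; congr (_ * _).
apply: (mean_cst_on hV UU) => y hy; rewrite fpsi_nrm sub0r nrmN.
by rewrite (nrm_sph rho0 hy).
Qed.

(** Descending induction from p + 1, where both sides are 0. At level k the difference u then solves
    Delta u = u. Instead of boundary values on |x| = rho, where the kernels are singular, the
    argument uses u (0) = 0: from the centre every point of the sphere is at distance rho. *)
Lemma wmean_eq_wker j x : nrm x < rho -> wmean j x = wker j x.
Proof.
suff H i y : nrm y < rho -> wmean (p.+1 - i) y = wker (p.+1 - i) y.
  move=> xr; have [jp|pj] := leqP j p.+1; first by rewrite -(subKn jp); exact: H.
  rewrite /wmean acoef_eq0 1?ltnW// mul0r /wker /radker big1// => k _.
  by rewrite acoef_eq0 ?mul0r// ltn_addl// ltnW.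
elim: i y => [|i IH] y yr.
  rewrite subn0 /wmean acoef_eq0// mul0r /wker /radker big1// => k _.
  by rewrite acoef_eq0 ?mul0r// ltn_addl.
have [pi|ip] := leqP p.+1 i.
  have -> : (p.+1 - i.+1 = p.+1 - i)%N by lia.
  exact: IH.
set k := (p.+1 - i.+1)%N; have kS : (p.+1 - i = k.+1)%N by rewrite /k; lia.
rewrite kS in IH.
have [y0|y0] := eqVneq (nrm y) 0.
  by rewrite (@sqn_eq0 _ _ y) ?wmean0// -sqr_nrm y0 expr0n.
pose s0 := nrm y; have s00 : 0 < s0 by rewrite lt_neqAle eq_sym y0 nrm_ge0.
(* With this multiple of the positive solution removed, Z vanishes on |x| = |y| and equals - c at 0.
   The maximum principle for Z and - Z gives c = 0. *)
pose c := (wmean k y - wker k y) / reg0 y.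
pose Z x := wmean k x + (- wker k x + - c * reg0 x).
have r1 := reg0_ge1 y.
have refl_inv z w : nrm z < rho -> Z (refl w z) = Z z.
  by move=> zr; rewrite /Z wmean_refl// /wker /reg0 nrm_refl sqn_refl.
have Zrad z : nrm z <= s0 -> Z z = Z (nrm z *: e0).
  move=> zs; symmetry; apply: radial_of_refl => [w|]; last by rewrite nrm_e0 ger0_norm// nrm_ge0.
  by apply: refl_inv; exact: le_lt_trans yr.
have Zlap z : nrm z < rho -> lapl Z z (Z z).
  move=> zr; have := laplD (lapl_wmean k zr) (laplD (laplZ (-1) (lapl_wker k z)) (laplZ (- c) (lapl_preg 0 z))).
  have -> : (fun y => wmean k y + (-1 * wker k y + - c * @preg R n 0 (sqn y))) = Z.
    by apply/funext => u; rewrite mulN1r.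
  by move=> /lapl_eq; apply; rewrite IH// /Z /reg0; ring.
have Zcont t : 0 <= t <= s0 -> {for t, continuous (fun t : R => Z (t *: e0))}.
  move=> /andP[t0 ts]; have tr : `|t| < rho by rewrite ger0_norm//; exact: le_lt_trans yr.
  apply: cvgD.
    by apply: cvgM; [exact: cvg_cst|exact: continuous_psi_mean].
  apply: cvgD; first by apply: cvgN; exact: continuous_wker.
  by apply: cvgM; [exact: cvg_cst|exact: continuous_reg0].
have Zs : Z (s0 *: e0) = 0.
  rewrite /s0 -Zrad// /Z /c; have : reg0 y != 0 by rewrite gt_eqF// (lt_le_trans ltr01).
  by move=> ?; field.
have Z0 : Z 0 = - c.
  rewrite /Z wmean0 addrA subrr add0r /reg0 /sqn dot0l preg_at0 eqxx mulr1 //.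
have h1 : Z 0 <= 0.
  apply: (lapl_max_principle s00 Zrad Zcont); last by rewrite Zs.
  by move=> z zs; apply: Zlap; exact: lt_trans yr.
have h2 : - Z 0 <= 0.
  apply: (@lapl_max_principle _ _ (fun x => - Z x) s0 s00); last by rewrite Zs oppr0.
  - by move=> z zs; rewrite Zrad.
  - by move=> t ht; apply: cvgN; exact: Zcont.
  move=> z zs; have zr := lt_trans zs yr.
  have := laplZ (-1) (Zlap z zr); rewrite mulN1r; congr (lapl _ _ _).
  by apply/funext => u; rewrite mulN1r.
have c0 : c = 0 by rewrite Z0 in h1 h2; lra.
move/eqP: c0; rewrite mulf_eq0 invr_eq0 (gt_eqF (lt_le_trans ltr01 r1)) orbF subr_eq0.
by move/eqP.
Qed.

Lemma shell_pot_inside x : nrm x < rho -> mean V U (ker x) = radker 0 rho (nrm x).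
Proof.
move=> xr; have := wmean_eq_wker 0 xr.
by rewrite /wmean /acoef ffactn0 expr0 !mul1r psi_mean0.
Qed.

End ShellPotential.

(** * The potential of a sphere at all points *)

Section ShellApproximation.
Variables (R : realType) (p : nat).
Local Open Scope classical_set_scope.
Local Notation n := (p.*2.+1).
Local Notation radker := (@radker R p).
Implicit Types (rho sig : R) (x y w : 'rV[R]_n).

Lemma exists_shell_potential rho : 0 < rho -> exists Phi : 'rV[R]_n -> R, [/\
  forall d : R, 0 < d -> exists2 mu, sphere_prob rho mu & forall x, `|pot mu x - Phi x| <= d,
  forall w x, Phi (refl w x) = Phi x &
  forall x, nrm x < rho -> Phi x = radker 0 rho (nrm x)].
Proof.
move=> rho0; have [V [hV hC hR]] := exists_near_minimizers p.*2 (ltW rho0).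
have [U [UU Uoo]] := @ultraFilterLemma nat \oo _.
exists (fun x => mean V U (ker x)); split.
- move=> d d0; have := @cvg_harmonic R => /cvgr0Pnorm_le/(_ (d / 2)) [|N _ HN]; first by rewrite divr_gt0.
  exists (V N); first exact: hV.
  move=> x; apply: (le_trans (shell_pot_approx hV hC UU Uoo N x)).
  have := HN N (leqnn N); rewrite /= ger0_norm ?harmonic_ge0// /harmonic /= => h.
  by rewrite -ler_pdivlMl// mulrC.
- by move=> w x; exact: (shell_pot_refl hV hR UU Uoo).
- by move=> x xr; exact: (shell_pot_inside rho0 hV hR UU Uoo).
Qed.

(* The average of exp (- |x - y|) over |y| = rho when |x| = sig. *)
Definition kappa rho sig : R := if sig <= rho then radker 0 rho sig else radker 0 sig rho.

Lemma kappaC rho sig : kappa rho sig = kappa sig rho.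
Proof. by rewrite /kappa; case: ltgtP => // ->. Qed.

Lemma pot_lipschitz rho mu x y : sphere_prob rho mu -> `|pot mu x - pot mu y| <= nrm (x - y).
Proof.
move=> pm; have -> : pot mu x - pot mu y = ev mu (fun z => ker x z - ker y z).
  by rewrite /pot /ev -sumrB; apply: eq_bigr => a _; rewrite mulrBr.
have := @ev_bound R n mu (fun z => ker x z - ker y z) (nrm (x - y)).
rewrite (sphere_prob_tvar pm) mul1r; apply=> a _.
by apply: le_trans (ker_lipschitz _ _ _) _; rewrite edistE.
Qed.

Lemma sphere_prob_ev rho mu (g : 'rV[R]_n -> R) c d : 0 < rho -> sphere_prob rho mu ->
  (forall y, nrm y = rho -> `|g y - c| <= d) -> `|ev mu g - c| <= d.
Proof.
move=> r0 pm hg; have -> : ev mu g - c = ev mu (fun z => g z - c).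
  have -> : c = ev mu (fun=> c) by rewrite ev_cst; have [_ ->] := pm; rewrite mul1r.
  by rewrite /ev -sumrB; apply: eq_bigr => a _; rewrite mulrBr -/(ev _ _) ev_cst; have [_ ->] := pm; rewrite mul1r.
have := @ev_bound R n mu (fun z => g z - c) d.
rewrite (sphere_prob_tvar pm) mul1r; apply=> a am; apply: hg; apply: (nrm_sph r0).
by have [h _] := pm; case: (h a am).
Qed.

(** Inside, this is the expansion. Outside, reciprocity applies: the energy of measures on the
    spheres of radii rho and |x|, computed in the other order, needs only the potential of the
    larger sphere on the smaller one, inside it. On the sphere, potentials are 1-Lipschitz and the
    value is a limit from inside. *)
Lemma shell_approx rho (d : R) : 0 < rho -> 0 < d ->
  exists2 mu : seq (R * 'rV[R]_n), sphere_prob rho mu & forall x, `|pot mu x - kappa rho (nrm x)| <= d.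
Proof.
move=> r0 d0; have [Phi [ha hr hin]] := exists_shell_potential r0.
suff HP x : Phi x = kappa rho (nrm x).
  by have [mu pm hm] := ha d d0; exists mu => // x; rewrite -HP.
have lip y : `|Phi x - Phi y| <= nrm (x - y).
  apply/ler_addgt0Pl => e e0; have e2 : 0 < e / 2 by rewrite divr_gt0.
  have [mu pm hm] := ha _ e2.
  have -> : Phi x - Phi y = (pot mu y - Phi y) - (pot mu x - Phi x) + (pot mu x - pot mu y) by ring.
  apply: le_trans (ler_normD _ _) _; apply: lerD; last exact: pot_lipschitz pm.
  apply: le_trans (ler_normB _ _) _.
  by have := hm x; have := hm y; lra.
have [xr|xr|xr] := ltgtP (nrm x) rho.
- by rewrite hin// /kappa ltW.
- rewrite /kappa leNgt xr /=; set s := nrm x in xr *.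
  have s0 : 0 < s by exact: lt_trans xr.
  have [Psi [ha' hr' hin']] := exists_shell_potential s0.
  apply/eqP; rewrite -subr_eq0 -normr_le0; apply/ler_addgt0Pl => e e0; rewrite addr0.
  have e2 : 0 < e / 2 by rewrite divr_gt0.
  have [mu pm hm] := ha _ e2; have [nu pn hn] := ha' _ e2.
  have h1 : `|ip nu mu - Phi x| <= e / 2.
    apply: (sphere_prob_ev s0 pn) => y ys.
    rewrite -(radial_of_refl (fun w => hr w x) (y := y)) ?ys//; exact: hm.
  have h2 : `|ip mu nu - radker 0 s rho| <= e / 2.
    apply: (sphere_prob_ev r0 pm) => y yr.
    have := hn y; rewrite hin' yr //.
  rewrite ipC in h2.
  have -> : Phi x - radker 0 s rho = (ip nu mu - radker 0 s rho) - (ip nu mu - Phi x) by ring.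
  by apply: le_trans (ler_normB _ _) _; lra.
rewrite xr /kappa lexx; apply/eqP; rewrite -subr_eq0 -normr_le0; apply/ler_addgt0Pl => e e0.
rewrite addr0; have e2 : 0 < e / 2 by rewrite divr_gt0.
have cr : {for rho, continuous (radker 0 rho)}.
  apply: differentiable_continuous; apply/derivable1_diffP.
  by case: (is_derive_radker p 0 rho rho).
have /cvgrPdist_le/(_ _ e2)[z /= z0 hz] := cr.
(* The point (1 - t) x is inside, and t is small enough both for the continuity of [radker] and for
   the Lipschitz bound. *)
pose t := Num.min (1 / 2) (Num.min (z / (2 * rho)) (e / (2 * rho))).
have t0 : 0 < t by rewrite !lt_min !divr_gt0// mulr_gt0.
have t1 : t <= 1 / 2 by rewrite ge_min lexx.
have t2 : t * rho <= z / 2.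
  have : t <= z / (2 * rho) by rewrite !ge_min lexx /= orbT.
  by rewrite ler_pdivlMr ?mulr_gt0// => h; lra.
have t3 : t * rho <= e / 2.
  have : t <= e / (2 * rho) by rewrite !ge_min lexx /= !orbT.
  by rewrite ler_pdivlMr ?mulr_gt0// => h; lra.
have tr : 0 < t * rho by rewrite mulr_gt0.
pose y := (1 - t) *: x.
have ny : nrm y = rho - t * rho by rewrite nrmZ xr ger0_norm; [ring|lra].
have nxy : nrm (x - y) = t * rho.
  have -> : x - y = t *: x by rewrite /y scalerBl scale1r opprB addrCA subrr addr0.
  by rewrite nrmZ xr gtr0_norm.
have h1 := lip y; rewrite nxy (hin y) ny in h1; last by lra.
have h2 : `|radker 0 rho rho - radker 0 rho (rho - t * rho)| <= e / 2.
  by apply: hz; rewrite /= subKr gtr0_norm//; lra.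
have -> : Phi x - radker 0 rho rho = (Phi x - radker 0 rho (rho - t * rho)) -
   (radker 0 rho rho - radker 0 rho (rho - t * rho)) by ring.
by apply: le_trans (ler_normB _ _) _; lra.
Qed.

(** Read off from the approximating probability measures, as the exponential kernel lies between 0
    and 1; the explicit sum does not show it. *)
Lemma kappa_bounds rho sig : 0 < rho -> 0 <= sig -> 0 <= kappa rho sig <= 1.
Proof.
move=> r0 s0.
have [x <-] : exists x : 'rV[R]_n, nrm x = sig.
  by exists (sig *: @e0 R p.*2); rewrite nrm_e0 ger0_norm.
suff : forall e, 0 < e -> - e <= kappa rho (nrm x) <= 1 + e.
  move=> h; apply/andP; split.
    by apply/ler_addgt0Pl => e /h; lra.
  by apply/ler_addgt0Pl => e /h; lra.
move=> e e0; have [mu pm /(_ x)] := shell_approx r0 e0.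
have := @sphere_prob_ev rho mu (ker x) (2^-1) (2^-1) r0 pm.
have h y : nrm y = rho -> `|ker x y - 2^-1| <= 2^-1.
  by have := ker_gt0 x y; have := ker_le1 x y; rewrite ler_norml; lra.
move=> /(_ h); rewrite -/(pot mu x) !ler_norml; lra.
Qed.

Lemma kappa_lipschitz rho s t : 0 < rho -> 0 <= s -> 0 <= t ->
  `|kappa rho s - kappa rho t| <= `|s - t|.
Proof.
move=> r0 s0 t0; apply/ler_addgt0Pl => e ep; have e2 : 0 < e / 2 by rewrite divr_gt0.
have [mu pm hm] := shell_approx r0 e2.
pose x := s *: @e0 R p.*2; pose y := t *: @e0 R p.*2.
have nx : nrm x = s by rewrite nrm_e0 ger0_norm.
have ny : nrm y = t by rewrite nrm_e0 ger0_norm.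
have h1 := hm x; have h2 := hm y; rewrite nx in h1; rewrite ny in h2.
have h3 := pot_lipschitz x y pm.
have nxy : nrm (x - y) = `|s - t| by rewrite -scalerBl nrm_e0.
rewrite nxy in h3.
have -> : kappa rho s - kappa rho t = (pot mu y - kappa rho t) - (pot mu x - kappa rho s) +
   (pot mu x - pot mu y) by ring.
apply: le_trans (ler_normD _ _) _; apply: lerD => //.
by apply: le_trans (ler_normB _ _) _; lra.
Qed.

End ShellApproximation.

(** * Potential of the interior density *)

Section RiemannSums.
Variable R : realType.
Implicit Types (g G H : R -> R) (r s t L : R).

Lemma cell_estimate g G (a b c : R) L : a <= b -> b <= c ->
  (forall x, a <= x <= b -> is_derive x 1 G (g x)) ->
  (forall x, a <= x <= b -> `|g x - g c| <= L) ->
  `|G b - G a - g c * (b - a)| <= L * (b - a).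
Proof.
move=> ab bc hd hL; have [|x xI E] := mvt (f := G) (df := g) (a := a) (b := b).
  by rewrite min_l ?max_r.
rewrite min_l ?max_r// in xI.
have ba : 0 <= b - a by rewrite subr_ge0.
by rewrite E -mulrBl normrM (ger0_norm ba) ler_wpM2r// hL.
Qed.

(** Right endpoint sums for an integrand whose antiderivative changes its formula at s; only the
    Lipschitz bound enters, so s need not be a node. *)
Lemma riemann_sum_two_pieces g G H r s L (Q : nat) : 0 < r -> 0 <= s <= r -> 0 <= L -> (0 < Q)%N ->
  (forall x, 0 <= x <= s -> is_derive x 1 G (g x)) ->
  (forall x, s <= x <= r -> is_derive x 1 H (g x)) ->
  G s = H s -> G 0 = 0 ->
  (forall x y, 0 <= x <= r -> 0 <= y <= r -> `|g x - g y| <= L * `|x - y|) ->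
  `|\sum_(i < Q) g (i.+1%:R * (r / Q%:R)) * (r / Q%:R) - H r| <= L * r ^+ 2 / Q%:R.
Proof.
move=> r0 /andP[s0 sr] L0 Q0 hG hH GH G0 hL.
pose d := r / Q%:R; have Qp : 0 < Q%:R :> R by rewrite ltr0n.
have d0 : 0 < d by rewrite divr_gt0.
pose F x := if x <= s then G x else H x.
have FH x : s <= x -> F x = H x.
  rewrite /F => sx; have [xs|//] := leP x s.
  by have -> : x = s by apply: le_anti; apply/andP.
have FG x : x <= s -> F x = G x by rewrite /F => ->.
have cell a b : 0 <= a -> a <= b -> b <= r -> `|F b - F a - g b * (b - a)| <= L * (b - a) * (b - a).
  move=> a0 ab br.
  have hg x : a <= x <= b -> `|g x - g b| <= L * (b - a).
    move=> /andP[ax xb]; apply: le_trans (hL _ _ _ _) _; [by apply/andP; split; lra|by apply/andP; split; lra|].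
    by rewrite ler_wpM2l// ler0_norm; lra.
  have [bs|sb] := leP b s.
    rewrite !FG//; last exact: le_trans bs.
    apply: cell_estimate => // x /andP[ax xb]; apply: hG; apply/andP; split; lra.
  have [sa|as_] := leP s a.
    rewrite !FH//; last exact: ltW.
    apply: cell_estimate => // x /andP[ax xb]; apply: hH; apply/andP; split; lra.
  rewrite (FH b (ltW sb)) (FG a (ltW as_)).
  (* The cell containing s is split there, both halves being compared with the value at the right
     end b. *)
  have -> : H b - G a - g b * (b - a) = (H b - H s - g b * (b - s)) + (G s - G a - g b * (s - a)).
    by rewrite GH; ring.
  apply: le_trans (ler_normD _ _) _.
  have -> : L * (b - a) * (b - a) = L * (b - a) * (b - s) + L * (b - a) * (s - a) by ring.
  apply: lerD.
    apply: (cell_estimate (ltW sb) (lexx b)) => x /andP[ax xb].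
      by apply: hH; apply/andP; split; lra.
    by apply: hg; apply/andP; split; lra.
  apply: (cell_estimate (ltW as_) (ltW sb)) => x /andP[ax xb].
    by apply: hG; apply/andP; split; lra.
  by apply: hg; apply/andP; split; lra.
have rE : r = Q%:R * d by rewrite /d mulrC divfK// gt_eqF.
have tel : \sum_(i < Q) (F (i.+1%:R * d) - F (i%:R * d)) = H r.
  rewrite -(big_mkord xpredT (fun i => F (i.+1%:R * d) - F (i%:R * d))).
  by rewrite (telescope_sumr (fun i => F (i%:R * d)))// -rE mul0r FH// FG// G0 subr0.
rewrite -[H r]tel -sumrB; apply: le_trans (ler_norm_sum _ _ _) _.
have -> : L * r ^+ 2 / Q%:R = \sum_(i < Q) L * d * d.
  by rewrite sumr_const card_ord -mulr_natl {1}rE; field; rewrite gt_eqF.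
apply: ler_sum => i _; rewrite distrC.
have E : i.+1%:R * d - i%:R * d = d by rewrite -mulrBl -natr1 addrAC subrr add0r mul1r.
have := cell (i%:R * d) (i.+1%:R * d); rewrite E; apply.
- by rewrite mulr_ge0// ltW.
- by rewrite ler_wpM2r ?(ltW d0)// ler_nat.
- by rewrite [leRHS]rE ler_wpM2r ?(ltW d0)// ler_nat.
Qed.

Lemma exprn_lipschitz (m : nat) r : 0 <= r -> exists2 L, 0 <= L &
  forall x y, 0 <= x <= r -> 0 <= y <= r -> `|x ^+ m - y ^+ m| <= L * `|x - y|.
Proof.
move=> r0; case: m => [|m].
  by exists 0 => // x y _ _; rewrite !expr0 subrr normr0 mul0r.
exists (m.+1%:R * r ^+ m) => [|x y hx hy]; first by rewrite mulr_ge0// exprn_ge0.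
apply: (@derive_bound_lipschitz R (fun x : R => x ^+ m.+1) (fun x => m.+1%:R * x ^+ m) 0 r) => // t.
  by move=> _; exact: is_derive_exprn.
move=> /andP[t0 tr]; rewrite ger0_norm ?mulr_ge0 ?exprn_ge0// ler_wpM2l//.
by rewrite lerXn2r ?nnegrE.
Qed.

End RiemannSums.

Section InteriorPotential.
Variables (R : realType) (p : nat).
Implicit Types (rho sig r : R).
Local Notation n := (p.*2.+1).
Local Notation radker := (@radker R p).
Local Notation dradker := (@dradker R p).
Local Notation dradker' := (@dradker' R p).
Local Notation kappa := (@kappa R p).

Lemma radker_top rho sig : radker p.+1 rho sig = 0.
Proof. by rewrite /radker big1// => k _; rewrite acoef_eq0 ?mul0r// ltn_addl. Qed.

(** This inverts the Laplacian: it sends [radker i] to radker i + radker i.+1, and [radker p.+1] is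
    0, so the alternating sum of all [radker i] has Laplacian [radker 0]. *)
Lemma alternating_telescope (N : nat) (u : nat -> R) :
  \sum_(i < N) (-1) ^+ i * (u i + u i.+1) = u 0%N - (-1) ^+ N * u N.
Proof.
elim: N => [|N IH]; first by rewrite big_ord0 mul1r subrr.
by rewrite big_ord_recr /= IH exprS; ring.
Qed.

(* Antiderivatives in rho of rho^(2p) * kappa rho sig for rho <= sig and for
   sig <= rho, with constants such that prim_in vanishes at rho = 0 and the two
   agree at rho = sig. *)
Definition prim_in sig rho : R := \sum_(i < p.+1) (-1) ^+ i * (rho ^+ p.*2 * dradker i sig rho).
Definition prim_out sig rho : R :=
  (p.*2)`!%:R + \sum_(i < p.+1) (-1) ^+ i * (rho ^+ p.*2 * dradker' i rho sig).

Lemma is_derive_prim_in sig rho :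
  is_derive rho 1 (prim_in sig) (rho ^+ p.*2 * radker 0 sig rho).
Proof.
have -> : rho ^+ p.*2 * radker 0 sig rho =
  \sum_(i < p.+1) (-1) ^+ i * (rho ^+ p.*2 * (radker i sig rho + radker i.+1 sig rho)).
  under eq_bigr do rewrite mulrCA.
  rewrite -mulr_sumr (alternating_telescope p.+1 (fun i => radker i sig rho)).
  by rewrite radker_top mulr0 subr0.
apply: is_derive_sum_seq => i _; apply: is_deriveMl; exact: radker_laplacian.
Qed.

Lemma is_derive_prim_out sig rho : 0 < rho ->
  is_derive rho 1 (prim_out sig) (rho ^+ p.*2 * radker 0 rho sig).
Proof.
move=> r0; have -> : rho ^+ p.*2 * radker 0 rho sig =
  0 + \sum_(i < p.+1) (-1) ^+ i * (rho ^+ p.*2 * (radker i rho sig + radker i.+1 rho sig)).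
  under eq_bigr do rewrite mulrCA.
  rewrite add0r -mulr_sumr (alternating_telescope p.+1 (fun i => radker i rho sig)).
  by rewrite radker_top mulr0 subr0.
apply: is_deriveD; apply: is_derive_sum_seq => i _; apply: is_deriveMl; exact: radker_laplacian'.
Qed.

(** The two sums differ by the alternating sum of the jumps [wronsk], hence the constant (2 p)! in
    [prim_out]. Divided by (2 p)!, it is the 1 in the potential of the interior density. *)
Lemma prim_match sig : 0 < sig -> prim_in sig sig = prim_out sig sig.
Proof.
move=> s0; apply/eqP; rewrite /prim_out -subr_eq -sumrB.
rewrite -(wronsk_alternating_sum p s0); apply/eqP; apply: eq_bigr => i _.
by rewrite /wronsk; ring.
Qed.

Lemma prim_in0 sig : prim_in sig 0 = 0.
Proof. by rewrite /prim_in big1// => i _; rewrite /dradker mulr0 !mul0r !mulr0. Qed.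

(** [kappa] is bounded by 1 and 1-Lipschitz, so the rate does not depend on sig. *)
Lemma interior_riemann r : 0 < r -> exists2 C, 0 <= C & forall (Q : nat) sig, (0 < Q)%N ->
  0 < sig <= r ->
  `|\sum_(i < Q) ((i.+1%:R * (r / Q%:R)) ^+ p.*2 * (r / Q%:R)) * kappa (i.+1%:R * (r / Q%:R)) sig -
    prim_out sig r| <= C / Q%:R.
Proof.
move=> r0; have [L L0 hL] := exprn_lipschitz p.*2 (ltW r0).
exists ((L + r ^+ p.*2) * r ^+ 2) => [|Q sig Q0 /andP[s0 sr]].
  by rewrite mulr_ge0 ?sqr_ge0// addr_ge0// exprn_ge0// ltW.
pose g x := x ^+ p.*2 * kappa x sig.
have -> : \sum_(i < Q) ((i.+1%:R * (r / Q%:R)) ^+ p.*2 * (r / Q%:R)) * kappa (i.+1%:R * (r / Q%:R)) sig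
  = \sum_(i < Q) g (i.+1%:R * (r / Q%:R)) * (r / Q%:R).
  by apply: eq_bigr => i _; rewrite /g mulrAC.
apply: (@riemann_sum_two_pieces R g (prim_in sig) (prim_out sig) r sig) => //.
- by rewrite (ltW s0).
- by rewrite addr_ge0// exprn_ge0// ltW.
- move=> x /andP[x0 xs]; have := is_derive_prim_in sig x; congr is_derive; congr (_ * _).
  by rewrite kappaC /kappa xs.
- move=> x /andP[sx xr]; have := is_derive_prim_out sig (lt_le_trans s0 sx); congr is_derive.
  by rewrite /g /kappa sx.
- exact: prim_match.
- exact: prim_in0.
move=> x y /andP[x0 xr] /andP[y0 yr].
have -> : g x - g y = (x ^+ p.*2 - y ^+ p.*2) * kappa x sig + y ^+ p.*2 * (kappa x sig - kappa y sig).
  by rewrite /g; ring.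
apply: le_trans (ler_normD _ _) _; rewrite !normrM mulrDl; apply: lerD.
  rewrite -[leRHS]mulr1; apply: ler_pM => //; first by apply: hL; apply/andP.
  have /andP[k0 k1] := @kappa_bounds R p sig x s0 x0.
  by rewrite kappaC ger0_norm.
apply: ler_pM => //.
  by rewrite ger0_norm ?exprn_ge0// lerXn2r ?nnegrE// ltW.
by rewrite (kappaC p x) (kappaC p y); exact: kappa_lipschitz.
Qed.

Lemma mass_riemann r : 0 < r -> exists2 C, 0 <= C & forall (Q : nat), (0 < Q)%N ->
  `|\sum_(i < Q) ((i.+1%:R * (r / Q%:R)) ^+ p.*2 * (r / Q%:R)) - r ^+ n / n%:R| <= C / Q%:R.
Proof.
move=> r0; have [L L0 hL] := exprn_lipschitz p.*2 (ltW r0).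
exists (L * r ^+ 2) => [|Q Q0]; first by rewrite mulr_ge0 ?sqr_ge0.
have hd (x : R) : is_derive x 1 (fun x : R => x ^+ n / n%:R) (x ^+ p.*2).
  have := is_deriveMl (n%:R^-1 : R) (is_derive_exprn p.*2 x).
  have -> : (fun t : R => n%:R^-1 * t ^+ n) = fun t => t ^+ n / n%:R by apply/funext => t; rewrite mulrC.
  by rewrite mulrA mulVf ?pnatr_eq0// mul1r.
apply: (@riemann_sum_two_pieces R (fun x => x ^+ p.*2) (fun x => x ^+ n / n%:R) (fun x => x ^+ n / n%:R) r r) => //.
- by rewrite lexx ltW.
- by rewrite expr0n mul0r.
Qed.

End InteriorPotential.

(** * The boundary layer *)

Section Determinants.
Variable R : realType.
Local Open Scope classical_set_scope.

Lemma cvg_prod_ord (T : Type) (F : set_system T) {FF : Filter F} (N : nat)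
    (u : T -> 'I_N -> R) (l : 'I_N -> R) :
  (forall i, u k i @[k --> F] --> l i) ->
  \prod_(i < N) u k i @[k --> F] --> \prod_(i < N) l i.
Proof.
elim: N u l => [|N IH] u l cu.
  under eq_fun do rewrite big_ord0; rewrite big_ord0; exact: cvg_cst.
under eq_fun do rewrite big_ord_recl; rewrite big_ord_recl.
by apply: cvgM => //; apply: IH.
Qed.

Lemma cvg_det (T : Type) (F : set_system T) {FF : Filter F} (N : nat) (M : T -> 'M[R]_N) (L : 'M[R]_N) :
  (forall i j, M k i j @[k --> F] --> L i j) -> \det (M k) @[k --> F] --> \det L.
Proof.
move=> cM; apply: cvg_sum_seq => s; apply: cvgM; first exact: cvg_cst.
by apply: cvg_prod_ord => i.
Qed.

Lemma cvg_adj (T : Type) (F : set_system T) {FF : Filter F} (N : nat) (M : T -> 'M[R]_N) (L : 'M[R]_N) :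
  (forall i j, M k i j @[k --> F] --> L i j) ->
  forall i j, (\adj (M k)) i j @[k --> F] --> (\adj L) i j.
Proof.
move=> cM i j; rewrite mxE; under eq_fun do rewrite mxE.
apply: cvgM; first exact: cvg_cst.
by apply: cvg_det => a b; rewrite !mxE; under eq_fun do rewrite !mxE; exact: cM.
Qed.

Lemma det_scale_rows_cols (N : nat) (a b : 'I_N -> R) (M : 'M[R]_N) :
  \det (\matrix_(i, j) (a i * M i j * b j)) = (\prod_i a i) * \det M * (\prod_j b j).
Proof.
have -> : \matrix_(i, j) (a i * M i j * b j) =
    diag_mx (\row_i a i) *m M *m diag_mx (\row_j b j).
  by apply/matrixP => i j; rewrite mul_diag_mx mul_mx_diag !mxE.
rewrite !det_mulmx !det_diag; congr (_ * _ * _); apply: eq_bigr => i _; by rewrite mxE.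
Qed.

Lemma det_upper (N : nat) (M : 'M[R]_N) :
  (forall i j : 'I_N, (j < i)%N -> M i j = 0) -> \det M = \prod_i M i i.
Proof.
move=> h; rewrite -det_tr det_trig; first by apply: eq_bigr => i _; rewrite mxE.
by apply/is_trig_mxP => i j ij; rewrite mxE h.
Qed.

End Determinants.

(** * The linear system of the boundary distribution *)

Section BoundarySystem.
Variables (R : realType) (p : nat) (r : R).
Local Open Scope classical_set_scope.
Hypothesis r0 : 0 < r.
Local Notation n := (p.*2.+1).
Local Notation acoef := (@acoef R p).
Local Notation preg := (@preg R n).

Definition tau k : R := r ^+ n * \sum_(i < p.+1) (-1) ^+ i * (acoef (k + i) * psi (k + i).+1 r).

Lemma prim_outE sig : prim_out p sig r = (p.*2)`!%:R - \sum_(k < p.+1) tau k * preg k (sig ^+ 2).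
Proof.
rewrite /prim_out; congr (_ + _); rewrite -sumrN.
transitivity (\sum_(i < p.+1) \sum_(k < p.+1)
  - (r ^+ n * ((-1) ^+ i * (acoef (k + i) * psi (k + i).+1 r)) * preg k (sig ^+ 2))).
  apply: eq_bigr => i _; rewrite /dradker' mulrN mulrA mulrN; rewrite !mulr_sumr -sumrN.
  by apply: eq_bigr => k _; rewrite (exprS _ p.*2); ring.
rewrite exchange_big /=; apply: eq_bigr => k _.
by rewrite sumrN /tau mulr_sumr mulr_suml.
Qed.

Lemma acoef_neq0 k : (k <= p)%N -> acoef k != 0.
Proof.
move=> kp; rewrite /acoef mulf_neq0 ?expf_neq0 ?oppr_eq0// pnatr_eq0 -lt0n ffact_gt0.
by [].
Qed.

Lemma tau_succ k : tau k + tau k.+1 = r ^+ n * (acoef k * psi k.+1 r).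
Proof.
rewrite /tau -mulrDr -big_split /=; congr (_ * _).
pose f i := acoef (k + i) * psi (k + i).+1 r.
rewrite (eq_bigr (fun i : 'I_p.+1 => (-1) ^+ i * (f i + f i.+1))) => [|i _]; last first.
  by rewrite -mulrDr /f !addnS !addSn.
rewrite alternating_telescope /f addn0 (@acoef_eq0 R p (k + p.+1)) ?ltn_addl//.
by rewrite mul0r mulr0 subr0.
Qed.

(** A radial distribution whose integral of [psi k] is I_k has, inside its spheres, the potential
    with coefficients acoef k * I_k. Dividing by [acoef] therefore gives the integrals required, up
    to the factor (2 p)!. *)
Definition target k : R := tau k / acoef k.

Lemma target_rec k : (k <= p)%N ->
  target k - 2 * (p%:R - k%:R) * target k.+1 = r ^+ n * psi k.+1 r.
Proof.
move=> kp; have a0 := acoef_neq0 kp.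
have : tau k = acoef k * target k by rewrite /target mulrC divfK.
have : tau k.+1 = acoef k.+1 * target k.+1.
  (* For k = p, [target p.+1] is a quotient by 0, but [tau p.+1] and [acoef p.+1] both vanish. *)
  move: kp; rewrite leq_eqVlt => /orP[/eqP kp|kp]; last by rewrite /target mulrC divfK// acoef_neq0.
  rewrite kp [acoef p.+1]acoef_eq0// mul0r /tau big1 ?mulr0// => i _.
  by rewrite acoef_eq0 ?mul0r ?mulr0// ltn_addr.
move=> E1 E2; have := tau_succ k; rewrite E1 E2 acoefS => E.
by apply: (mulfI a0); rewrite [RHS]mulrCA -E; ring.
Qed.

(* Backward differences in |x|^2, so that the limit matrix is Hankel up to scaling columns. *)
Definition bmat (e : R) : 'M[R]_p.+1 :=
  \matrix_(j, m) (bdiff e m (@fpsi R j) (r ^+ 2) / e ^+ m).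
Definition bmat0 : 'M[R]_p.+1 := \matrix_(j, m) ((- 2^-1) ^+ m * psi (j + m) r).
(** Adjugate over determinant: defined for every matrix, and continuous wherever the determinant is
    nonzero. *)
Definition bvec (M : 'M[R]_p.+1) : 'cV[R]_p.+1 :=
  (\det M)^-1 *: (\adj M *m \col_j (target j / (p.*2)`!%:R)).

Lemma bvec_solves (M : 'M[R]_p.+1) : \det M != 0 ->
  M *m bvec M = \col_j (target j / (p.*2)`!%:R).
Proof.
move=> d0; rewrite /bvec -scalemxAr mulmxA mul_mx_adj mul_scalar_mx scalerA mulVf//.
by rewrite scale1r.
Qed.

Lemma det_bmat0 : \det bmat0 = (\prod_(m < p.+1) (- 2^-1) ^+ m) * \det (\matrix_(i < p.+1, j < p.+1) psi (i + j) r).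
Proof.
have := det_scale_rows_cols (fun=> 1) (fun m : 'I_p.+1 => (- 2^-1) ^+ m) (\matrix_(i < p.+1, j < p.+1) psi (i + j) r).
rewrite big1_eq mul1r mulrC => <-; congr (\det _).
by apply/matrixP => i j; rewrite !mxE mul1r mulrC.
Qed.

Lemma det_bmat0_neq0 : \det bmat0 != 0.
Proof.
rewrite det_bmat0 mulf_neq0 ?hankel_psi_det_neq0//.
by apply/prodf_neq0 => i _; rewrite expf_neq0// oppr_eq0 invr_eq0.
Qed.

Lemma cvg_bmat (e : nat -> R) : (forall k, 0 < e k) -> e k @[k --> \oo] --> 0 ->
  forall i j, bmat (e k) i j @[k --> \oo] --> bmat0 i j.
Proof.
by move=> e0 ec i j; rewrite mxE; under eq_fun do rewrite mxE; exact: cvg_bdiff_psi.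
Qed.

Lemma cvg_bvec (e : nat -> R) : (forall k, 0 < e k) -> e k @[k --> \oo] --> 0 ->
  forall i, bvec (bmat (e k)) i 0 @[k --> \oo] --> bvec bmat0 i 0.
Proof.
move=> e0 ec i; have cb := cvg_bmat e0 ec.
rewrite /bvec !mxE; under eq_fun do rewrite !mxE.
apply: cvgM; first by apply: cvgV; [exact: det_bmat0_neq0|exact: cvg_det].
by apply: cvg_sum_seq => j; apply: cvgM; [exact: cvg_adj|exact: cvg_cst].
Qed.

(* Cramer's rule: the first column of bmat0 replaced by the right-hand side plus
   a multiple of that column. *)
Definition repl_mat : 'M[R]_p.+1 :=
  \matrix_(j, m) (if m == ord0 then (r ^+ n * psi j r + n%:R * target j) / n`!%:R else bmat0 j m).

(** The left side is the limiting mass: r^n / n! from the interior and the coefficient of order 0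
    from the boundary, since higher differences have mass 0. By linearity in the first column one
    determinant accounts for both. *)
Lemma bvec0_repl : r ^+ n / n`!%:R + bvec bmat0 ord0 0 = \det repl_mat / \det bmat0.
Proof.
have d0 := det_bmat0_neq0.
have -> : bvec bmat0 ord0 0 = (\sum_j cofactor bmat0 j ord0 * (target j / (p.*2)`!%:R)) / \det bmat0.
  by rewrite /bvec !mxE mulrC; congr (_ / _); apply: eq_bigr => j _; rewrite !mxE.
have -> : r ^+ n / n`!%:R = (r ^+ n / n`!%:R * \det bmat0) / \det bmat0 by rewrite mulfK.
rewrite -mulrDl; congr (_ / _).
rewrite (expand_det_col _ ord0) (expand_det_col repl_mat ord0) mulr_sumr -big_split.
apply: eq_bigr => j _ /=.
have -> : cofactor repl_mat j ord0 = cofactor bmat0 j ord0.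
  congr (_ * \det _); apply/matrixP => a b; rewrite !mxE.
  by rewrite eq_sym (negPf (neq_lift _ _)).
rewrite !mxE /= expr0 mul1r addn0 factS natrM.
have f0 : (p.*2)`!%:R != 0 :> R by rewrite pnatr_eq0 -lt0n fact_gt0.
have n0 : n%:R != 0 :> R by rewrite pnatr_eq0.
move: f0 n0; set F : R := (p.*2)`!%:R; set N : R := n%:R => f0 n0.
clearbody F N; by field; do ?(apply/andP; split).
Qed.

(* Unitriangular row operations, after which repl_mat is a Hankel matrix times
   upper triangular column operations. *)
Definition row_ops : 'M[R]_p.+1 := \matrix_(i, j)
  ((i == j)%:R - (if j == i.+1 :> nat then 2 * (p%:R - i%:R) else 0)).
Definition col_ops : 'M[R]_p.+1 := \matrix_(k, m)
  (if m == ord0 then (if k == ord0 then r ^+ n.+2 / n`!%:R else 0)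
   else (- 2^-1) ^+ m * ((if k == m then r ^+ 2 else 0) -
     (if k.+1 == m :> nat then (2 * m + 2 * p + 1)%:R else 0))).

Lemma row_opsE (M : 'M[R]_p.+1) (f : nat -> 'I_p.+1 -> R) :
  (forall i m, M i m = f i m) ->
  forall i m, (row_ops *m M) i m = f i m - 2 * (p%:R - i%:R) * f i.+1 m.
Proof.
move=> hM i m; rewrite mxE.
under eq_bigr do rewrite mxE hM mulrBl.
rewrite sumrB (bigD1 i)//= eqxx mul1r big1 ?addr0; last first.
  by move=> j ji; rewrite eq_sym (negPf ji) mul0r.
congr (_ - _); have [ip|pi] := ltnP i p.
  have ip' : (i.+1 < p.+1)%N by [].
  rewrite (bigD1 (Ordinal ip'))//= eqxx big1 ?addr0// => j ji.
  by case: eqP => [E|]; [move: ji; rewrite -val_eqE /= E eqxx|rewrite mul0r].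
have -> : i = p :> nat by apply/eqP; rewrite eqn_leq pi -ltnS ltn_ord.
rewrite subrr mulr0 mul0r big1// => j _; case: ifP => _; rewrite ?mul0r//.
Qed.

(** By [psi_rec] the entry psi (i + m) is r^2 psi (i + m + 2) - (2 (i + m) + 1) psi (i + m + 1).
    Subtracting 2 (p - i) times the next row makes the last coefficient 2 m + 2 p + 1, independent
    of i. In the first column [target_rec] reduces everything to r^(n+2) psi (i + 2). *)
Lemma row_col_ops :
  row_ops *m repl_mat = (\matrix_(i < p.+1, j < p.+1) psi (i + j + 2) r) *m col_ops.
Proof.
have rn0 := lt0r_neq0 r0.
apply/matrixP => i m.
rewrite (@row_opsE _ (fun j m => if m == ord0 then (r ^+ n * psi j r + n%:R * target j) / n`!%:R
    else (- 2^-1) ^+ m * psi (j + m) r)); last by move=> a b; rewrite !mxE; case: ifP => // _; rewrite mxE.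
have ip : (i <= p)%N by rewrite -ltnS ltn_ord.
rewrite mxE; case: (eqVneq m ord0) => [->|m0].
  rewrite (bigD1 ord0)//= !mxE /= big1 ?addr0; last first.
    by move=> k k0; rewrite !mxE /= (negPf k0) mulr0.
  have T := target_rec ip; have S := psi_rec i rn0.
  rewrite addn0 addn2.
  have -> : psi i r = r ^+ 2 * psi i.+2 r - (2 * i + 1)%:R * psi i.+1 r by rewrite S addrK.
  have -> : target i = r ^+ n * psi i.+1 r + 2 * (p%:R - i%:R) * target i.+1 by rewrite -T subrK.
  by rewrite (exprS r n.+1) (exprS r n) (odd_dimE R p) natrD natrM; ring.
have m1 : (0 < m)%N by rewrite lt0n.
have m1p : (m.-1 < p.+1)%N by apply: leq_ltn_trans (ltn_ord m); exact: leq_pred.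
rewrite (bigD1 m)//= (bigD1 (Ordinal m1p)) /=; last first.
  by rewrite -val_eqE /= -(prednK m1) /= ltn_eqF.
rewrite !mxE /= (negPf m0) !eqxx.
rewrite big1 ?addr0; last first.
  move=> k /andP[km km1]; rewrite !mxE (negPf m0) (negPf km).
  case: eqP => [E|_]; last by rewrite subrr mulr0 mulr0.
  by move: km1; rewrite -val_eqE /= -E eqxx.
have -> : (m.+1 == m :> nat) = false by rewrite gtn_eqF.
have -> : (Ordinal m1p == m) = false by rewrite -val_eqE /= ltn_eqF// ltn_predL.
rewrite (prednK m1) eqxx.
have -> : (i + m.-1 + 2 = (i + m).+1)%N by rewrite -{2}(prednK m1); lia.
have -> : (i + m + 2 = (i + m).+2)%N by lia.
rewrite addSn.
have -> : psi (i + m) r = r ^+ 2 * psi (i + m).+2 r - (2 * (i + m) + 1)%:R * psi (i + m).+1 r.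
  by rewrite psi_rec// addrK.
by rewrite !(natrD, natrM); ring.
Qed.

Lemma det_row_ops : \det row_ops = 1.
Proof.
rewrite det_upper => [|i j ji].
  by rewrite big1// => i _; rewrite mxE eqxx ltn_eqF// subr0.
have e1 : (i == j) = false by rewrite -val_eqE gtn_eqF.
have e2 : (j == i.+1 :> nat) = false by rewrite ltn_eqF// ltnS ltnW.
by rewrite mxE e1 e2 subr0.
Qed.

Lemma det_col_ops : \det col_ops = r ^+ n.+2 / n`!%:R * \prod_(m < p) ((- 2^-1) ^+ m.+1 * r ^+ 2).
Proof.
rewrite det_upper => [|i j ji].
  rewrite big_ord_recl !mxE /=; congr (_ * _); apply: eq_bigr => m _.
  by rewrite mxE /= eqxx gtn_eqF// subr0.
rewrite mxE; case: eqVneq => [j0|j0].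
  by case: eqVneq => // i0; move: ji; rewrite i0 j0 ltnn.
have -> : (i == j) = false by rewrite -val_eqE gtn_eqF.
have -> : (i.+1 == j :> nat) = false by rewrite gtn_eqF// ltnS ltnW.
by rewrite subrr mulr0.
Qed.

(** Passing from [psi] to [chiR] scales rows and columns by the same factors in both determinants,
    except for r^(4p+4) from the shift by 2. Against the r^(4p+3) in [det_col_ops] this leaves 1/r;
    the powers of - 1/2 cancel. *)
Lemma bvec0_magnitude : r ^+ n / n`!%:R + bvec bmat0 ord0 0 =
  \det (\matrix_(i < p.+1, j < p.+1) chiR (i + j + 2) r) /
     (n`!%:R * r * \det (\matrix_(i < p.+1, j < p.+1) chiR (i + j) r)).
Proof.
have rn0 := lt0r_neq0 r0.
set H := \matrix_(i < p.+1, j < p.+1) psi (i + j) r.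
set E := \matrix_(i < p.+1, j < p.+1) psi (i + j + 2) r.
have H0 : \det H != 0 by exact: hankel_psi_det_neq0.
have D : \det repl_mat = \det E * \det col_ops.
  by have := congr1 determinant row_col_ops; rewrite !det_mulmx det_row_ops mul1r.
pose P1 : R := \prod_(i < p.+1) r ^+ (2 * i).
have P10 : P1 != 0 by apply/prodf_neq0 => i _; rewrite expf_neq0.
pose P2 : R := \prod_(i < p.+1) (r ^+ (2 * i) * expR r).
have P20 : P2 != 0 by apply/prodf_neq0 => i _; rewrite mulf_neq0 ?expf_neq0// gt_eqF// expR_gt0.
have C0 : \det (\matrix_(i < p.+1, j < p.+1) chiR (i + j) r) = P1 * \det H * P2.
  rewrite -det_scale_rows_cols; congr (\det _); apply/matrixP => i j; rewrite !mxE.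
  by rewrite chiR_psi// mulnDr exprD; ring.
have C2 : \det (\matrix_(i < p.+1, j < p.+1) chiR (i + j + 2) r) = P1 * \det E * P2 * r ^+ (4 * p.+1).
  have -> : P1 * \det E * P2 * r ^+ (4 * p.+1) =
     P1 * \det E * \prod_(i < p.+1) (r ^+ (2 * i) * expR r * r ^+ 4).
    by rewrite big_split /= prodr_const card_ord -exprM mulrA.
  rewrite -det_scale_rows_cols; congr (\det _); apply/matrixP => i j; rewrite !mxE.
  rewrite chiR_psi//; have -> : (2 * (i + j + 2) = 2 * i + (2 * j + 4))%N by lia.
  by rewrite !exprD; ring.
rewrite bvec0_repl D C0 C2 det_bmat0 -/H det_col_ops big_ord_recl expr0 mul1r big_split /= prodr_const card_ord.
pose S : R := \prod_(i < p) (- 2^-1) ^+ i.+1.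
have S0 : S != 0 by apply/prodf_neq0 => i _; rewrite expf_neq0// oppr_eq0 invr_eq0.
have -> : \prod_(i < p) (- 2^-1) ^+ (lift ord0 i) = S by [].
rewrite -/S -exprM.
have f0 : n`!%:R != 0 :> R by rewrite pnatr_eq0 -lt0n fact_gt0.
have -> : (4 * p.+1 = 1 + (n.+2 + 2 * p))%N by lia.
rewrite !exprD expr1; move: f0 H0 P10 P20 S0.
clear C0 C2 D; clearbody P1 P2 S.
move: (n`!%:R : R) (\det H) (\det E) (r ^+ n.+2) (r ^+ (2 * p)) => F dH dE X Y *.
by field; do ?(apply/andP; split).
Qed.

End BoundarySystem.

(** * Realizing the boundary distribution by spheres *)

Section RadialMeasures.
Variables (R : realType) (p : nat) (r : R).
Local Open Scope classical_set_scope.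
Hypothesis r0 : 0 < r.
Local Notation n := (p.*2.+1).
Local Notation acoef := (@acoef R p).
Local Notation preg := (@preg R n).
Local Notation kappa := (@kappa R p).
Local Notation radker := (@radker R p).
Implicit Types (L : seq (R * R)) (e sig rho : R).

(* A pair (c, rho) stands for c times the uniform probability on |y| = rho. *)
Definition radev L (f : R -> R) : R := \sum_(a <- L) a.1 * f a.2.
Definition rmass L : R := \sum_(a <- L) a.1.
Definition rtv L : R := \sum_(a <- L) `|a.1|.

Lemma rtv_ge0 L : 0 <= rtv L. Proof. by rewrite /rtv sumr_ge0. Qed.

Lemma radev_cat L M f : radev (L ++ M) f = radev L f + radev M f.
Proof. exact: big_cat. Qed.

Lemma radev_dist L f g d : (forall a, a \in L -> `|f a.2 - g a.2| <= d) ->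
  `|radev L f - radev L g| <= rtv L * d.
Proof.
move=> h; rewrite /radev -sumrB; apply: le_trans (ler_norm_sum _ _ _) _.
rewrite mulr_suml big_seq [leRHS]big_seq; apply: ler_sum => a aL.
by rewrite -mulrBr normrM ler_wpM2l// h.
Qed.

(** The combination with coefficients b m / e^m of the m-th backward differences in |y|^2 at r^2,
    listed sphere by sphere. Backward steps keep all radii at most r. *)
Definition blist e (b : nat -> R) : seq (R * R) :=
  [seq (b m / e ^+ m * c.1, Num.sqrt (r ^+ 2 - c.2%:R * e)) | m <- iota 0 p.+1, c : R * nat <- dcoef R m].

Lemma radev_blist e b f : radev (blist e b) f =
  \sum_(m < p.+1) b m / e ^+ m * bdiff e m (fun t => f (Num.sqrt t)) (r ^+ 2).
Proof.
rewrite /radev /blist big_allpairs_dep -[iota 0 p.+1]/(index_iota 0 p.+1) big_mkord.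
apply: eq_bigr => m _; rewrite /bdiff mulr_sumr; apply: eq_bigr => c _ /=.
by rewrite mulrA.
Qed.

Lemma rmass_blist e b : rmass (blist e b) = b 0%N.
Proof.
have -> : rmass (blist e b) = radev (blist e b) (fun=> 1).
  by apply: eq_bigr => a _; rewrite mulr1.
rewrite radev_blist big_ord_recl big1 => [|m _].
  by rewrite bdiff0 expr0 divr1 mulr1 addr0.
have d0 k t : bdiff e k.+1 (fun=> 1) t = 0.
  elim: k t => [|k IH] t; first by rewrite bdiffS !bdiff0 subrr.
  by rewrite bdiffS !IH subrr.
by rewrite d0 mulr0.
Qed.

Lemma dcoef_tv m : \sum_(c <- dcoef R m) `|c.1| = 2 ^+ m.
Proof.
elim: m => [|m IH]; first by rewrite /= big_seq1 normr1.
rewrite /= big_cat /= big_map; under [X in _ + X]eq_bigr do rewrite normrN.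
by rewrite IH exprS; ring.
Qed.

Lemma rtv_blist e b : 0 < e <= 1 ->
  rtv (blist e b) <= 2 ^+ p * (\sum_(m < p.+1) `|b m|) / e ^+ p.
Proof.
move=> /andP[e0 e1].
rewrite /rtv /blist big_allpairs_dep -[iota 0 p.+1]/(index_iota 0 p.+1) big_mkord.
rewrite mulr_sumr mulr_suml; apply: ler_sum => m _ /=.
under eq_bigr do rewrite normrM.
rewrite -mulr_sumr dcoef_tv normrM normfV (ger0_norm (exprn_ge0 _ (ltW e0))).
have mp : (m <= p)%N by rewrite -ltnS ltn_ord.
rewrite mulrAC [2 ^+ p * _]mulrC; apply: ler_pM.
- by rewrite mulr_ge0// exprn_ge0.
- by rewrite invr_ge0 exprn_ge0// ltW.
- by rewrite ler_wpM2l// ler_eXn2l// ltr1n.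
- by rewrite lef_pV2 ?posrE ?exprn_gt0// ler_wiXn2l// ltW.
Qed.

Lemma blist_radius e b a : 0 < e -> p%:R * e <= r ^+ 2 / 2 -> a \in blist e b ->
  [/\ r / 2 <= a.2, a.2 <= r & r - a.2 <= p%:R * e / r].
Proof.
move=> e0 pe /allpairsPdep[m [c [mp cm ->]]] /=.
have cp : (c.2 <= p)%N.
  by apply: leq_trans (dcoef_le cm) _; move: mp; rewrite mem_iota /= add0n ltnS.
have c1 : c.2%:R * e <= p%:R * e by rewrite ler_wpM2r ?(ltW e0)// ler_nat.
have c0 : 0 <= c.2%:R * e by rewrite mulr_ge0// ltW.
set s := Num.sqrt _.
have s2 : s ^+ 2 = r ^+ 2 - c.2%:R * e.
  by rewrite sqr_sqrtr// subr_ge0; have := sqr_ge0 r; lra.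
have s0 : 0 <= s by exact: sqrtr_ge0.
have r2 : 0 < r / 2 by rewrite divr_gt0.
have h1 : r / 2 <= s.
  rewrite -(@ler_pXn2r _ 2) ?nnegrE ?(ltW r2)// s2 exprMn.
  have := sqr_ge0 r; lra.
have h2 : s <= r by rewrite -(@ler_pXn2r _ 2) ?nnegrE ?(ltW r0)// s2; lra.
split=> //; rewrite ler_pdivlMr//.
apply: (@le_trans _ _ ((r - s) * (r + s))).
  by rewrite ler_wpM2l ?subr_ge0// lerDl.
have -> : (r - s) * (r + s) = r ^+ 2 - s ^+ 2 by ring.
by rewrite s2; lra.
Qed.

Definition boundary_target sig : R := (\sum_(k < p.+1) @tau R p r k * preg k (sig ^+ 2)) / (p.*2)`!%:R.

(** There is no error, even for sig larger than some of the radii, because the inside expansion is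
    used in place of [kappa]. *)
Lemma boundary_exact e (b : 'cV[R]_p.+1) sig : 
  bmat p r e *m b = \col_j (target p r j / (p.*2)`!%:R) ->
  radev (blist e (fun m => if insub m is Some i then b i 0 else 0)) (fun rho => radker 0 rho sig) =
  boundary_target sig.
Proof.
move=> hb; set bf := fun m : nat => _.
have bfE (m : 'I_p.+1) : bf m = b m 0 by rewrite /bf valK.
have E (k : 'I_p.+1) : radev (blist e bf) (psi k) = target p r k / (p.*2)`!%:R.
  have := congr1 (fun M : 'cV_p.+1 => M k 0) hb; rewrite !mxE => <-.
  rewrite radev_blist; apply: eq_bigr => m _; rewrite bfE mxE -/(@fpsi R k).
  by rewrite [LHS]mulrC mulrA mulrAC.
have -> : radev (blist e bf) (fun rho => radker 0 rho sig) =
  \sum_(k < p.+1) acoef k * preg k (sig ^+ 2) * radev (blist e bf) (psi k).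
  rewrite /radev; under [RHS]eq_bigr do rewrite mulr_sumr.
  rewrite exchange_big /=; apply: eq_bigr => a _; rewrite /radker mulr_sumr.
  by apply: eq_bigr => k _; rewrite addn0; ring.
rewrite /boundary_target mulr_suml; apply: eq_bigr => k _; rewrite E /target.
have a0 : acoef k != 0 by apply: acoef_neq0; rewrite -ltnS.
have : (p.*2)`!%:R != 0 :> R by rewrite pnatr_eq0 -lt0n fact_gt0.
move: ((p.*2)`!%:R : R) a0 => F a0 F0.
by field; do ?(apply/andP; split).
Qed.

(** The total variation is at most K e^(-p), and exchanging the inside expansion for [kappa] costs
    O(e^n) per unit of variation by [flip_bound]. Hence d is of order e^(p+1) and [rtv L * d] of
    order e. *)
Lemma boundary_layer (eta : R) : 0 < eta -> exists L : seq (R * R), exists d : R, [/\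
  forall a, a \in L -> 0 < a.2 <= r,
  `|rmass L - bvec r (bmat0 p r) ord0 0| <= eta,
  0 <= d <= eta, rtv L * d <= eta &
  forall sig, 0 < sig <= r -> `|radev L (fun rho => kappa rho sig) - boundary_target sig| <= d].
Proof.
move=> eta0; have r2 : 0 < r / 2 by rewrite divr_gt0.
have [C C0 hC] := @flip_bound R p (r / 2) r r2.
(* This bound on e gives e <= 1 and radii at least r / 2, away from the singularity of [psi] at
   0. *)
pose c0 : R := Num.min 1 (r ^+ 2 / (2 * p.+1%:R)).
have c00 : 0 < c0 by rewrite lt_min ltr01 divr_gt0 ?exprn_gt0// mulr_gt0.
pose e k : R := c0 * harmonic k.
have e0 k : 0 < e k by rewrite mulr_gt0// /harmonic /= invr_gt0.
have ec : e k @[k --> \oo] --> 0.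
  by rewrite -[X in _ --> X](mulr0 c0); apply: cvgM; [exact: cvg_cst|exact: cvg_harmonic].
have ec0 k : e k <= c0.
  by rewrite /e ler_piMr ?(ltW c00)// /harmonic /= invf_le1// ler1n.
have e1 k : e k <= 1 by apply: le_trans (ec0 k) _; rewrite ge_min lexx.
have pe k : p%:R * e k <= r ^+ 2 / 2.
  apply: (@le_trans _ _ (p.+1%:R * (r ^+ 2 / (2 * p.+1%:R)))).
    apply: ler_pM => //; [exact: ltW|by rewrite ler_nat|].
    by apply: le_trans (ec0 k) _; rewrite ge_min lexx orbT.
  have pn : p.+1%:R != 0 :> R by rewrite pnatr_eq0.
  move: pn; set P : R := p.+1%:R => pn; clearbody P.
  by rewrite le_eqVlt; apply/orP; left; apply/eqP; field.
pose bv k := bvec r (bmat p r (e k)).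
pose S := \sum_(i < p.+1) `|bvec r (bmat0 p r) i 0|.
have cS : \sum_(i < p.+1) `|bv k i 0| @[k --> \oo] --> S.
  by apply: cvg_sum_seq => i; apply: cvg_norm; exact: cvg_bvec.
have S0 : 0 <= S by rewrite sumr_ge0.
pose K := 2 ^+ p * (S + 1); have K0 : 0 <= K by rewrite mulr_ge0 ?exprn_ge0// addr_ge0.
pose K' := K * (C * (p%:R / r) ^+ n).
have K'0 : 0 <= K' by rewrite mulr_ge0// mulr_ge0// exprn_ge0// divr_ge0// ltW.
pose B := K' * (K + 1) + 1; have B0 : 0 < B by rewrite ltr_wpDl// mulr_ge0// addr_ge0.
have n1 : \forall k \near \oo, \det (bmat p r (e k)) != 0.
  have cd : \det (bmat p r (e k)) @[k --> \oo] --> \det (bmat0 p r).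
    by apply: cvg_det => i j; exact: cvg_bmat.
  exact: (cvgr_neq0 _ cd (det_bmat0_neq0 p r0)).
have n2 : \forall k \near \oo, \sum_(i < p.+1) `|bv k i 0| <= S + 1.
  by apply: (cvgr_le S cS); rewrite ltrDl.
have n3 : \forall k \near \oo, `|bvec r (bmat0 p r) ord0 0 - bv k ord0 0| <= eta.
  by have /cvgrPdist_le := @cvg_bvec R p r r0 e e0 ec ord0; apply.
have n4 : \forall k \near \oo, e k <= eta / B.
  have /cvgr0Pnorm_le/(_ (eta / B)) := ec; rewrite divr_gt0// => /(_ isT).
  by apply: filterS => k; rewrite ger0_norm// ltW.
near \oo => k.
have h1 : \det (bmat p r (e k)) != 0 by near: k.
have h2 : \sum_(i < p.+1) `|bv k i 0| <= S + 1 by near: k.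
have h3 : `|bvec r (bmat0 p r) ord0 0 - bv k ord0 0| <= eta by near: k.
have h4 : e k <= eta / B by near: k.
pose bf (m : nat) : R := if insub m is Some i then bv k i 0 else 0.
have bfE (m : 'I_p.+1) : bf m = bv k m 0 by rewrite /bf valK.
pose L := blist (e k) bf.
have ek0 := e0 k; have ek1 := e1 k.
have tvL : rtv L <= K / e k ^+ p.
  apply: le_trans (rtv_blist bf _) _; first by rewrite ek0.
  rewrite ler_wpM2r ?invr_ge0 ?exprn_ge0 ?(ltW ek0)//.
  rewrite ler_wpM2l ?exprn_ge0//; apply: le_trans h2.
  by apply: ler_sum => m _; rewrite bfE.
have hrad a : a \in L -> [/\ r / 2 <= a.2, a.2 <= r & r - a.2 <= p%:R * e k / r].
  by apply: blist_radius.
exists L; exists (K' * e k ^+ p.+1); split.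
- by move=> a /hrad[h5 h6 _]; rewrite h6 andbT (lt_le_trans r2).
- by rewrite rmass_blist (bfE ord0) distrC.
- rewrite mulr_ge0 ?exprn_ge0 ?(ltW ek0)//=.
  apply: (@le_trans _ _ (B * e k)); last by rewrite mulrC -ler_pdivlMr.
  rewrite exprSr mulrA ler_wpM2r ?(ltW ek0)//.
  apply: (@le_trans _ _ (K' * 1)); first by rewrite ler_wpM2l// exprn_ile1// ltW.
  rewrite /B mulrDr !mulr1 addrAC; have := mulr_ge0 K'0 K0; lra.
- apply: (@le_trans _ _ (K / e k ^+ p * (K' * e k ^+ p.+1))).
    by rewrite ler_wpM2r// mulr_ge0// exprn_ge0// ltW.
  apply: (@le_trans _ _ (B * e k)); last by rewrite mulrC -ler_pdivlMr.
  have -> : K / e k ^+ p * (K' * e k ^+ p.+1) = (K' * K) * e k.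
    by rewrite exprS; field; rewrite expf_neq0// gt_eqF.
  rewrite ler_wpM2r ?(ltW ek0)// /B; lra.
move=> sig /andP[s0 sr].
have q0 := divr_ge0 (mulr_ge0 (ler0n R p) (ltW ek0)) (ltW r0).
have ex := @boundary_exact (e k) (bv k) sig (bvec_solves r h1).
rewrite -ex -/bf -/L.
apply: (@le_trans _ _ (rtv L * (C * (p%:R * e k / r) ^+ n))).
  apply: radev_dist => a aL; have [a1 a2 a3] := hrad a aL.
  have bd0 : 0 <= C * (p%:R * e k / r) ^+ n.
    by rewrite mulr_ge0// exprn_ge0.
  (* Only spheres of radius below sig contribute an error. *)
  rewrite /kappa; have [_|as_] := leP sig a.2; first by rewrite subrr normr0.
  rewrite distrC; apply: le_trans (hC a.2 sig _ _) _.
  - by rewrite a1.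
  - by rewrite sr andbT (le_trans a1)// ltW.
  rewrite ler_wpM2l// lerXn2r ?nnegrE ?normr_ge0//.
  by rewrite ger0_norm ?subr_ge0 ?(ltW as_)//; lra.
apply: (@le_trans _ _ (K / e k ^+ p * (C * (p%:R * e k / r) ^+ n))).
  by rewrite ler_wpM2r// mulr_ge0// exprn_ge0.
rewrite le_eqVlt; apply/orP; left; apply/eqP.
have -> : (p%:R * e k / r) ^+ n = (p%:R / r) ^+ n * (e k ^+ p * e k ^+ p.+1).
  by rewrite mulrAC exprMn -exprD addnS addnn.
have ekp : e k ^+ p != 0 by rewrite expf_neq0// gt_eqF.
rewrite /K'; move: ((p%:R / r) ^+ n) (e k ^+ p.+1) => X Y.
by field.
Unshelve. all: by end_near.
Qed.

End RadialMeasures.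

(** * Approximate weightings of the ball *)

Section RadialWeighting.
Variables (R : realType) (p : nat) (r : R).
Hypothesis r0 : 0 < r.
Local Notation n := (p.*2.+1).
Local Notation kappa := (@kappa R p).
Local Notation limit_mass := (r ^+ n / n`!%:R + bvec r (bmat0 p r) ord0 0).
Implicit Types (L : seq (R * R)) (sig rho : R) (x y : 'rV[R]_n) (V W : seq (R * 'rV[R]_n)).

Let F : R := (p.*2)`!%:R.
Let F0 : 0 < F. Proof. by rewrite ltr0n fact_gt0. Qed.

Definition interior_list (Q : nat) : seq (R * R) :=
  [seq ((i.+1%:R * (r / Q%:R)) ^+ p.*2 * (r / Q%:R) / F, i.+1%:R * (r / Q%:R)) | i <- iota 0 Q].

Lemma radev_interior_list Q f : radev (interior_list Q) f =
  (\sum_(i < Q) (i.+1%:R * (r / Q%:R)) ^+ p.*2 * (r / Q%:R) * f (i.+1%:R * (r / Q%:R))) / F.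
Proof.
rewrite /radev /interior_list big_map mulr_suml.
have -> : iota 0 Q = index_iota 0 Q by rewrite /index_iota subn0.
rewrite big_mkord.
by apply: eq_bigr => i _ /=; rewrite mulrAC.
Qed.

Lemma rmass_radev L : rmass L = radev L (fun=> 1).
Proof. by apply: eq_bigr => a _; rewrite mulr1. Qed.

Lemma interior_list_radius Q a : a \in interior_list Q -> 0 <= a.1 /\ 0 < a.2 <= r.
Proof.
move=> /mapP[i iQ ->] /=; have {}iQ : (i < Q)%N by move: iQ; rewrite mem_iota.
have Q0 : 0 < Q%:R :> R by rewrite ltr0n (leq_trans _ iQ).
have t0 : 0 < i.+1%:R * (r / Q%:R) by rewrite mulr_gt0// divr_gt0.
split; first by rewrite divr_ge0 ?(ltW F0)// mulr_ge0 ?exprn_ge0 ?(ltW t0)// divr_ge0// ltW.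
rewrite t0 /= mulrA ler_pdivrMr// mulrC ler_wpM2l ?ler_nat//; exact: ltW.
Qed.

Lemma interior_layer : exists2 C : R, 0 <= C & forall Q : nat, (0 < Q)%N ->
  `|rmass (interior_list Q) - r ^+ n / n`!%:R| <= C / Q%:R /\
  (forall sig, 0 < sig <= r ->
    `|radev (interior_list Q) (fun rho => kappa rho sig) - (1 - boundary_target p r sig)| <= C / Q%:R).
Proof.
have [C1 C10 h1] := interior_riemann p r0; have [C2 C20 h2] := mass_riemann p r0.
have C3 : 0 <= C1 + C2 by rewrite addr_ge0.
exists ((C1 + C2) / F) => [|Q Q0]; first by rewrite divr_ge0// ltW.
have Q1 : 0 <= Q%:R^-1 :> R by rewrite invr_ge0.
have aux (a b c : R) : c <= C1 + C2 -> `|a - b| <= c / Q%:R -> `|a / F - b / F| <= (C1 + C2) / F / Q%:R.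
  move=> cC h; rewrite -mulrBl normrM normfV (gtr0_norm F0) mulrAC ler_wpM2r ?invr_ge0 ?(ltW F0)//.
  by apply: le_trans h _; rewrite ler_wpM2r.
split=> [|sig sr].
  rewrite rmass_radev radev_interior_list; under eq_bigr do rewrite mulr1.
  have -> : r ^+ n / n`!%:R = r ^+ n / n%:R / F.
    by rewrite factS natrM invfM mulrA.
  by apply: (aux _ _ C2); [rewrite lerDr|exact: h2].
rewrite radev_interior_list.
have -> : 1 - boundary_target p r sig = prim_out p sig r / F.
  by rewrite prim_outE /boundary_target mulrBl -/F divff// gt_eqF.
by apply: (aux _ _ C1); [rewrite lerDl|exact: h1].
Qed.

Lemma rmass_ge0 L : (forall a, a \in L -> 0 <= a.1) -> rtv L = rmass L.
Proof. by move=> h; apply: eq_big_seq => a /h; exact: ger0_norm. Qed.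

(** The interior estimate covers sig > 0 only; the Lipschitz property of [kappa] carries it to the
    centre. *)
Lemma radev_kappa_at0 L d : (forall a, a \in L -> 0 < a.2) ->
  (forall sig, 0 < sig <= r -> `|radev L (fun rho => kappa rho sig) - 1| <= d) ->
  `|radev L (fun rho => kappa rho 0) - 1| <= d.
Proof.
move=> hL h; apply/ler_addgt0Pl => e e0.
pose T := rtv L + 1; have T0 : 0 < T by rewrite ltr_wpDl// rtv_ge0.
pose s := Num.min r (e / T).
have s0 : 0 < s by rewrite lt_min r0 divr_gt0.
have sr : 0 < s <= r by rewrite s0 ge_min lexx.
have -> : radev L (fun rho => kappa rho 0) - 1 =
  (radev L (fun rho => kappa rho 0) - radev L (fun rho => kappa rho s)) +
  (radev L (fun rho => kappa rho s) - 1) by ring.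
apply: le_trans (ler_normD _ _) _; apply: lerD; last exact: h.
apply: le_trans (radev_dist (d := s) _) _ => [a /hL a0|].
  by apply: le_trans (kappa_lipschitz p a0 (lexx 0) (ltW s0)) _; rewrite sub0r normrN gtr0_norm.
apply: (@le_trans _ _ (T * (e / T))); last by rewrite mulrC divfK// gt_eqF.
apply: ler_pM; [exact: rtv_ge0|exact: ltW|by rewrite lerDl|by rewrite ge_min lexx orbT].
Qed.

(** The total variation of each layer multiplies the error of the other. [T0] bounds the variation
    of all interior layers beforehand, the boundary layer is chosen against [T0], and Q against the
    variation of the boundary layer. *)
Lemma radial_weighting (eta : R) : 0 < eta -> exists L : seq (R * R), exists d : R, [/\
  forall a, a \in L -> 0 < a.2 <= r,
  `|rmass L - limit_mass| <= eta,
  0 <= d <= eta, rtv L * d <= eta &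
  forall sig, 0 <= sig <= r -> `|radev L (fun rho => kappa rho sig) - 1| <= d].
Proof.
move=> eta0; have [C C0 hC] := interior_layer.
pose v0 := r ^+ n / n`!%:R.
have v00 : 0 <= v0 by rewrite divr_ge0// exprn_ge0// ltW.
pose T0 := C + v0 + 1; have T01 : 1 <= T0 by rewrite lerDr addr_ge0.
have T00 : 0 < T0 by exact: lt_le_trans T01.
have e1 : 0 < eta / 4 / T0 by rewrite !divr_gt0.
have [Lb [db [hb1 hb2 /andP[db0 db1] hb3 hb4]]] := boundary_layer p r0 e1.
have e1T : eta / 4 / T0 * T0 = eta / 4 by rewrite divfK// gt_eqF.
have e1e : eta / 4 / T0 <= eta / 4 by rewrite ler_pdivrMr// ler_peMr// divr_ge0// ltW.
pose T := rtv Lb + T0; have T1 : 1 <= T by rewrite (le_trans T01)// lerDr rtv_ge0.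
have Tp : 0 < T by exact: lt_le_trans T1.
have e2 : 0 < eta / 4 / T by rewrite !divr_gt0.
have e2T : T * (eta / 4 / T) = eta / 4 by rewrite mulrC divfK// gt_eqF.
have e2e : eta / 4 / T <= eta / 4 by rewrite ler_pdivrMr// ler_peMr// divr_ge0// ltW.
pose Q := (Num.bound (C / (eta / 4 / T))).+1.
have Q0 : (0 < Q)%N by [].
have CQ0 : 0 <= C / Q%:R by rewrite divr_ge0.
have CQ : C / Q%:R <= eta / 4 / T.
  rewrite ler_pdivrMr ?ltr0n// mulrC -ler_pdivrMr//.
  apply: le_trans (ltW (archi_boundP _)) _; first by rewrite divr_ge0// ltW.
  by rewrite ler_nat.
have [hm hp] := hC Q Q0.
have hC1 : C / Q%:R <= C by rewrite ler_pdivrMr ?ltr0n// ler_peMr// ler1n.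
have tvI : rtv (interior_list Q) <= C + v0.
  rewrite rmass_ge0 => [|a /interior_list_radius[]//].
  by move: hm; rewrite -/v0 ler_norml; lra.
have tvI0 := rtv_ge0 (interior_list Q); have tvb := rtv_ge0 Lb.
have rtvE : rtv (interior_list Q ++ Lb) = rtv (interior_list Q) + rtv Lb by exact: big_cat.
have hrad a : a \in interior_list Q ++ Lb -> 0 < a.2 <= r.
  by rewrite mem_cat => /orP[/interior_list_radius[]|/hb1].
have hpos sig : 0 < sig <= r ->
    `|radev (interior_list Q ++ Lb) (fun rho => kappa rho sig) - 1| <= db + C / Q%:R.
  move=> sr; rewrite radev_cat.
  have h1 := hp sig sr; have h2 := hb4 sig sr.
  set A := radev _ _ in h1 *; set B := radev _ _ in h2 *; set G := boundary_target _ _ _ in h1 h2.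
  have -> : A + B - 1 = (B - G) + (A - (1 - G)) by ring.
  by apply: le_trans (ler_normD _ _) _; apply: lerD.
exists (interior_list Q ++ Lb), (db + C / Q%:R); split=> //.
- have -> : rmass (interior_list Q ++ Lb) = rmass (interior_list Q) + rmass Lb by exact: big_cat.
  have -> (a b c d : R) : a + b - (c + d) = (a - c) + (b - d) by ring.
  by apply: le_trans (ler_normD _ _) _; lra.
- by apply/andP; split; lra.
- rewrite rtvE mulrDr !mulrDl.
  have : rtv (interior_list Q) * db <= eta / 4.
    by rewrite -e1T mulrC; apply: ler_pM => //; rewrite /T0; lra.
  have : (rtv (interior_list Q) + rtv Lb) * (C / Q%:R) <= eta / 4.
    by rewrite -e2T; apply: ler_pM => //; rewrite ?addr_ge0// /T /T0; lra.
  rewrite mulrDl; lra.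
move=> sig /andP[]; rewrite le_eqVlt => /orP[/eqP <-|s0] sr; last by apply: hpos; rewrite s0.
by apply: radev_kappa_at0 => // a /hrad/andP[].
Qed.

Lemma realize_radial L (delta : R) : 0 < delta -> (forall a, a \in L -> 0 < a.2 <= r) ->
  exists V, [/\ forall a, a \in V -> nrm a.2 <= r, mass V = rmass L, tvar V = rtv L &
    forall x, `|pot V x - radev L (fun rho => kappa rho (nrm x))| <= rtv L * delta].
Proof.
move=> d0; elim: L => [|[c rho] L IH] hL.
  exists [::]; split=> //; rewrite /mass /rmass /tvar /rtv ?big_nil// => x.
  by rewrite /pot /ev /radev !big_nil subrr normr0 mul0r.
have [V [V1 V2 V3 V4]] : exists V, [/\ forall a, a \in V -> nrm a.2 <= r, mass V = rmass L,
    tvar V = rtv L &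
    forall x, `|pot V x - radev L (fun rho => kappa rho (nrm x))| <= rtv L * delta].
  by apply: IH => a aL; apply: hL; rewrite inE aL orbT.
have /andP[/= rho0 rhor] := hL (c, rho) (mem_head _ _).
have [mu pm hm] := @shell_approx R p rho delta rho0 d0.
have [pm1 pm2] := pm.
exists (scalem c mu ++ V); split.
- move=> a; rewrite mem_cat => /orP[/mapP[b bm ->]|/V1//] /=.
  by have [_ bs] := pm1 b bm; rewrite (nrm_sph rho0 bs).
- by rewrite mass_cat mass_scale pm2 mulr1 V2 /rmass big_cons.
- by rewrite tvar_cat tvar_scale (sphere_prob_tvar pm) mulr1 V3 /rtv big_cons.
move=> x; rewrite pot_cat pot_scale /radev big_cons /= -/(radev _ _) /rtv big_cons /= -/(rtv L) mulrDl.
have -> (a b e f : R) : a + b - (e + f) = (a - e) + (b - f) by ring.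
apply: le_trans (ler_normD _ _) _; apply: lerD; last exact: V4.
by rewrite -mulrBr normrM ler_wpM2l.
Qed.

(** Energy minus mass is the integral of [pot V] - 1 against V, at most the total variation times
    the uniform error; hence the control of [rtv L * d]. *)
Lemma approximate_weighting (eta : R) : 0 < eta -> exists V, [/\
  forall a, a \in V -> nrm a.2 <= r,
  `|mass V - limit_mass| <= eta,
  `|ip V V - limit_mass| <= eta &
  forall x, nrm x <= r -> `|pot V x - 1| <= eta].
Proof.
move=> eta0; have e3 : 0 < eta / 3 by rewrite divr_gt0.
have [L [d [h1 h2 /andP[d0 d1] h3 h4]]] := radial_weighting e3.
pose T := rtv L + 1; have T1 : 1 <= T by rewrite lerDr rtv_ge0.
have T0 : 0 < T by exact: lt_le_trans T1.
pose delta := eta / 3 / (T * T).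
have delta0 : 0 < delta by rewrite divr_gt0// mulr_gt0.
have LT : rtv L <= T by rewrite lerDl.
have dT2 : T * (T * delta) = eta / 3 by rewrite mulrA mulrC divfK// gt_eqF// mulr_gt0.
have b1 : rtv L * (rtv L * delta) <= eta / 3.
  rewrite -dT2; apply: ler_pM => //; rewrite ?rtv_ge0//.
    by rewrite mulr_ge0 ?rtv_ge0// ltW.
  by rewrite ler_wpM2r// ltW.
have b2 : rtv L * delta <= eta / 3.
  rewrite -dT2; apply: (@le_trans _ _ (T * delta)); first by rewrite ler_wpM2r// ltW.
  by rewrite ler_peMl// mulr_ge0// ltW.
have [V [V1 V2 V3 V4]] := realize_radial delta0 h1.
have hpot x : nrm x <= r -> `|pot V x - 1| <= d + rtv L * delta.
  move=> xr; have := h4 (nrm x); rewrite nrm_ge0 xr => /(_ isT) k1; have k2 := V4 x.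
  set K := radev _ _ in k1 k2.
  have -> : pot V x - 1 = (K - 1) + (pot V x - K) by ring.
  by apply: le_trans (ler_normD _ _) _; apply: lerD.
exists V; split=> //.
- by rewrite V2; lra.
- have hip : `|ip V V - mass V| <= eta / 3 + eta / 3.
    have -> : ip V V - mass V = ev V (fun x => pot V x - 1).
      by rewrite evD ev_cst mulrN1.
    apply: le_trans (ev_bound (e := d + rtv L * delta) _) _ => [a aV|]; first by apply: hpot; exact: V1.
    by rewrite V3 mulrDr; apply: lerD.
  have -> : ip V V - limit_mass = (ip V V - mass V) + (mass V - limit_mass) by ring.
  by apply: le_trans (ler_normD _ _) _; rewrite V2 in hip *; lra.
by move=> x /hpot h; apply: le_trans h _; lra.
Qed.

End RadialWeighting.

(** * Comparison with weightings of finite sets *)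

Section WeightingComparison.
Variables (R : realType) (n : nat) (A : {fset 'rV[R]_n}) (w : 'rV[R]_n -> R).
Hypothesis wA : is_weighting A w.
Implicit Types (x y : 'rV[R]_n) (V : seq (R * 'rV[R]_n)).

Definition weighting_measure : seq (R * 'rV[R]_n) := [seq (w x, x) | x <- enum_fset A].
Local Notation W := weighting_measure.
Local Notation m := (\sum_(x <- A) w x).

Lemma weighting_measure_mem a : a \in W -> a.2 \in A.
Proof. by case/mapP => x xA ->. Qed.

Lemma pot_weighting_measure s : s \in A -> pot W s = 1.
Proof.
move=> sA; rewrite -(wA sA) /pot /ev big_map; apply: eq_bigr => x _ /=.
by rewrite kerC.
Qed.

Lemma mass_weighting_measure : mass W = m.
Proof. by rewrite /mass big_map. Qed.

Lemma ip_weighting_measure : ip W W = m.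
Proof.
rewrite -mass_weighting_measure -[RHS]mulr1 -ev_cst; apply: eq_in_ev => a aW.
exact/pot_weighting_measure/weighting_measure_mem.
Qed.

Lemma ip_sub V U : ip (V ++ scalem (-1) U) (V ++ scalem (-1) U) = ip V V - 2 * ip U V + ip U U.
Proof. by rewrite !ip_catl !ip_catr !ip_scalel !ip_scaler (ipC V U); ring. Qed.

(** The energy of V - W is nonnegative. W has energy m, and its pairing with V is m up to tvar W *
    eta, since [pot V] is nearly 1 on A. *)
Lemma weighting_mass_le V (v eta : R) : (forall a, a \in A -> `|pot V a - 1| <= eta) ->
  ip V V <= v + eta -> m <= v + (1 + 2 * tvar W) * eta.
Proof.
move=> hV VV; have := ip_ge0 (V ++ scalem (-1) W); rewrite ip_sub ip_weighting_measure.
have : `|ip W V - mass W| <= tvar W * eta.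
  have -> : ip W V - mass W = ev W (fun x => pot V x - 1) by rewrite evD ev_cst mulrN1.
  by apply: ev_bound => a aW; apply/hV/weighting_measure_mem.
by rewrite mass_weighting_measure ler_norml => /andP[h _]; nra.
Qed.

Lemma weighting_mass_ge0 : 0 <= m.
Proof. by rewrite -ip_weighting_measure ip_ge0. Qed.

(** The deviation is the pairing of W with the difference of unit atoms at y and a, whose energy is
    2 - 2 exp (- |y - a|). Cauchy-Schwarz bounds it by the energy m of W, with no reference to its
    total variation. *)
Lemma pot_weighting_measure_dist y a : a \in A -> `|pot W y - 1| ^+ 2 <= 2 * edist y a * m.
Proof.
move=> aA; pose D : seq (R * 'rV[R]_n) := [:: (1, y); (-1, a)].
have DW U : ip D U = pot U y - pot U a.
  by rewrite /ip /ev !big_cons big_nil /= mul1r mulN1r addr0.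
have -> : pot W y - 1 = ip D W by rewrite DW (pot_weighting_measure aA).
rewrite real_normK ?num_real//; apply: le_trans (ip_cauchy_schwarz _ _) _.
rewrite ip_weighting_measure; apply: ler_wpM2r; first exact: weighting_mass_ge0.
have pD x : pot D x = ker x y - ker x a.
  by rewrite /pot /ev !big_cons big_nil /= mul1r mulN1r addr0.
rewrite DW !pD !kerxx (kerC a y).
have := expR_ge1Dx (- edist y a); rewrite -/(ker y a); lra.
Qed.

(** The same square, with the pairing now evaluated on V, where [pot W] is nearly 1. *)
Lemma weighting_mass_ge V (e : R) :
  (forall a, a \in V -> `|pot W a.2 - 1| <= e) ->
  2 * (mass V - tvar V * e) - ip V V <= m.
Proof.
move=> hV; have := ip_ge0 (V ++ scalem (-1) W); rewrite ip_sub ip_weighting_measure ipC.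
have : `|ip V W - mass V| <= tvar V * e.
  have -> : ip V W - mass V = ev V (fun x => pot W x - 1) by rewrite evD ev_cst mulrN1.
  exact: ev_bound.
by rewrite ler_norml => /andP[h _]; lra.
Qed.

End WeightingComparison.

Lemma closed_ball_euclE (R : realType) (n : nat) (r : R) (x : 'rV[R]_n) :
  closed_ball_eucl n r x <-> nrm x <= r.
Proof. by rewrite /closed_ball_eucl /= edistE subr0. Qed.

Theorem theorem1p8 (R : realType) (p : nat) (r : R) (hr : 0 < r) :
  has_magnitude (closed_ball_eucl (p.*2.+1) r)
    (\det (\matrix_(i < p.+1, j < p.+1) chiR (i + j + 2) r) /
     (((p.*2.+1)`!)%:R * r *
      \det (\matrix_(i < p.+1, j < p.+1) chiR (i + j) r))).
Proof.
rewrite -bvec0_magnitude//; set v : R := _ + _.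
move=> A m AB Ah Am.
(* The accuracy of V is adapted to the total variation of the weighting of [A i]; the bound holds
   for each i, not only in the limit. *)
have mle i : m i <= v.
  have [w [wA ->]] := Am i; apply/ler_addgt0Pl => e e0; set W := weighting_measure (A i) w.
  have T0 : 0 < 1 + 2 * tvar W by have := tvar_ge0 W; lra.
  have [V [_ _ hV hp]] := approximate_weighting p hr (divr_gt0 e0 T0).
  have VV : ip V V <= v + e / (1 + 2 * tvar W) by move: hV; rewrite ler_norml -/v; lra.
  apply: le_trans (weighting_mass_le wA _ VV) _ => [a /AB/closed_ball_euclE|]; first exact: hp.
  by rewrite [leRHS]addrC lerD2l mulrC divfK ?gt_eqF.
have v0 : 0 <= v.
  by apply: le_trans (mle 0%N); have [w [wA ->]] := Am 0%N; exact: weighting_mass_ge0 wA.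
apply/cvgrPdist_le => e e0.
have e8 : 0 < e / 8 by rewrite divr_gt0.
have [V [Vr hm hV _]] := approximate_weighting p hr e8.
pose T := tvar V + 1; have T0 : 0 < T by rewrite ltr_wpDl// tvar_ge0.
pose q := e / 8 / T; have q0 : 0 < q by rewrite divr_gt0.
(* At this Hausdorff distance the bound 2 z (v + 1) on the squared deviation of the potential is
   q^2; it does not depend on i because m i <= v. *)
pose z := q ^+ 2 / (2 * (v + 1)).
have v1 : 0 < 2 * (v + 1) by rewrite mulr_gt0// ltr_wpDl.
have z0 : 0 < z by rewrite divr_gt0// exprn_gt0.
have [N hN] := Ah z z0.
exists N => //= i /hN[hA _]; rewrite ger0_norm ?subr_ge0//.
have mi := mle i; have [w [wA mE]] := Am i.
suff : 2 * (mass V - tvar V * q) - ip V V <= m i.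
  have : tvar V * q <= e / 8.
    apply: (@le_trans _ _ (T * q)); first by rewrite ler_wpM2r ?lerDl// ltW.
    by rewrite /q mulrC divfK// gt_eqF.
  by move: hm hV; rewrite -/v !ler_norml; lra.
rewrite mE; apply: (weighting_mass_ge wA) => b bV.
have [a aA ya] := hA b.2 (proj2 (closed_ball_euclE r b.2) (Vr b bV)).
rewrite -(@ler_pXn2r _ 2) ?nnegrE ?normr_ge0 ?(ltW q0)//.
apply: le_trans (pot_weighting_measure_dist wA _ aA) _; rewrite -mE.
have m0 : 0 <= m i by rewrite mE; exact: weighting_mass_ge0 wA.
apply: (@le_trans _ _ (2 * z * (v + 1))).
  apply: ler_pM => //; [|by rewrite ler_wpM2l// ltW|lra].
  by rewrite mulr_ge0// edist_ge0.
by rewrite mulrAC mulrC divfK// gt_eqF.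
Qed.
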